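(* Let $(Y_t)_{t\ge0}$ be Brownian motion on the weighted metric graph $\mathcal X_{\text{loop}}(\Gamma,\ell,p,\omega)$. Let $x\in G$ be a vertex whose distinct neighbours in $\Gamma$ are $x_1,\dots,x_k$ ($k\ge1$), and let $T$ be the first time $Y$ hits $\{x_1,\dots,x_k\}$. Then $$\mathbb E^xT=\frac{\sum_{e\in E_{\text{loop}}(x)}\omega(e)q(e)\ell(e)}{\sum_{e\in E(x)}q(e)/\ell(e)}.$$
   Context: $\Gamma=(G,E)$ is an unoriented, connected, countable, locally finite graph without loops or multiple edges. $\Gamma_{\text{loop}}=(G,E_{\text{loop}})$ is obtained by adding one loop edge $x_{\text{loop}}$ at every vertex $x$. $E(x)$ is the set of non-loop edges incident to $x$, and $E_{\text{loop}}(x)=E(x)\cup\{x_{\text{loop}}\}$. Each $e\in E_{\text{loop}}$ has a length $\ell(e)\in(0,\infty)$, a jump conductance $p(e)>0$ and an edge density $\omega(e)>0$. The weighted metric graph $\mathcal X_{\text{loop}}(\Gamma,\ell,p,\omega)$ is obtained by identifying each edge $e$ with a copy $I(e)$ of $[0,\ell(e)]$, glued at common vertices (both ends of a loop at $x$ are identified with $x$). Let $m$ be Lebesgue measure on edges and $\mu(dx)=\sum_e\mathbf 1_{I(e)}(x)p(e)\omega(e)m(dx)$. Brownian motion $(Y_t)$ on it is the strong Markov diffusion associated with the Dirichlet form $\mathcal E(f,g)=\frac12\sum_{e}\int_{I(e)}f'g'\,p(e)\,dm$ on $L^2(\mu)$, whose domain consists of the continuous functions that are uniform limits of compactly supported continuous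 functions, lie in $W^{1,2}$ on every edge, and have finite total $W^{1,2}$ norm squared $\sum_e\|f\|^2_{W^{1,2}(I(e),\mu)}$. Its generator acts as $\frac1{2\omega(e)}u''$ on $I(e)$, with the condition at each vertex $x$ that $\sum_{e\in E(x)}p(e)u'_e(x)+p(x_{\text{loop}})u_1'(x_{\text{loop}})+p(x_{\text{loop}})u_2'(x_{\text{loop}})=0$, where $u'_e(x)$ is the derivative at $x$ in the direction of $e$ and $u_1',u_2'$ are the derivatives at $x$ into the two ends of the loop. Set $q(e)=p(e)$ for non-loop edges and $q(e)=2p(e)$ for loop edges. $\mathbb E^x$ is expectation for $Y$ started at $x$. *)

(* Defs.v *)
From HB Require Import structures.
From mathcomp Require Import all_boot all_order all_algebra.
From mathcomp Require Import all_classical all_reals all_analysis.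
From mathcomp Require Import measurable_realfun.
Set Implicit Arguments.
Unset Strict Implicit.
Unset Printing Implicit Defensive.
Import Order.TTheory GRing.Theory Num.Theory.
Import numFieldNormedType.Exports.
Local Open Scope classical_set_scope.
Local Open Scope ring_scope.

(* Edges are unoriented: [src] and [tgt] only fix, for each edge e, which of
   its two ends is the point 0 of the interval I(e). The vertex [root] records
   that the graph is nonempty; it serves as default value. *)
Record graph := Graph {
  vert : countType;
  edge : countType;
  src : edge -> vert;
  tgt : edge -> vert;
  root : vert }.

Section graph_notions.
Variable G : graph.
Implicit Types (x y : vert G) (e : edge G).

Definition joins e x y : Prop :=
  (src e = x /\ tgt e = y) \/ (src e = y /\ tgt e = x).

Definition neighbours x y : Prop := exists e, joins e x y.

Definition no_loops : Prop := forall e, src e <> tgt e.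

Definition no_multiple_edges : Prop :=
  forall e e' x y, joins e x y -> joins e' x y -> e = e'.

Definition locally_finite : Prop :=
  forall x, finite_set [set e | src e = x \/ tgt e = x].

Definition connected_graph : Prop :=
  forall x y, exists s : seq (vert G),
    path (fun u v => `[< neighbours u v >]) x s && (last x s == y).

(* E_loop: [inl e] is the edge e of the graph, [inr x] is the loop at x. *)
Definition loop_edge : Type := (edge G + vert G)%type.

HB.instance Definition _ := Countable.on loop_edge.

Definition lsrc (e : loop_edge) : vert G :=
  match e with inl e => src e | inr x => x end.

Definition ltgt (e : loop_edge) : vert G :=
  match e with inl e => tgt e | inr x => x end.

Definition is_loop (e : loop_edge) : bool := if e is inr _ then true else false.

Definition star x : set loop_edge :=
  [set inl e | e in [set e | src e = x \/ tgt e = x]].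

Definition star_loop x : set loop_edge := inr x |` star x.

End graph_notions.

Record weighted_graph (R : realType) := WeightedGraph {
  wgraph :> graph;
  wgraph_no_loops : no_loops wgraph;
  wgraph_no_multiple_edges : no_multiple_edges wgraph;
  wgraph_locally_finite : locally_finite wgraph;
  wgraph_connected : connected_graph wgraph;
  len : loop_edge wgraph -> {posnum R};
  cond : loop_edge wgraph -> {posnum R};
  dens : loop_edge wgraph -> {posnum R} }.

Definition qcond (R : realType) (W : weighted_graph R) (e : loop_edge W) : R :=
  if is_loop e then 2 * (cond e)%:num else (cond e)%:num.

Section metric_graph.
Variables (R : realType) (W : weighted_graph R).

(* A point is a vertex, or a pair (e, s) with 0 < s < len e. *)
Definition metric_graph : Type :=
  (vert W + {a : loop_edge W * R | 0 < a.2 < (len a.1)%:num})%type.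

HB.instance Definition _ := Choice.on metric_graph.

Definition vertex (x : vert W) : metric_graph := inl x.

(* The copy I(e) of [0, len e]; outside of this interval the chart is extended
   by its values at the two ends. *)
Definition chart (e : loop_edge W) (s : R) : metric_graph :=
  if s <= 0 then vertex (lsrc e)
  else if insub (e, s) is Some a then inr a else vertex (ltgt e).

(* The quotient topology. As [chart e] factors through the retraction of R onto
   [0, len e], requiring that the preimage be open in R is the same as requiring
   that its trace on [0, len e] be relatively open. *)
Definition metric_graph_open (U : set metric_graph) : Prop :=
  forall e, open (chart e @^-1` U).

Let open_setT : metric_graph_open setT.
Proof. by move=> e; rewrite preimage_setT; exact: openT. Qed.

Let open_setI : setI_closed metric_graph_open.
Proof. by move=> A B oA oB e; rewrite preimage_setI; exact: openI. Qed.

Let open_bigcup (I : Type) (f : I -> set metric_graph) :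
  (forall i, metric_graph_open (f i)) -> metric_graph_open (\bigcup_i f i).
Proof.
by move=> of_ e; rewrite preimage_bigcup; apply: bigcup_open => i _; exact: of_.
Qed.

HB.instance Definition _ :=
  isOpenTopological.Build metric_graph open_setT open_setI open_bigcup.
HB.instance Definition _ := isPointed.Build metric_graph (vertex (root W)).

HB.instance Definition _ := @isMeasurable.Build
  (sigma_display (@open metric_graph)) metric_graph <<s @open metric_graph >>
  (@sigma_algebra0 _ setT _) (@sigma_algebraC _ _)
  (@sigma_algebra_bigcup _ setT _).

Lemma measurable_chart (e : loop_edge W) :
  measurable_fun setT (chart e : measurableTypeR R -> metric_graph).
Proof.
apply: (@measurability _ _ _ _ _ _ (@open metric_graph)) => //.
by move=> _ [U oU <-]; rewrite setTI; apply: open_measurable; exact: oU.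
Qed.

HB.instance Definition _ (e : loop_edge W) :=
  isMeasurableFun.Build _ _ _ _ (chart e : measurableTypeR R -> metric_graph)
    (measurable_chart e).

(* The state space X together with a cemetery None, the point at infinity
   (an isolated point if X is compact). *)
Definition state : Type := one_point_compactification metric_graph.

HB.instance Definition _ := Topological.on state.
HB.instance Definition _ := Pointed.on state.

HB.instance Definition _ := @isMeasurable.Build
  (sigma_display (@open state)) state <<s @open state >>
  (@sigma_algebra0 _ setT _) (@sigma_algebraC _ _)
  (@sigma_algebra_bigcup _ setT _).

Definition edge_lebesgue (e : loop_edge W) : set metric_graph -> \bar R :=
  pushforward
    (mrestr (@lebesgue_measure R) (measurable_itv `[0, (len e)%:num]))
    (chart e).

Section edge_lebesgue_measure.
Variable e : loop_edge W.

Let edge_lebesgue0 : edge_lebesgue e set0 = 0%E.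
Proof. exact: measure0. Qed.

Let edge_lebesgue_ge0 A : (0 <= edge_lebesgue e A)%E.
Proof. exact: measure_ge0. Qed.

Let edge_lebesgue_sigma_additive : semi_sigma_additive (edge_lebesgue e).
Proof. exact: measure_semi_sigma_additive. Qed.

HB.instance Definition _ := isMeasure.Build _ _ _ (edge_lebesgue e)
  edge_lebesgue0 edge_lebesgue_ge0 edge_lebesgue_sigma_additive.

End edge_lebesgue_measure.

(* The sum over all edges e of c(e) times Lebesgue measure on I(e); the sum runs
   over the numbers of the edges in an enumeration ([pickle_inv], unlike
   [unpickle], hits each edge exactly once). *)
Definition edge_measure (c : loop_edge W -> {nonneg R}) :
    {measure set metric_graph -> \bar R} :=
  mseries (fun n : nat =>
    if pickle_inv n is Some e then mscale (c e) (edge_lebesgue e)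
    else mzero) 0.

Definition graph_measure : {measure set metric_graph -> \bar R} :=
  edge_measure (fun e => ((cond e)%:num * (dens e)%:num)%:nng).

Definition energy_measure : {measure set metric_graph -> \bar R} :=
  edge_measure (fun e => (cond e)%:num%:nng).

Implicit Types f g h : metric_graph -> R.

(* The test functions of class C^1 with compact support in ]0, l[. *)
Definition test_function (l : R) (psi : R -> R) : Prop :=
  [/\ forall s, derivable psi s 1, continuous (derive1 psi) &
      exists a b, [/\ 0 < a, b < l & forall s, psi s != 0 -> a <= s <= b]].

(* h is a weak derivative of f, in L^2 of every edge. On I(e) it is taken in
   the direction of [chart e]; the values at the vertices are irrelevant. *)
Definition is_weak_derivative f h : Prop :=
  measurable_fun setT h /\
  forall e, let l := (len e)%:num in
    (\int[@lebesgue_measure R]_(s in `[0%R, l]) (h (chart e s) ^+ 2)%:E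
       < +oo)%E /\
    forall psi, test_function l psi ->
      \int[@lebesgue_measure R]_(s in `[0, l]) (f (chart e s) * derive1 psi s) =
      - \int[@lebesgue_measure R]_(s in `[0, l]) (h (chart e s) * psi s).

(* For a continuous f: f is in W^{1,2}(I(e)) for every edge e. *)
Definition edgewise_W12 f : Prop := exists h, is_weak_derivative f h.

Definition weak_derivative f : metric_graph -> R :=
  xget (fun=> 0) [set h | is_weak_derivative f h].

(* (1/2) sum_e int_{I(e)} f' g' p(e) dm. *)
Definition energy f g : R :=
  2^-1 * \int[energy_measure]_x (weak_derivative f x * weak_derivative g x).

Definition compactly_supported f : Prop :=
  compact (closure [set x | f x != 0]).

Definition vanishes_at_infinity f : Prop :=
  forall eps : R, 0 < eps -> exists g,
    [/\ continuous g, compactly_supported g & forall x, `|f x - g x| <= eps].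

(* The last condition, implied by the previous one if the density is bounded
   below, ensures that the energy of f is finite. *)
Definition form_core f : Prop :=
  [/\ continuous f, vanishes_at_infinity f, edgewise_W12 f,
      (\int[graph_measure]_x (f x ^+ 2 + weak_derivative f x ^+ 2)%:E < +oo)%E &
      (\int[energy_measure]_x (weak_derivative f x ^+ 2)%:E < +oo)%E].

Definition form_norm2 f : \bar R :=
  (\int[graph_measure]_x (f x ^+ 2)%:E +
   (2^-1)%:E * \int[energy_measure]_x (weak_derivative f x ^+ 2)%:E)%E.

(* A Dirichlet form is closed: its domain is the closure of [form_core] with
   respect to E(f,f) + |f|^2 (norm of L^2(graph_measure)). Convergence in this
   norm implies uniform convergence on each edge, so that the closure is again
   a space of continuous functions. *)
Definition form_domain f : Prop :=
  [/\ continuous f, edgewise_W12 f &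
      exists2 u : nat -> metric_graph -> R, forall n, form_core (u n) &
        form_norm2 (u n \- f) @[n --> \oo] --> 0%E].

End metric_graph.

Section diffusion.
Variables (R : realType) (W : weighted_graph R).
Variables (d : measure_display) (Omega : measurableType d).
Variables (P : state W -> probability Omega R) (Y : R -> Omega -> state W).

(* Time is [0, +oo[; the values of Y at negative times are never used. *)

Definition past (t : R) : set (set Omega) :=
  <<s [set A | exists s, 0 <= s <= t /\
         exists2 B, measurable B & A = Y s @^-1` B] >>.

Definition right_past (t : R) : set (set Omega) :=
  [set A | forall s, t < s -> past s A].

Definition stopping_time (tau : Omega -> \bar R) : Prop :=
  (forall w, 0 <= tau w)%E /\
  forall t, 0 <= t -> right_past t [set w | (tau w <= t%:E)%E].

Definition stopped_past (tau : Omega -> \bar R) : set (set Omega) :=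
  [set A | forall t, 0 <= t -> right_past t (A `&` [set w | (tau w <= t%:E)%E])].

Definition strong_markov : Prop :=
  forall (x : state W) (tau : Omega -> \bar R) (A : set Omega) (s : R)
      (B : set (state W)),
    stopping_time tau -> measurable A -> stopped_past tau A -> 0 <= s ->
    measurable B ->
    let A' := A `&` [set w | (tau w < +oo)%E] in
    P x (A' `&` [set w | B (Y (fine (tau w) + s) w)]) =
    (\int[P x]_(w in A') P (Y (fine (tau w)) w) (Y s @^-1` B))%E.

(* Lifetime zeta = inf {t | Y t w = None}: the paths are continuous on
   [0, zeta[ and stay in the cemetery from zeta on. *)
Record diffusion : Prop := Diffusion {
  diffusion_measurable : forall t, 0 <= t -> measurable_fun setT (Y t);
  diffusion_kernel : forall t (B : set (state W)), 0 <= t -> measurable B ->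
    measurable_fun setT (fun x => P x (Y t @^-1` B));
  diffusion_start : forall x, {ae P x, forall w, Y 0 w = x};
  diffusion_continuous : forall w t, 0 <= t -> Y t w <> None ->
    Y s w @[s --> within (`[0, +oo[)%classic (nbhs t)] --> Y t w;
  diffusion_cemetery : forall w s t, 0 <= s <= t ->
    Y s w = None -> Y t w = None;
  diffusion_strong_markov : strong_markov }.

Definition extend0 (f : metric_graph W -> R) (y : state W) : R :=
  if y is Some x then f x else 0.

Definition resolvent (alpha : R) (f : metric_graph W -> R)
    (x : metric_graph W) : R :=
  \int[@lebesgue_measure R]_(t in `[0, +oo[)
    (expR (- (alpha * t)) * \int[P (Some x)]_w extend0 f (Y t w)).

(* The resolvent of the process is the resolvent of the form. As the elements
   of [form_domain] are functions and not classes of functions, the process is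
   determined for every starting point. *)
Definition associated_with_form : Prop :=
  forall (alpha : R) (f : metric_graph W -> R),
    0 < alpha -> measurable_fun setT f ->
    (exists M, forall x, `|f x| <= M) ->
    (\int[@graph_measure R W]_x (f x ^+ 2)%:E < +oo)%E ->
    form_domain (resolvent alpha f) /\
    forall g, form_domain g ->
      energy (resolvent alpha f) g +
        alpha * \int[@graph_measure R W]_x (resolvent alpha f x * g x) =
      \int[@graph_measure R W]_x (f x * g x).

Definition brownian_motion : Prop := diffusion /\ associated_with_form.

Definition hitting_time (A : set (metric_graph W)) (w : Omega) : \bar R :=
  ereal_inf [set t%:E | t in [set t | 0 <= t /\ (Some @` A) (Y t w)]].

End diffusion.

(* Main.v *)
(* Write L for the generator. The functions used are quadratic on every edge and
   have finite support; the curvature on the loop at a vertex y can be chosen so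
   that the vertex condition holds at y, whatever the function is on the other
   edges. Such a u is the resolvent of alpha u - L u.

   Two of them determine E^x T. One has L v = 0 and v = 1 on the star of x, loop
   included: the process is not killed before T. The other vanishes at the
   neighbours of x and has curvature omega(e) on the edges e at x; the value A of
   u at x for which the curvature on the loop is omega too is the announced
   ratio. Hence L u = -1 before T.

   Dynkin's formula follows from the strong Markov property at T and the
   memorylessness of an independent exponential time of rate alpha. With
   Q(alpha) = E^x (1 - exp (- alpha T)) and Mu a bound of u it gives
   Q(alpha) <= alpha A <= (1 + alpha Mu) Q(alpha), and alpha -> 0 yields
   E^x T = A. *)
Require Import Defs.
From mathcomp Require Import all_boot all_order all_algebra.
From mathcomp Require Import all_classical all_reals all_analysis.
From mathcomp Require Import measurable_realfun ring lra.
Set Implicit Arguments.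
Unset Strict Implicit.
Unset Printing Implicit Defensive.
Import Order.TTheory GRing.Theory Num.Theory.
Import numFieldNormedType.Exports.
Local Open Scope classical_set_scope.
Local Open Scope ring_scope.

(** * Weak derivatives on an interval *)

(** The loops decouple the vertices: a function prescribed near [x] can be cut off one layer of
    edges further on, the mismatch of its derivatives at the outer vertices being absorbed by the
    loops there. The process then enters only through resolvents of explicit functions.

    Two features shape the rest. First, the form sees functions up to null sets of the edges,
    whereas the estimates up to T are made at every point of a path. The sources are therefore
    defined at every point, corrected at [x], and shown to be measurable along the paths.

    Secondly, the set of neighbours is presented as the zero set of a continuous function [theta]
    that is positive exactly on the open star of [x]. Hitting becomes a property of a real path: the
    intermediate value theorem keeps the path in the star before T, and sampling [theta] at
    countably many times shows that T is a stopping time. The path may die at a finite time, and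
    nothing is known about [theta] near the cemetery, so every continuity argument stays strictly
    before death. *)

Section cutoff.
Variable R : realType.
Implicit Types (s t c : R) (f : R -> R).

(** Meant for the square of the positive part, whose derivative at the kink 0 cannot be had from the
    rules of calculus. *)
Lemma is_derive_quadratic_error f s a M :
  (forall h, `|f (s + h) - f s - a * h| <= M * h ^+ 2) -> is_derive s 1 f a.
Proof.
move=> H.
have M0 : 0 <= M.
  by have := H 1; rewrite expr1n !mulr1; exact: le_trans (normr_ge0 _).
have cvgf : (fun h => h^-1 *: (f (h *: 1 + s) - f s)) @ 0^' --> a.
  apply/cvgrPdist_le => e e0; near=> h.
  have h0 : h != 0 by near: h; exact: nbhs_dnbhs_neq.
  have -> : a - h^-1 *: (f (h *: 1 + s) - f s) =
            - (h^-1 * (f (s + h) - f s - a * h)).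
    by rewrite /GRing.scale/= mulr1 (addrC h s); field.
  rewrite normrN normrM normfV ler_pdivrMl ?normr_gt0//.
  apply: le_trans (H h) _; rewrite -[h ^+ 2]ger0_norm ?sqr_ge0// normrX expr2.
  rewrite mulrA mulrC ler_wpM2l// .
  have : `|h| <= e / (M + 1).
    near: h; apply: dnbhs0_le; rewrite divr_gt0//; lra.
  rewrite ler_pdivlMr; last by lra.
  have := normr_ge0 h; nra.
have df : derivable f s 1 by apply/cvg_ex; exists a.
by apply: DeriveDef => //; exact: cvg_lim.
Unshelve. all: by end_near. Qed.

Definition pospart s : R := Num.max 0 s.

Lemma continuous_pospart : continuous pospart.
Proof.
move=> s; rewrite /pospart.
by apply: continuous_max; [exact: cst_continuous|exact: (fun x => @cvg_id _ (nbhs x))].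
Qed.

Lemma is_derive_pospart_sqr s :
  is_derive s 1 (fun t => pospart t ^+ 2) (2 * pospart s).
Proof.
apply: (@is_derive_quadratic_error _ _ _ 1) => h; rewrite /pospart mul1r.
rewrite ler_norml; case: (leP 0 s) => s0; case: (leP 0 (s + h)) => sh0.
all: apply/andP; split; nra.
Qed.

(* A C^1 step, equal to 0 before 1 and to 1 after 2. *)
Definition step s : R :=
  2 * (pospart (s - 1) ^+ 2 - 2 * pospart (s - 3 / 2) ^+ 2
       + pospart (s - 2) ^+ 2).

Definition dstep s : R :=
  4 * (pospart (s - 1) - 2 * pospart (s - 3 / 2) + pospart (s - 2)).

Lemma is_derive_step s : is_derive s 1 step (dstep s).
Proof.
have D c : is_derive s 1 (fun t => pospart (t - c) ^+ 2) (2 * pospart (s - c)).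
  have := @is_derive1_comp _ (fun t => pospart t ^+ 2) (fun t => t - c) s _ _
    (is_derive_pospart_sqr (s - c)) _.
  by move=> /(_ 1); rewrite mulr1; apply; exact: is_derive_shift.
rewrite /step /dstep.
have D1 := D 1; have D2 := D (3/2); have D3 := D 2.
apply: is_derive_eq; rewrite /GRing.scale/=; ring.
Qed.

Lemma continuous_dstep : continuous dstep.
Proof.
have C c : continuous (fun s => pospart (s - c)).
  move=> s; apply: (continuous_comp (f := fun s => s - c)).
    by apply: continuousB; [exact: (fun x => @cvg_id _ (nbhs x))|exact: cst_continuous].
  exact: continuous_pospart.
move=> s; rewrite /dstep; apply: cvgM; first exact: cvg_cst.
apply: cvgD; last exact: C.
by apply: cvgB; [exact: C|apply: cvgM; [exact: cvg_cst|exact: C]].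
Qed.

Lemma step_eq0 s : s <= 1 -> step s = 0.
Proof.
move=> s1; rewrite /step /pospart.
by rewrite !max_l ?subr_le0//; [ring|lra..].
Qed.

Lemma step_eq1 s : 2 <= s -> step s = 1.
Proof.
move=> s2; rewrite /step /pospart.
by rewrite !max_r ?subr_ge0//; [field|lra..].
Qed.

Lemma dstep_ge0 s : 0 <= dstep s.
Proof.
rewrite /dstep /pospart.
by case: (leP 0 (s - 1)); case: (leP 0 (s - 3/2)); case: (leP 0 (s - 2)); lra.
Qed.

Lemma dstep_eq0 s : ~ (1 < s < 2) -> dstep s = 0.
Proof.
rewrite /dstep /pospart => H.
have [s1|s1] := leP s 1; first by rewrite !max_l ?subr_le0//; [ring|lra..].
have [s2|s2] := leP 2 s; first by rewrite !max_r ?subr_ge0//; [field|lra..].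
by exfalso; apply: H; rewrite s1 s2.
Qed.

Lemma step_itv s : 0 <= step s <= 1.
Proof.
have [s1|s1] := leP s 1; first by rewrite step_eq0// lexx ler01.
have [s2|s2] := leP 2 s; first by rewrite step_eq1// lexx ler01.
rewrite /step /pospart.
by case: (leP 0 (s - 1)); case: (leP 0 (s - 3/2)); case: (leP 0 (s - 2));
  move=> *; apply/andP; split; nra.
Qed.

End cutoff.

Section interval_integrals.
Variable R : realType.
Local Notation mu := (@lebesgue_measure R).
Implicit Types (f k h : R -> R) (a b l s : R).

Lemma continuous_itv_integrable f a b :
  continuous f -> mu.-integrable `[a, b] (EFin \o f).
Proof.
move=> cf; apply: continuous_compact_integrable; first exact: segment_compact.
exact: continuous_subspaceT.
Qed.

(** On a set of finite measure, by |h| <= 1 + h^2. *)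
Lemma sqr_integrable_integrable d (T : measurableType d)
    (m : {measure set T -> \bar R}) (D : set T) (h : T -> R) :
  measurable D -> (m D < +oo)%E -> measurable_fun D h ->
  (\int[m]_(x in D) (h x ^+ 2)%:E < +oo)%E ->
  m.-integrable D (EFin \o h).
Proof.
move=> mD mfin mh h2.
have i1 : m.-integrable D (EFin \o cst (1 : R)).
  apply/integrableP; split; first exact/measurable_EFinP/measurable_cst.
  by under eq_integral do rewrite /= normr1; rewrite integral_cst// mul1e.
have i2 : m.-integrable D (fun x => (h x ^+ 2)%:E).
  apply/integrableP; split; first exact/measurable_EFinP/measurable_funX.
  under eq_integral do rewrite gee0_abs ?lee_fin ?sqr_ge0//.
  exact: h2.
have := integrableD mD i1 i2; apply: le_integrable => //.
  exact/measurable_EFinP.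
move=> x Dx /=; rewrite lee_fin [leRHS]ger0_norm; last first.
  by rewrite addr_ge0// sqr_ge0.
rewrite -(real_normK (num_real (h x))).
have := normr_ge0 (h x); nra.
Qed.

Lemma integrable_bounded_mul d (T : measurableType d)
    (m : {measure set T -> \bar R}) (D : set T) (f h : T -> R) (M : R) :
  measurable D -> measurable_fun D f -> (forall x, D x -> `|f x| <= M) ->
  m.-integrable D (EFin \o h) ->
  m.-integrable D (EFin \o (fun x => f x * h x)).
Proof.
move=> mD mf fM ih.
have mh : measurable_fun D h by apply/measurable_EFinP; apply: measurable_int ih.
have := integrableZl mD M ih; apply: le_integrable => //.
  exact/measurable_EFinP/measurable_funM.
move=> x Dx /=; rewrite lee_fin !normrM ler_wpM2r//.
by rewrite (le_trans (fM x Dx))// ler_norm.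
Qed.

Lemma continuous_itv_bounded f a b : continuous f ->
  exists M, forall s, `[a, b]%classic s -> `|f s| <= M.
Proof.
move=> cf.
have := @compact_bounded _ _ (f @` `[a, b]) (continuous_compact _ (@segment_compact _ a b)).
case; first exact: continuous_subspaceT.
move=> M [_ HM]; exists (M + 1) => s abs.
by apply: (HM (M + 1)); [rewrite ltrDl|exists s].
Qed.

Lemma integrable_continuous_mul f h a b :
  continuous f -> mu.-integrable `[a, b] (EFin \o h) ->
  mu.-integrable `[a, b] (EFin \o (fun x => f x * h x)).
Proof.
move=> cf ih; have [M HM] := continuous_itv_bounded a b cf.
apply: (@integrable_bounded_mul _ (measurableTypeR R) mu _ f h M) => //.
by apply: measurable_funTS; exact: continuous_measurable_fun.
Qed.

Lemma Rintegral_continuous_FTC2 f F a b : a < b -> continuous f ->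
  (forall s, is_derive s 1 F (f s)) ->
  \int[mu]_(s in `[a, b]) f s = F b - F a.
Proof.
move=> ab cf dF.
have cF : continuous F.
  by move=> s; apply: differentiable_continuous; apply/derivable1_diffP; case: (dF s).
rewrite /Rintegral (@continuous_FTC2 _ f F a b)//.
- exact: continuous_subspaceT.
- split=> //.
  + exact/cvg_at_right_filter/cF.
  + exact/cvg_at_left_filter/cF.
- by move=> s _; rewrite derive1E; case: (dF s).
Qed.

End interval_integrals.

(** * Integration by parts for a weak derivative, up to the ends of the interval *)

Section weak_derivative_on_interval.
Variable R : realType.
Local Notation mu := (@lebesgue_measure R).
Implicit Types (f g h k : R -> R) (a b c e l s : R).

(** A nonnegative bump of mass 1 carried by [c + e, c + 2e]: an approximate Dirac mass at [c] as [e]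
    tends to 0. *)
Let dbump c e s := dstep ((s - c) / e) / e.

Let is_derive_bump c e s : is_derive s 1 (fun t => step ((t - c) / e)) (dbump c e s).
Proof.
have H : is_derive s 1 (fun t => (t - c) / e) e^-1.
  apply: is_derive_eq; rewrite ?/GRing.scale/=; ring.
have := @is_derive1_comp _ (@step R) (fun t => (t - c) / e) s _ _
  (is_derive_step _) H.
exact.
Qed.

Let continuous_dbump c e : continuous (dbump c e).
Proof.
move=> s; apply: cvgM; last exact: cvg_cst.
apply: (continuous_comp (f := fun s => (s - c) / e)); last exact: continuous_dstep.
by apply: cvgM; [apply: cvgB; [exact: cvg_id|exact: cvg_cst]|exact: cvg_cst].
Qed.

Let dbump_eq0 c e s : 0 < e -> ~ (c + e < s < c + 2 * e) -> dbump c e s = 0.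
Proof.
move=> e0 H; rewrite /dbump dstep_eq0 ?mul0r// => /andP[H1 H2]; apply: H.
move: H1 H2; rewrite ltr_pdivlMr// ltr_pdivrMr// mul1r.
by move=> ? ?; apply/andP; split; lra.
Qed.

Let dbump_ge0 c e s : 0 < e -> 0 <= dbump c e s.
Proof. by move=> e0; rewrite divr_ge0 ?dstep_ge0// ltW. Qed.

Lemma Rintegral_dbump_approx k (k0 eta c e l : R) :
  0 < e -> 0 <= c + e -> c + 2 * e <= l -> continuous k -> 0 <= eta ->
  (forall s, c + e < s < c + 2 * e -> `|k s - k0| <= eta) ->
  `| \int[mu]_(s in `[0, l]) (k s * dbump c e s) - k0 | <= eta.
Proof.
move=> e0 ce cl ck eta0 H.
have l0 : 0 < l by lra.
have i1 : \int[mu]_(s in `[0, l]) dbump c e s = 1.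
  rewrite (Rintegral_continuous_FTC2 l0 (@continuous_dbump c e) (is_derive_bump c e)).
  rewrite step_eq1 ?step_eq0 ?subr0//; first by rewrite ler_pdivrMr//; lra.
  by rewrite ler_pdivlMr//; lra.
have cB : continuous (fun s => (k s - k0) * dbump c e s).
  move=> s; apply: cvgM; last exact: continuous_dbump.
  by apply: cvgB; [exact: ck|exact: cvg_cst].
have iB := continuous_itv_integrable 0 l cB.
have cD := @continuous_dbump c e; have iD := continuous_itv_integrable 0 l cD.
have ik := integrable_continuous_mul ck iD.
have -> : \int[mu]_(s in `[0, l]) (k s * dbump c e s) - k0 =
   \int[mu]_(s in `[0, l]) ((k s - k0) * dbump c e s).
  rewrite -[X in _ - X = _]mulr1 -i1 -(RintegralZl k0 _ iD)//.
  rewrite -(RintegralB _ ik (integrableZl _ k0 iD))//.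
  by apply: eq_Rintegral => s _; rewrite mulrBl.
apply: le_trans (le_normr_Rintegral _ iB) _ => //.
rewrite -[leRHS]mulr1 -i1 -(RintegralZl eta _ iD)//.
apply: le_Rintegral => //.
- by have := integrable_norm iB.
- exact: (integrableZl _ eta iD).
- move=> s _; rewrite normrM [X in _ * X]ger0_norm ?dbump_ge0//.
  have [/H Hs|Hs] := pselect (c + e < s < c + 2 * e).
    by rewrite ler_wpM2r// dbump_ge0.
  by rewrite dbump_eq0// !mulr0.
Qed.

(** A C^1 substitute for the indicator of ]a, b[: it rises on [a + e, a + 2e] and, thanks to the
    shift by 3e, descends on [b - 2e, b - e]. Its derivative is a difference of two bumps. *)
Let cut a b e s := step ((s - a) / e) - step ((s - (b - 3 * e)) / e).

Let cut_le1 a b e s : `|cut a b e s| <= 1.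
Proof.
rewrite /cut ler_norml.
have /andP[? ?] := step_itv ((s - a) / e).
have /andP[? ?] := step_itv ((s - (b - 3 * e)) / e).
by apply/andP; split; lra.
Qed.

Let cut_eq0 a b e s : 0 < e -> 4 * e <= b - a -> s <= a + e \/ b - e <= s ->
  cut a b e s = 0.
Proof.
move=> e0 eab [sa|bs]; rewrite /cut.
  by rewrite !step_eq0 ?subrr// ler_pdivrMr//; lra.
by rewrite !step_eq1 ?subrr// ler_pdivlMr//; lra.
Qed.

Let cut_eq1 a b e s : 0 < e -> a + 2 * e <= s -> s <= b - 2 * e ->
  cut a b e s = 1.
Proof.
move=> e0 eas sb; rewrite /cut.
rewrite step_eq1 ?step_eq0 ?subr0// ?ler_pdivrMr// ?ler_pdivlMr//; lra.
Qed.

Let is_derive_cut a b e s :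
  is_derive s 1 (cut a b e) (dbump a e s - dbump (b - 3 * e) e s).
Proof. exact: (is_deriveB (is_derive_bump a e s) (is_derive_bump (b - 3 * e) e s)). Qed.

Let continuous_cut a b e : continuous (cut a b e).
Proof.
move=> s; apply: differentiable_continuous; apply/derivable1_diffP.
by have [] := is_derive_cut a b e s.
Qed.

(** The 4 makes room for both slopes of [cut] in [a, b] for every [n]. *)
Let eps a b (n : nat) := (b - a) / n.+4%:R.

Let eps_gt0 a b n : a < b -> 0 < eps a b n.
Proof. by move=> ab; rewrite divr_gt0// subr_gt0. Qed.

Let eps_le a b n : a < b -> 4 * eps a b n <= b - a.
Proof.
move=> ab; rewrite /eps mulrCA -[leRHS]mulr1 ler_wpM2l//; first by lra.
by rewrite ler_pdivrMr// mul1r ler_nat.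
Qed.

Let eps_small a b r : a < b -> 0 < r -> \forall n \near \oo, eps a b n < r.
Proof.
move=> ab r0; near=> n.
rewrite /eps ltr_pdivrMr// mulrC -ltr_pdivrMr//.
apply: (@lt_le_trans _ _ n%:R); last by rewrite ler_nat !leqW.
by near: n; exact: nbhs_infty_gtr.
Unshelve. all: by end_near. Qed.

Let cut_cvg a b s : a < b ->
  cut a b (eps a b n) s @[n --> \oo] --> (\1_`]a, b[%classic s : R).
Proof.
move=> ab; apply: cvg_near_cst; rewrite indicE.
have [/andP[sa sb]|sab] := boolP (a < s < b).
  rewrite mem_set/= ?in_itv/= ?sa//.
  near=> n; apply: cut_eq1; first exact: eps_gt0.
    suff : eps a b n < (s - a) / 2 by lra.
    by near: n; apply: eps_small => //; lra.
  suff : eps a b n < (b - s) / 2 by lra.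
  by near: n; apply: eps_small => //; lra.
rewrite memNset/= ?in_itv/=; last exact/negP.
near=> n; apply: cut_eq0; [exact: eps_gt0|exact: eps_le|].
have e0 := eps_gt0 n ab.
move: sab; rewrite negb_and -!leNgt => /orP[|]; [left|right]; lra.
Unshelve. all: by end_near. Qed.

Let Rintegral_cut_cvg a b l k : 0 <= a -> a < b -> b <= l ->
  mu.-integrable `[0, l] (EFin \o k) ->
  \int[mu]_(s in `[0, l]) (k s * cut a b (eps a b n) s) @[n --> \oo] -->
  \int[mu]_(s in `[a, b]) k s.
Proof.
move=> a0 ab bl ik.
have mk : measurable_fun `[0, l] k by apply/measurable_EFinP; apply: measurable_int ik.
have mab : (`]a, b[ `<=` `[0, l])%classic.
  by move=> s /=; rewrite !in_itv/= => /andP[? ?]; apply/andP; split; lra.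
have -> : \int[mu]_(s in `[a, b]) k s =
          \int[mu]_(s in `[0, l]) (k s * \1_`]a, b[ s).
  rewrite -Rintegral_itv_obnd_cbnd; last first.
    apply: integrableS ik => // s /=; rewrite !in_itv/= => /andP[? ?].
    by apply/andP; split; lra.
  rewrite -Rintegral_itv_bndo_bndc; last first.
    exact: integrableS ik.
  rewrite -(setIidr mab) Rintegral_mkcondr; apply: eq_Rintegral => s _.
  rewrite patchE indicE.
  have [H|H] := pselect (`]a, b[%classic s); first by rewrite !mem_set ?mulr1//; split => //;
    exact: mab.
  by rewrite !memNset ?mulr0// => -[].
have [] := @dominated_convergence _ (measurableTypeR R) R mu `[0, l]%classic _
  (fun n s => (k s * cut a b (eps a b n) s)%:E)
  (fun s => (k s * \1_`]a, b[ s)%:E) (fun s => `|k s|%:E).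
- by [].
- move=> n; apply/measurable_EFinP; apply: measurable_funM => //.
  by apply: measurable_funTS; apply: continuous_measurable_fun; exact: continuous_cut.
- apply/measurable_EFinP; apply: measurable_funM => //.
- apply: aeW => s _; apply: cvg_EFin; first by near=> n.
  by apply: cvgM; [exact: cvg_cst|exact: cut_cvg].
- exact: integrable_norm ik.
- apply: aeW => s n _ /=; rewrite lee_fin normrM -[leRHS]mulr1.
  by rewrite ler_wpM2l// cut_le1.
move=> i0 _ i.
apply: fine_cvg; rewrite fineK; first exact: i.
exact: integrable_fin_num.
Unshelve. all: by end_near. Qed.

Let Rintegral_dbump_cvg (k : R -> R) (t : R) (c : R^nat) (e : R^nat) l :
  (forall n, 0 < e n /\ 0 <= c n + e n /\ c n + 2 * e n <= l) ->
  e @ \oo --> 0 -> c @ \oo --> t -> continuous k ->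
  \int[mu]_(s in `[0, l]) (k s * dbump (c n) (e n) s) @[n --> \oo] --> k t.
Proof.
move=> H e0 ct ck; apply/cvgrPdist_le => eta eta0.
have /cvgrPdist_le/(_ _ eta0)/nbhs_ballP[r /= r0 Hr] := ck t.
near=> n.
have [en0 [cn cl]] := H n.
rewrite distrC; apply: Rintegral_dbump_approx => //; first exact: ltW.
move=> s /andP[s1 s2]; rewrite distrC; apply: Hr.
rewrite /ball/= ltr_distlC.
have : `|t - c n| <= r / 4 by near: n; move/cvgrPdist_le : ct; apply; lra.
have : `|0 - e n| <= r / 4 by near: n; move/cvgrPdist_le : e0; apply; lra.
rewrite !ler_norml => /andP[? ?] /andP[? ?].
by apply/andP; split; lra.
Unshelve. all: by end_near. Qed.

(** Test functions live strictly inside ]0, l[, yet [a = 0] and [b = l] are allowed. The weak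
    derivative is tested against [A] times a cut-off of ]a, b[; as the cut-off sharpens, the bumps
    in its derivative turn into the boundary values, because [g] is continuous. *)
Lemma weak_integration_by_parts g h (A A' : R -> R) a b l :
  0 <= a -> a < b -> b <= l ->
  continuous g -> mu.-integrable `[0, l] (EFin \o h) ->
  (forall psi, test_function l psi ->
    \int[mu]_(s in `[0, l]) (g s * derive1 psi s) =
    - \int[mu]_(s in `[0, l]) (h s * psi s)) ->
  (forall s, is_derive s 1 A (A' s)) -> continuous A' ->
  \int[mu]_(s in `[a, b]) (A s * h s) =
  A b * g b - A a * g a - \int[mu]_(s in `[a, b]) (A' s * g s).
Proof.
move=> a0 ab bl cg ih test dA cA'.
have cA : continuous A.
  by move=> s; apply: differentiable_continuous; apply/derivable1_diffP; have [] := dA s.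
pose e := eps a b.
have e0 n : 0 < e n by exact: eps_gt0.
have e4 n : 4 * e n <= b - a by exact: eps_le.
have ecvg : e @ \oo --> 0.
  apply/cvgrPdist_le => r r0; near=> n.
  rewrite sub0r normrN ger0_norm ?ltW//.
  by near: n; exact: eps_small.
pose psi n s := A s * cut a b (e n) s.
pose dpsi n s := A' s * cut a b (e n) s + (A s * dbump a (e n) s - A s * dbump (b - 3 * e n)
  (e n) s).
have dpsiE n s : is_derive s 1 (psi n) (dpsi n s).
  have dA1 := dA s; have dc := is_derive_cut a b (e n) s.
  have := is_deriveM dA1 dc => dM.
  apply: (@is_derive_eq _ _ _ _ _ _ _ _ dM).
  rewrite /dpsi /GRing.scale/=; ring.
have psi1 n s : derive1 (psi n) s = dpsi n s.
  by rewrite derive1E; have [] := dpsiE n s.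
have cgA : continuous (fun s => g s * A s).
  by move=> s; apply: cvgM; [exact: cg|exact: cA].
have cA'g : continuous (fun s => A' s * g s).
  by move=> s; apply: cvgM; [exact: cA'|exact: cg].
have cK n c : continuous (fun s => g s * A s * dbump c (e n) s).
  by move=> s; apply: cvgM; [exact: cgA|exact: continuous_dbump].
have cL n : continuous (fun s => A' s * g s * cut a b (e n) s).
  by move=> s; apply: cvgM; [exact: cA'g|exact: continuous_cut].
have tpsi n : test_function l (psi n).
  split.
  - by move=> s; have [] := dpsiE n s.
  - have -> : derive1 (psi n) = dpsi n by apply/funext => s; exact: psi1.
    move=> s; apply: cvgD.
      by apply: cvgM; [exact: cA'|exact: continuous_cut].
    by apply: cvgB; apply: cvgM; solve [exact: cA|exact: continuous_dbump].
  - exists (a + e n), (b - e n); split; [have := e0 n; lra|have := e0 n; lra|].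
    move=> s; apply: contra_neqT; rewrite negb_and -!ltNge => H.
    rewrite /psi cut_eq0 ?mulr0//.
    by case/orP : H => /ltW; [left|right].
(* The weak derivative tested against [psi n]; each of the four integrals has a limit, which gives
   the formula. *)
have key n : \int[mu]_(s in `[0, l]) (A' s * g s * cut a b (e n) s) +
   (\int[mu]_(s in `[0, l]) (g s * A s * dbump a (e n) s) -
    \int[mu]_(s in `[0, l]) (g s * A s * dbump (b - 3 * e n) (e n) s)) =
   - \int[mu]_(s in `[0, l]) (A s * h s * cut a b (e n) s).
  rewrite -RintegralB//; [|exact: continuous_itv_integrable (cK n _)..].
  rewrite -RintegralD//; last 2 first.
  - exact: continuous_itv_integrable (cL n).
  - apply: (@continuous_itv_integrable _ (fun s => _ - _)).
    by move=> s; apply: cvgB; exact: cK.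
  have -> : \int[mu]_(s in `[0, l]) (A s * h s * cut a b (e n) s) =
            \int[mu]_(s in `[0, l]) (h s * psi n s).
    by apply: eq_Rintegral => s _; rewrite /psi; ring.
  rewrite -test//; apply: eq_Rintegral => s _; rewrite psi1 /dpsi; ring.
have lim1 := Rintegral_cut_cvg a0 ab bl (continuous_itv_integrable 0 l cA'g).
have iAh := integrable_continuous_mul cA ih.
have lim2 := Rintegral_cut_cvg a0 ab bl iAh.
have lim3 : \int[mu]_(s in `[0, l]) (g s * A s * dbump a (e n) s) @[n --> \oo] --> g a * A a.
  apply: (@Rintegral_dbump_cvg (fun s => g s * A s) a (fun=> a)) => //; last exact: cvg_cst.
  by move=> n; have := e0 n; have := e4 n; lra.
have lim4 : \int[mu]_(s in `[0, l]) (g s * A s * dbump (b - 3 * e n) (e n) s) @[n --> \oo]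
  --> g b * A b.
  apply: (@Rintegral_dbump_cvg (fun s => g s * A s) b (fun n => b - 3 * e n)) => //.
    by move=> n; have := e0 n; have := e4 n; lra.
  rewrite -[X in _ --> X]subr0 -[X in _ --> _ - X](mulr0 3).
  by apply: cvgB; [exact: cvg_cst|apply: cvgM; [exact: cvg_cst|exact: ecvg]].
have L := cvgD lim1 (cvgB lim3 lim4).
have M := cvgN lim2.
have : \int[mu]_(s in `[a, b]) (A' s * g s) + (g a * A a - g b * A b) = -
  \int[mu]_(s in `[a, b]) (A s * h s).
  apply: (cvg_unique (@Rhausdorff R) (F := (fun n => - \int[mu]_(s in `[0, l])
    (A s * h s * cut a b (e n) s)) @ \oo)) => /=.
    by have /funext <- := key; exact: L.
  exact: M.
lra.
Unshelve. all: by end_near. Qed.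

End weak_derivative_on_interval.

Section weak_derivative_unique.
Variable R : realType.
Local Notation mu := (@lebesgue_measure R).
Implicit Types (g h k : R -> R) (a b l s : R).

(** Extended by 0, [k] has a vanishing primitive, whose derivative is [k] almost everywhere by
    Lebesgue differentiation. *)
Lemma itv_integrals_eq0_ae k l : 0 < l ->
  mu.-integrable `[0, l] (EFin \o k) ->
  (forall a b, 0 <= a -> a < b -> b <= l -> \int[mu]_(s in `[a, b]) k s = 0) ->
  {ae mu, forall s, `[0, l]%classic s -> k s = 0}.
Proof.
move=> l0 ik k0.
pose f := k \_ `[0, l]%classic.
have if_ : mu.-integrable setT (EFin \o f).
  rewrite /f -restrict_EFin; apply/integrable_restrict => //.
  by rewrite setTI.
have iy y : mu.-integrable `]-oo, y] (EFin \o f) by exact: integrableS if_.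
have := FTC1Ny iy (open_integrable_locally openT if_).
apply: (@filterS _ _ (ae_filter_ringOfSetsType mu)) => s [_ +] ls.
have F0 : (fun x => \int[mu]_(t in [set` `]-oo, x]]) f t) = cst 0.
  apply/funext => x /=; rewrite /f -Rintegral_mkcondr.
  have [x0|x0] := leP x 0.
    rewrite (_ : _ `&` _ = if x == 0 then [set 0] else set0); last first.
      apply/seteqP; split => t /=.
        rewrite !in_itv/= => -[tx /andP[t0 tl]].
        have -> : x = 0 by lra.
        by rewrite eqxx /=; lra.
      case: eqP => [->/= ->|//]; rewrite !in_itv/= lexx ltW//.
    by case: eqP => _; rewrite ?Rintegral_set1 ?Rintegral_set0.
  have [xl|xl] := leP x l.
    rewrite (_ : _ `&` _ = `[0, x]%classic) ?k0//.
    apply/seteqP; split => t /=; rewrite !in_itv/=; first by case => -> /andP[->].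
    by move=> /andP[-> tx]; rewrite tx (le_trans tx).
  rewrite (_ : _ `&` _ = `[0, l]%classic) ?k0//.
  apply/seteqP; split => t /=; rewrite !in_itv/=; first by case.
  by move=> /andP[-> tl]; rewrite tl (le_trans tl)// ltW.
rewrite F0 derive1_cst /f patchE mem_set// => ->.
Qed.

(** Integration by parts with [A = 1]: both weak derivatives integrate to [g b - g a] over every
    subinterval. *)
Lemma weak_derivative_unique_itv g h1 h2 l : 0 < l -> continuous g ->
  mu.-integrable `[0, l] (EFin \o h1) -> mu.-integrable `[0, l] (EFin \o h2) ->
  (forall psi, test_function l psi ->
    \int[mu]_(s in `[0, l]) (g s * derive1 psi s) =
    - \int[mu]_(s in `[0, l]) (h1 s * psi s)) ->
  (forall psi, test_function l psi ->
    \int[mu]_(s in `[0, l]) (g s * derive1 psi s) =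
    - \int[mu]_(s in `[0, l]) (h2 s * psi s)) ->
  {ae mu, forall s, `[0, l]%classic s -> h1 s = h2 s}.
Proof.
move=> l0 cg i1 i2 t1 t2.
have : {ae mu, forall s, `[0, l]%classic s -> h1 s - h2 s = 0}.
  apply: itv_integrals_eq0_ae => //.
    exact: (integrableB _ i1 i2).
  move=> a b a0 ab bl.
  have sub : (`[a, b] `<=` `[0, l])%classic.
    by move=> s /=; rewrite !in_itv/= => /andP[? ?]; apply/andP; split; lra.
  rewrite RintegralB//; [|exact: integrableS i1|exact: integrableS i2].
  have d1 s : is_derive s 1 (cst (1 : R)) ((cst 0 : R -> R) s) by exact: is_derive_cst.
  have c0 : continuous (cst 0 : R -> R) by move=> s; exact: cvg_cst.
  have := weak_integration_by_parts a0 ab bl cg i1 t1 d1 c0.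
  have := weak_integration_by_parts a0 ab bl cg i2 t2 d1 c0.
  under eq_Rintegral do rewrite mul1r.
  move=> ->; under eq_Rintegral do rewrite mul1r.
  by move=> ->; rewrite subrr.
by apply: (@filterS _ _ (ae_filter_ringOfSetsType mu)) => s H /H /subr0_eq.
Qed.

End weak_derivative_unique.

(** * The metric graph *)

Section chart_theory.
Variables (R : realType) (W : weighted_graph R).
Local Notation mu := (@lebesgue_measure R).
Implicit Types (e : loop_edge W) (s : R) (v : vert W -> R) (F : loop_edge W -> R -> R).

Local Notation length e := (len e)%:num.

Lemma open_metric_graphE (U : set (metric_graph W)) :
  open U = metric_graph_open U.
Proof. by []. Qed.

Lemma chart_le0 e s : s <= 0 -> chart e s = vertex (lsrc e).
Proof. by move=> s0; rewrite /chart s0. Qed.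

Lemma chart_ge e s : length e <= s -> chart e s = vertex (ltgt e).
Proof.
move=> ls; rewrite /chart leNgt (lt_le_trans _ ls)//=.
by rewrite insubF//=; apply/negbTE; rewrite negb_and -!leNgt ls orbT.
Qed.

Lemma chart_in e s (H : 0 < s < length e) : chart e s = inr (exist _ (e, s) H).
Proof.
have /andP[s0 sl] := H; rewrite /chart leNgt s0/=.
by case: insubP => [u _ us|/negP]; [congr inr; exact: val_inj|].
Qed.

Definition clamp (l s : R) : R := Num.max 0 (Num.min s l).

Lemma clamp_id l s : 0 <= s <= l -> clamp l s = s.
Proof. by move=> /andP[s0 sl]; rewrite /clamp min_l// max_r. Qed.

Lemma continuous_clamp l : continuous (clamp l).
Proof.
move=> s; apply: (@continuous_max R R (cst 0) (fun s => Num.min s l)).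
  exact: cvg_cst.
by apply: (@continuous_min R R id (cst l)); [exact: cvg_id|exact: cvg_cst].
Qed.

Definition glue v F (y : metric_graph W) : R :=
  match y with inl x => v x | inr a => F (sval a).1 (sval a).2 end.

Definition compatible v F : Prop :=
  forall e, F e 0 = v (lsrc e) /\ F e (length e) = v (ltgt e).

Lemma glue_chart_clamp v F e s : compatible v F ->
  glue v F (chart e s) = F e (clamp (length e) s).
Proof.
move=> H; have [F0 Fl] := H e.
have [s0|s0] := leP s 0.
  by rewrite chart_le0//= -F0 /clamp max_l// ge_min s0.
have [ls|sl] := leP (length e) s.
  by rewrite chart_ge//= -Fl /clamp min_r// max_r.
have H0 : 0 < s < length e by rewrite s0 sl.
by rewrite (chart_in H0)/= clamp_id// !ltW.
Qed.

Lemma glue_chart v F e s : compatible v F -> `[0, length e]%classic s ->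
  glue v F (chart e s) = F e s.
Proof.
by move=> H; rewrite /= in_itv/= => ls; rewrite glue_chart_clamp// clamp_id.
Qed.

Lemma continuous_chart e : continuous (chart e : R -> metric_graph W).
Proof. by apply/continuousP => U; exact. Qed.

(** The universal property of the quotient topology. *)
Lemma continuous_graphP (T : topologicalType) (f : metric_graph W -> T) :
  (forall e, continuous (f \o chart e)) -> continuous f.
Proof.
move=> H; apply/continuousP => U oU; rewrite open_metric_graphE => e.
by have /continuousP := H e; apply.
Qed.

Lemma continuous_glue v F : compatible v F ->
  (forall e, continuous (F e)) -> continuous (glue v F).
Proof.
move=> H cF; apply: continuous_graphP => e.
have -> : glue v F \o chart e = F e \o clamp (length e).
  by apply/funext => s /=; exact: glue_chart_clamp.
move=> s; apply: continuous_comp; [exact: continuous_clamp|exact: cF].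
Qed.

Lemma metric_graph_chart (y : metric_graph W) :
  exists e s, 0 <= s <= length e /\ y = chart e s.
Proof.
case: y => [x|[[e s] H]].
  exists (inr x), 0; rewrite lexx ge0; split => //.
  by rewrite chart_le0.
exists e, s; have /andP[s0 sl] := H; split; first by rewrite !ltW.
by rewrite (chart_in H).
Qed.

Definition open_edge e : set (metric_graph W) :=
  [set y | if y is inr a then (sval a).1 = e else False].

Lemma preimage_open_edge e : chart e @^-1` open_edge e = `]0, length e[%classic.
Proof.
apply/seteqP; split => s /=; rewrite /open_edge/= in_itv/=.
  have [s0|s0] := leP s 0; first by rewrite chart_le0.
  by have [ls|//] := leP (length e) s; rewrite chart_ge.
by move=> H; rewrite (chart_in H).
Qed.

Lemma preimage_open_edge_neq e e' : e' <> e -> chart e' @^-1` open_edge e = set0.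
Proof.
move=> ee'; apply/seteqP; split => s //=; rewrite /open_edge/=.
have [s0|s0] := leP s 0; first by rewrite chart_le0.
have [ls|ls] := leP (length e') s; first by rewrite chart_ge.
have H : 0 < s < length e' by rewrite s0 ls.
by rewrite (chart_in H).
Qed.

Definition coord (y : metric_graph W) : R :=
  if y is inr a then (sval a).2 else 0.

Lemma open_edge_coord e (U : set R) : open U -> open (open_edge e `&` coord @^-1` U).
Proof.
move=> oU; rewrite open_metric_graphE => e'; rewrite preimage_setI.
have [->|/eqP ee'] := eqVneq e' e; last first.
  by rewrite preimage_open_edge_neq// set0I; exact: open0.
rewrite preimage_open_edge (_ : _ `&` _ = `]0, length e[%classic `&` U).
  by apply: openI => //; exact: interval_open.
apply/seteqP; split => s /= [H]; move: (H); rewrite in_itv/= => H0;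
  by rewrite (chart_in H0).
Qed.

Lemma open_open_edge e : open (open_edge e).
Proof.
rewrite -(setIT (open_edge e)) -(preimage_setT coord).
exact: open_edge_coord openT.
Qed.

Lemma measurable_graph_open (U : set (metric_graph W)) : open U -> measurable U.
Proof. by move=> oU; exact: sub_sigma_algebra. Qed.

Lemma measurable_open_edge e : measurable (open_edge e).
Proof. by apply: measurable_graph_open; exact: open_open_edge. Qed.

Lemma continuous_measurable_graph (f : metric_graph W -> R) :
  continuous f -> measurable_fun setT f.
Proof.
move=> cf; apply: (measurability _ (RGenOpens.measurableE R)) => //.
move=> _ [_ [a [b ->] <-]]; rewrite setTI; apply: measurable_graph_open.
by move/continuousP : cf; apply; exact: interval_open.
Qed.

Lemma measurable_open_edge_fun e (f : R -> R) : measurable_fun setT f ->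
  measurable_fun setT
    ((fun y => f (coord y)) \_ (open_edge e) : metric_graph W -> R).
Proof.
move=> mf; apply/(measurable_restrictT _ (measurable_open_edge e)).
have mc : measurable_fun (open_edge e) coord.
  apply: (measurability _ (RGenOpens.measurableE R)) => //.
  move=> _ [_ [a [b ->] <-]]; apply: measurable_graph_open.
  by apply: open_edge_coord; exact: interval_open.
exact: measurableT_comp.
Qed.

End chart_theory.

(** * Integrals over the graph as sums over its edges *)

Section edge_integrals.
Variables (R : realType) (W : weighted_graph R).
Local Notation mu := (@lebesgue_measure R).
Local Notation length e := (len e)%:num.
Implicit Types (e : loop_edge W) (c : loop_edge W -> {nonneg R}).

Lemma ge0_integral_mrestr d (T : measurableType d)
    (m : {measure set T -> \bar R}) (D : set T) (mD : measurable D)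
    (k : T -> \bar R) : measurable_fun setT k -> (forall y, 0 <= k y)%E ->
  (\int[mrestr m mD]_y k y = \int[m]_(y in D) k y)%E.
Proof.
move=> mk k0.
have -> : (\int[m]_(y in D) k y = \int[mrestr m mD]_(y in D) k y)%E.
  by apply: eq_measure_integral => A mA AD; rewrite /= /mrestr (setIidl AD).
rewrite (@ge0_negligible_integral _ _ _ (mrestr m mD) setT (~` D))//.
- by rewrite setTD setCK.
- exact: measurableC.
- by rewrite /= /mrestr setICl measure0.
Qed.

(** The series over codes is reindexed by edges: codes of no edge contribute 0, and coding is
    injective. *)
Lemma ge0_integral_edge_measure c (k : metric_graph W -> \bar R) :
  measurable_fun setT k -> (forall y, 0 <= k y)%E ->
  (\int[edge_measure c]_y k y =
   \esum_(e in setT) ((c e)%:num%:E * \int[mu]_(s in `[0%R, length e]) k (chart e s)))%E.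
Proof.
move=> mk k0.
pose b n := (if pickle_inv n is Some e then
     (c e)%:num%:E * \int[mu]_(s in `[0%R, length e]) k (chart e s) else 0)%E.
have b0 n : (0 <= b n)%E.
  rewrite /b; case: pickle_inv => // e.
  by rewrite mule_ge0 ?lee_fin// integral_ge0.
transitivity (\sum_(n <oo) b n)%E.
  rewrite ge0_integral_measure_series//; apply: eq_eseriesr => n _.
  rewrite /b; case: pickle_inv => [e|]; last exact: integral_measure_zero.
  rewrite ge0_integral_mscale//; congr (_ * _)%E.
  rewrite ge0_integral_pushforward//.
  rewrite preimage_setT ge0_integral_mrestr//; last by move=> s; exact: k0.
  by apply: measurableT_comp => //; exact: measurable_chart.
rewrite nneseries_esumT//.
transitivity (\esum_(i in [set (pickle e : nat) | e in [set: loop_edge W]]) b i)%E.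
  rewrite [RHS]esum_mkcond; apply: eq_esum => n _.
  case: ifPn => // /negP H; rewrite /b; case En : pickle_inv => [e|//].
  case: H; rewrite inE; exists e => //.
  by have := @pickle_invK (loop_edge W) n; rewrite /= En.
rewrite esum_image; last by move=> e e' _ _; exact: (pcan_inj pickleK_inv).
by apply: eq_esum => e _; rewrite /b pickleK_inv.
Qed.

(** Weak derivatives are determined only almost everywhere on each edge; this permits exchanging
    them under an integral. *)
Lemma ge0_integral_edge_measure_eq c (k k' : metric_graph W -> \bar R) :
  measurable_fun setT k -> (forall y, 0 <= k y)%E ->
  measurable_fun setT k' -> (forall y, 0 <= k' y)%E ->
  (forall e, {ae mu, forall s, `[0, length e]%classic s ->
     k (chart e s) = k' (chart e s)}) ->
  (\int[edge_measure c]_y k y = \int[edge_measure c]_y k' y)%E.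
Proof.
move=> mk k0 mk' k'0 H; rewrite !ge0_integral_edge_measure//.
apply: eq_esum => e _; congr (_ * _)%E.
apply: ge0_ae_eq_integral => //.
- by apply: measurable_funTS; apply: measurableT_comp => //; exact: measurable_chart.
- by apply: measurable_funTS; apply: measurableT_comp => //; exact: measurable_chart.
- exact: H.
Qed.

Lemma ge0_integral_edge_measure_eq0 c (k : metric_graph W -> \bar R) :
  measurable_fun setT k -> (forall y, 0 <= k y)%E ->
  (forall e, 0 < (c e)%:num) ->
  (\int[edge_measure c]_y k y = 0)%E ->
  forall e, (\int[mu]_(s in `[0%R, length e]) k (chart e s) = 0)%E.
Proof.
move=> mk k0 c0 + e; rewrite ge0_integral_edge_measure// => H.
have le0 : ((c e)%:num%:E * \int[mu]_(s in `[0%R, length e]) k (chart e s) <= 0)%E.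
  rewrite -H; apply: esum_ge; exists [set e]; last by rewrite fsbig_set1.
  by split.
have : ((c e)%:num%:E * \int[mu]_(s in `[0%R, length e]) k (chart e s) == 0)%E.
  by rewrite eq_le le0 mule_ge0 ?lee_fin// integral_ge0.
rewrite mule_eq0 => /orP[|/eqP//].
by rewrite eqe gt_eqF.
Qed.

Lemma ge0_integral_edge_measure_finite c (S : seq (loop_edge W))
    (k : metric_graph W -> \bar R) : uniq S ->
  measurable_fun setT k -> (forall y, 0 <= k y)%E ->
  (forall e, e \notin S -> {ae mu, forall s, `[0, length e]%classic s ->
     k (chart e s) = 0%E}) ->
  (\int[edge_measure c]_y k y =
   \sum_(e <- S) (c e)%:num%:E * \int[mu]_(s in `[0%R, length e]) k (chart e s))%E.
Proof.
move=> uS mk k0 H; rewrite ge0_integral_edge_measure// fsbig_seq//.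
rewrite -esum_fset//; last by move=> e _; rewrite mule_ge0 ?lee_fin// integral_ge0.
rewrite [RHS]esum_mkcond; apply: eq_esum => e _; case: ifPn => // eS.
rewrite (ge0_ae_eq_integral (g := cst 0%E))//.
- by rewrite integral0 mule0.
- by apply: measurable_funTS; apply: measurableT_comp => //; exact: measurable_chart.
- by apply: H; apply: contra eS => eS; rewrite inE.
Qed.

Lemma Rintegral_edge_measure_finite c (S : seq (loop_edge W))
    (k : metric_graph W -> R) : uniq S -> measurable_fun setT k ->
  (forall e, e \in S -> mu.-integrable `[0, length e] (EFin \o (k \o chart e))) ->
  (forall e, e \notin S -> {ae mu, forall s, `[0, length e]%classic s ->
     k (chart e s) = 0}) ->
  (edge_measure c).-integrable setT (EFin \o k) /\
  \int[edge_measure c]_y k y =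
  \sum_(e <- S) (c e)%:num * \int[mu]_(s in `[0, length e]) k (chart e s).
Proof.
move=> uS mk ik H.
have mEk : measurable_fun setT (EFin \o k) by exact/measurable_EFinP.
have Hp e : e \notin S -> {ae mu, forall s, `[0, length e]%classic s ->
     ((EFin \o k)^\+ (chart e s))%E = 0%E}.
  move=> /H; apply: (@filterS _ _ (ae_filter_ringOfSetsType mu)) => s Hs /Hs.
  by rewrite funeposE /= => ->; rewrite maxxx.
have Hn e : e \notin S -> {ae mu, forall s, `[0, length e]%classic s ->
     ((EFin \o k)^\- (chart e s))%E = 0%E}.
  move=> /H; apply: (@filterS _ _ (ae_filter_ringOfSetsType mu)) => s Hs /Hs.
  by rewrite funenegE /= => ->; rewrite oppr0 maxxx.
have Ha e : e \notin S -> {ae mu, forall s, `[0, length e]%classic s ->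
     (`|(EFin \o k) (chart e s)|)%E = 0%E}.
  move=> /H; apply: (@filterS _ _ (ae_filter_ringOfSetsType mu)) => s Hs /Hs /= ->.
  by rewrite normr0.
split.
  apply/integrableP; split => //.
  rewrite (ge0_integral_edge_measure_finite c uS)//; last exact: measurableT_comp.
  rewrite big_seq; apply: lte_sum_pinfty => e eS.
  by rewrite lte_mul_pinfty// ?lee_fin//; case/integrableP : (ik e eS).
rewrite /Rintegral integralE.
rewrite (ge0_integral_edge_measure_finite c uS)//; last exact: measurable_funepos.
rewrite (ge0_integral_edge_measure_finite c uS)//; last exact: measurable_funeneg.
pose p e := (\int[mu]_(s in `[0%R, length e]) ((EFin \o k)^\+ (chart e s)))%E.
pose n e := (\int[mu]_(s in `[0%R, length e]) ((EFin \o k)^\- (chart e s)))%E.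
have p'E e : (p e = \int[mu]_(s in `[0%R, length e]) (EFin \o (k \o chart e))^\+ s)%E.
  by apply: eq_integral => s _; rewrite !funeposE.
have n'E e : (n e = \int[mu]_(s in `[0%R, length e]) (EFin \o (k \o chart e))^\- s)%E.
  by apply: eq_integral => s _; rewrite !funenegE.
have pE e : e \in S -> p e \is a fin_num.
  by move=> eS; rewrite p'E; exact: integrable_pos_fin_num (ik e eS).
have nE e : e \in S -> n e \is a fin_num.
  by move=> eS; rewrite n'E; exact: integrable_neg_fin_num (ik e eS).
transitivity (fine (\sum_(e <- S) ((c e)%:num * fine (p e))%:E -
                    \sum_(e <- S) ((c e)%:num * fine (n e))%:E)%E).
  congr (fine (_ - _)); rewrite big_seq [RHS]big_seq; apply: eq_bigr => e eS.
    by rewrite EFinM fineK// pE.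
  by rewrite EFinM fineK// nE.
rewrite !sumEFin/= -sumrB big_seq [RHS]big_seq; apply: eq_bigr => e eS.
rewrite -mulrBr; congr (_ * _); rewrite /Rintegral integralE.
by rewrite -p'E -n'E [RHS]fineB ?pE ?nE.
Qed.

End edge_integrals.

(** * Weak derivatives on the graph and the domain of the form *)

Section weak_derivatives.
Variables (R : realType) (W : weighted_graph R).
Local Notation mu := (@lebesgue_measure R).
Local Notation length e := (len e)%:num.
Implicit Types (e : loop_edge W) (f g h : metric_graph W -> R).

Lemma measurable_comp_chart h e : measurable_fun setT h ->
  measurable_fun setT (h \o chart e).
Proof. by move=> mh; apply: measurableT_comp => //; exact: measurable_chart. Qed.

Lemma continuous_comp_chart f e : continuous f -> continuous (f \o chart e).
Proof.
move=> cf s; apply: continuous_comp; last exact: cf.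
exact: continuous_chart.
Qed.

Lemma weak_derivative_integrable f h e : is_weak_derivative f h ->
  mu.-integrable `[0, length e] (EFin \o (h \o chart e)).
Proof.
move=> [mh /(_ e)[h2 _]]; apply: sqr_integrable_integrable => //.
- by rewrite /= lebesgue_measure_itv/=; case: ifP => _; rewrite ?ltry// -EFinD ltry.
- by apply: measurable_funTS; exact: measurable_comp_chart.
Qed.

Lemma weak_derivative_unique f h1 h2 e : continuous f ->
  is_weak_derivative f h1 -> is_weak_derivative f h2 ->
  {ae mu, forall s, `[0, length e]%classic s -> h1 (chart e s) = h2 (chart e s)}.
Proof.
move=> cf w1 w2.
apply: (@weak_derivative_unique_itv R (f \o chart e) (h1 \o chart e) (h2 \o chart e)) => //.
- exact: continuous_comp_chart.
- exact: weak_derivative_integrable w1.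
- exact: weak_derivative_integrable w2.
- by have [_ /(_ e)[_ ]] := w1.
- by have [_ /(_ e)[_ ]] := w2.
Qed.

Lemma weak_derivative_of f : edgewise_W12 f -> is_weak_derivative f (weak_derivative f).
Proof. by move=> H; exact: (xgetPex _ H). Qed.

Lemma weak_derivative_cst0 : is_weak_derivative (fun _ : metric_graph W => 0) (fun _ => 0).
Proof.
split; first exact: measurable_cst.
move=> e l; split.
  under eq_integral do rewrite expr0n/=.
  by rewrite integral0 ltry.
move=> psi _; under eq_Rintegral do rewrite mul0r.
by under [in RHS]eq_Rintegral do rewrite mul0r; rewrite Rintegral_cst// mul0r oppr0.
Qed.

Lemma sqrB_le (a b : R) : (a - b) ^+ 2 <= 2 * a ^+ 2 + 2 * b ^+ 2.
Proof. by have := sqr_ge0 (a + b); nra. Qed.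

Lemma integral_sqrB_lty d (T : measurableType d) (m : {measure set T -> \bar R})
    (D : set T) (a b : T -> R) : measurable D ->
  measurable_fun D a -> measurable_fun D b ->
  (\int[m]_(x in D) (a x ^+ 2)%:E < +oo)%E ->
  (\int[m]_(x in D) (b x ^+ 2)%:E < +oo)%E ->
  (\int[m]_(x in D) ((a x - b x) ^+ 2)%:E < +oo)%E.
Proof.
move=> mD ma mb a2 b2.
apply: (@le_lt_trans _ _ (\int[m]_(x in D) ((2 * a x ^+ 2)%:E + (2 * b x ^+ 2)%:E))%E).
  apply: ge0_le_integral => //.
  - by move=> x _; rewrite lee_fin sqr_ge0.
  - by apply/measurable_EFinP/measurable_funX/measurable_funB.
  - by apply: emeasurable_funD; apply/measurable_EFinP; apply: measurable_funM => //;
    exact: measurable_funX.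
  - by move=> x _; rewrite -EFinD lee_fin sqrB_le.
rewrite ge0_integralD//; last 4 first.
- by move=> x _; rewrite lee_fin mulr_ge0// sqr_ge0.
- by apply/measurable_EFinP; apply: measurable_funM => //; exact: measurable_funX.
- by move=> x _; rewrite lee_fin mulr_ge0// sqr_ge0.
- by apply/measurable_EFinP; apply: measurable_funM => //; exact: measurable_funX.
under eq_integral do rewrite EFinM.
under [X in (_ + X)%E]eq_integral do rewrite EFinM.
rewrite !ge0_integralZl//; try by move=> x _; rewrite lee_fin sqr_ge0.
- by apply: lte_add_pinfty; apply: lte_mul_pinfty.
- exact/measurable_EFinP/measurable_funX.
- exact/measurable_EFinP/measurable_funX.
Qed.

Lemma test_function_continuous l (psi : R -> R) : test_function l psi -> continuous psi.
Proof.
move=> [dpsi _ _] s; apply: differentiable_continuous; exact/derivable1_diffP.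
Qed.

Lemma is_weak_derivativeB f1 f2 h1 h2 : continuous f1 -> continuous f2 ->
  is_weak_derivative f1 h1 -> is_weak_derivative f2 h2 ->
  is_weak_derivative (f1 \- f2) (h1 \- h2).
Proof.
move=> c1 c2 w1 w2.
have [m1 H1] := w1; have [m2 H2] := w2.
split; first exact: measurable_funB.
move=> e l; have [s1 t1] := H1 e; have [s2 t2] := H2 e; split.
  apply: integral_sqrB_lty => //; apply: measurable_funTS;
    exact: measurable_comp_chart.
move=> psi tpsi; have cpsi := test_function_continuous tpsi.
have [_ cdpsi _] := tpsi.
have i1 := weak_derivative_integrable e w1.
have i2 := weak_derivative_integrable e w2.
have ipsi g : continuous g -> mu.-integrable `[0, l]
     (EFin \o (fun s => g (chart e s) * derive1 psi s)).
  move=> cg; apply: continuous_itv_integrable => s; apply: cvgM; last exact: cdpsi.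
  exact: continuous_comp_chart.
have ih h : mu.-integrable `[0, l] (EFin \o (h \o chart e)) ->
   mu.-integrable `[0, l] (EFin \o (fun s => h (chart e s) * psi s)).
  move=> ih; have := integrable_continuous_mul cpsi ih.
  by congr (_.-integrable _ (EFin \o _)); apply/funext => s; rewrite mulrC.
have -> : \int[mu]_(s in `[0, l]) ((f1 \- f2) (chart e s) * derive1 psi s) =
  \int[mu]_(s in `[0, l]) (f1 (chart e s) * derive1 psi s) -
  \int[mu]_(s in `[0, l]) (f2 (chart e s) * derive1 psi s).
  rewrite -RintegralB//; [|exact: ipsi|exact: ipsi].
  by apply: eq_Rintegral => s _; rewrite mulrBl.
have -> : \int[mu]_(s in `[0, l]) ((h1 \- h2) (chart e s) * psi s) =
  \int[mu]_(s in `[0, l]) (h1 (chart e s) * psi s) -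
  \int[mu]_(s in `[0, l]) (h2 (chart e s) * psi s).
  rewrite -RintegralB//; [|exact: ih|exact: ih].
  by apply: eq_Rintegral => s _; rewrite mulrBl.
by rewrite t1// t2// opprB opprK addrC.
Qed.

(** Membership in [form_domain] gives no bound on [f] directly; one writes f = u_n - (u_n - f), with
    u_n in the core and u_n - f of finite norm. *)
Lemma form_domain_square_integrable f : form_domain f ->
  (\int[@graph_measure R W]_x (f x ^+ 2)%:E < +oo)%E /\
  (\int[@energy_measure R W]_x (weak_derivative f x ^+ 2)%:E < +oo)%E.
Proof.
move=> [cf wf [u uc ucvg]].
have wdf := weak_derivative_of wf.
(* Convergence to the finite value 0 in the extended reals makes the norms finite from some rank
   on. *)
have [n un] : exists n, (form_norm2 (u n \- f)%R < +oo)%E.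
  have /fine_cvgP[[N _ H] _] := ucvg.
  by exists N; rewrite ltey_eq (H N)/=.
have [cu _ wu un1 un2] := uc n.
have wdu := weak_derivative_of wu.
have wB := is_weak_derivativeB cu cf wdu wdf.
have cB : continuous (u n \- f) by move=> x; exact: (cvgB (cu x) (cf x)).
have wdB : is_weak_derivative (u n \- f) (weak_derivative (u n \- f)).
  by apply: weak_derivative_of; eexists; exact: wB.
have mu_ := continuous_measurable_graph cu.
have mf := continuous_measurable_graph cf.
move: un; rewrite /form_norm2 => un.
have ge1 : (0 <= \int[@graph_measure R W]_x ((u n \- f)%R x ^+ 2)%:E)%E.
  by apply: integral_ge0 => x _; rewrite lee_fin sqr_ge0.
have ge2 : (0 <= \int[@energy_measure R W]_x (weak_derivative (u n \- f)%R x ^+ 2)%:E)%E.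
  by apply: integral_ge0 => x _; rewrite lee_fin sqr_ge0.
have un3 : (\int[@graph_measure R W]_x ((u n \- f)%R x ^+ 2)%:E < +oo)%E.
  by apply: le_lt_trans un; rewrite leeDl// mule_ge0// lee_fin.
have un4 : (\int[@energy_measure R W]_x (weak_derivative (u n \- f)%R x ^+ 2)%:E < +oo)%E.
  rewrite ltNge leye_eq; apply/negP => /eqP E; move: un.
  by rewrite E gt0_muley ?lte_fin// addey// -ltNye (lt_le_trans _ ge1).
split.
  have -> : (\int[@graph_measure R W]_x (f x ^+ 2)%:E =
    \int[@graph_measure R W]_x ((u n x - (u n \- f)%R x) ^+ 2)%:E)%E.
    by apply: eq_integral => x _; rewrite /= subKr.
  apply: (@integral_sqrB_lty _ _ (@graph_measure R W) setT (u n) (u n \- f)%R).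
  - exact: measurableT.
  - exact: mu_.
  - exact: measurable_funB.
  - apply: le_lt_trans un1; apply: ge0_le_integral.
    + exact: measurableT.
    + by move=> x _; rewrite lee_fin sqr_ge0.
    + exact/measurable_EFinP/measurable_funX.
    + apply/measurable_EFinP; apply: measurable_funD; apply: measurable_funX => //.
      by case: wdu.
    + by move=> x _; rewrite lee_fin lerDl sqr_ge0.
  - exact: un3.
have wd2 := is_weak_derivativeB cu cB wdu wdB.
have uE : u n \- (u n \- f) = f by apply/funext => x /=; rewrite subKr.
rewrite uE in wd2.
rewrite (@ge0_integral_edge_measure_eq _ _ _ _
  (fun x => ((weak_derivative (u n) x - weak_derivative (u n \- f) x) ^+ 2)%:E)).
- apply: (@integral_sqrB_lty _ _ (@energy_measure R W) setT (weak_derivative (u n))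
    (weak_derivative (u n \- f)%R)).
  + exact: measurableT.
  + by case: wdu.
  + by case: wdB.
  + exact: un2.
  + exact: un4.
- apply/measurable_EFinP/measurable_funX; by case: wdf.
- by move=> x; rewrite lee_fin sqr_ge0.
- apply/measurable_EFinP/measurable_funX/measurable_funB; [by case: wdu|by case: wdB].
- by move=> x; rewrite lee_fin sqr_ge0.
- move=> e; have := weak_derivative_unique e cf wdf wd2.
  by apply: (@filterS _ _ (ae_filter_ringOfSetsType mu)) => s H /H ->.
Qed.

Lemma form_core_form_domain f : form_core f -> form_domain f.
Proof.
move=> fc; have [cf _ wf _ _] := fc; split => //.
exists (fun=> f) => //; apply: cvg_near_cst; near=> n.
rewrite /form_norm2.
have -> : f \- f = fun=> 0 by apply/funext => x /=; rewrite subrr.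
under eq_integral do rewrite expr0n/=.
rewrite integral0 add0e.
have c0 : continuous (cst 0 : metric_graph W -> R) by exact: cst_continuous.
have w0 := weak_derivative_cst0.
have wd0 : is_weak_derivative (fun _ : metric_graph W => 0)
  (weak_derivative (fun _ : metric_graph W => 0)).
  by apply: weak_derivative_of; eexists; exact: w0.
(* [weak_derivative] is a chosen representative, so even for the function 0 it vanishes only almost
   everywhere. *)
rewrite (@ge0_integral_edge_measure_eq _ _ _ _ (cst 0)%E).
- by rewrite integral0 mule0.
- by apply/measurable_EFinP/measurable_funX; case: wd0.
- by move=> x; rewrite lee_fin sqr_ge0.
- by [].
- by [].
- move=> e; have := weak_derivative_unique e c0 wd0 w0.
  by apply: (@filterS _ _ (ae_filter_ringOfSetsType mu)) => s H /H ->; rewrite expr0n.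
Unshelve. all: by end_near. Qed.

End weak_derivatives.

(** * Piecewise quadratic functions *)

Section quadratic_functions.
Variables (R : realType) (W : weighted_graph R).
Local Notation mu := (@lebesgue_measure R).
Local Notation length e := (len e)%:num.
Implicit Types (e : loop_edge W) (val : vert W -> R) (kap : loop_edge W -> R)
  (f g h : metric_graph W -> R) (S : seq (loop_edge W)).

Definition slope val e : R := (val (ltgt e) - val (lsrc e)) / length e.

(** Affine interpolation of [val] plus a parabola vanishing at both ends. The second derivative is
    [- 2 * kap e], so the generator takes the function to [- kap e / dens e]; [kap] is the curvature
    of the overview. *)
Definition quad_edge val kap e (s : R) : R :=
  val (lsrc e) + slope val e * s + kap e * (s * (length e - s)).

Definition dquad_edge val kap e (s : R) : R :=
  slope val e + kap e * (length e - 2 * s).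

Definition quad val kap : metric_graph W -> R := glue val (quad_edge val kap).

(** The value 0 at the vertices is a default on a null set. *)
Definition dquad val kap (y : metric_graph W) : R :=
  if y is inr a then dquad_edge val kap (sval a).1 (sval a).2 else 0.

Lemma quad_compatible val kap : compatible val (quad_edge val kap).
Proof.
move=> e; rewrite /quad_edge /slope; split; first by rewrite !(mulr0, mul0r, addr0).
by rewrite subrr !mulr0 addr0 divfK ?gt_eqF// addrC subrK.
Qed.

Lemma is_derive_quad_edge val kap e (s : R) :
  is_derive s 1 (quad_edge val kap e) (dquad_edge val kap e s).
Proof.
rewrite /quad_edge /dquad_edge; apply: is_derive_eq.
rewrite /GRing.scale/=; ring.
Qed.

Lemma is_derive_dquad_edge val kap e (s : R) :
  is_derive s 1 (dquad_edge val kap e) (- 2 * kap e).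
Proof.
rewrite /dquad_edge; apply: is_derive_eq.
rewrite /GRing.scale/=; ring.
Qed.

Lemma continuous_quad_edge val kap e : continuous (quad_edge val kap e).
Proof.
move=> s; apply: differentiable_continuous; apply/derivable1_diffP.
by have [] := is_derive_quad_edge val kap e s.
Qed.

Lemma continuous_dquad_edge val kap e : continuous (dquad_edge val kap e).
Proof.
move=> s; apply: differentiable_continuous; apply/derivable1_diffP.
by have [] := is_derive_dquad_edge val kap e s.
Qed.

Lemma continuous_quad val kap : continuous (quad val kap).
Proof.
apply: continuous_glue; first exact: quad_compatible.
by move=> e; exact: continuous_quad_edge.
Qed.

Lemma quad_chart val kap e s : 0 <= s <= length e ->
  quad val kap (chart e s) = quad_edge val kap e s.
Proof.
by move=> H; rewrite /quad glue_chart//= ?in_itv//; exact: quad_compatible.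
Qed.

Lemma dquad_chart val kap e s : 0 < s < length e ->
  dquad val kap (chart e s) = dquad_edge val kap e s.
Proof. by move=> H; rewrite (chart_in H). Qed.

Definition supported S val kap : Prop := forall e, e \notin S ->
  [/\ val (lsrc e) = 0, val (ltgt e) = 0 & kap e = 0].

Lemma quad_edge_unsupported S val kap e s : supported S val kap ->
  e \notin S -> quad_edge val kap e s = 0 /\ dquad_edge val kap e s = 0.
Proof.
move=> H /H[v1 v2 k]; rewrite /quad_edge /dquad_edge /slope v1 v2 k.
by rewrite !(subrr, mul0r, addr0).
Qed.

Lemma open_itv_ae (l : R) (p : R -> Prop) :
  (forall s, 0 < s < l -> p s) ->
  {ae mu, forall s, `[0, l]%classic s -> p s}.
Proof.
move=> H; exists [set 0; l]; split.
- exact: measurableU.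
- apply/eqP; rewrite eq_le measure_ge0 andbT.
  apply: le_trans (measureU2 _ _ _) _ => //.
  have E (r : R) : (mu [set r] = 0)%E by exact: lebesgue_measure_set1.
  by rewrite -[X in (_ <= X)%E]adde0 -{1}(E 0) -(E l).
- move=> s /=; rewrite in_itv/= => /not_implyP[/andP[s0 sl]].
  have [->|s0'] := eqVneq s 0; first by left.
  have [->|sl'] := eqVneq s l; first by right.
  by case; apply: H; rewrite !lt_neqAle s0 sl eq_sym s0' sl'.
Qed.

Lemma Rintegral_open_itv (l : R) (k k' : R -> R) :
  measurable_fun `[0, l] k -> measurable_fun `[0, l] k' ->
  (forall s, 0 < s < l -> k s = k' s) ->
  \int[mu]_(s in `[0, l]) k s = \int[mu]_(s in `[0, l]) k' s.
Proof.
move=> mk mk' H; congr fine; apply: ae_eq_integral => //.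
- exact/measurable_EFinP.
- exact/measurable_EFinP.
- have := open_itv_ae H.
  by apply: (@filterS _ _ (ae_filter_ringOfSetsType mu)) => s K /K /= ->.
Qed.

(** [dquad] may jump at the vertices, so it is written as a finite sum of functions that are each
    continuous on one open edge and 0 off it. *)
Lemma measurable_dquad S val kap : uniq S -> supported S val kap ->
  measurable_fun setT (dquad val kap).
Proof.
move=> uS H.
have -> : dquad val kap = fun y => \sum_(e <- S)
    ((fun y => dquad_edge val kap e (coord y)) \_ (open_edge e)) y.
  apply/funext => -[x|[[e s] es]] /=.
    rewrite big1// => e _; rewrite patchE memNset//.
  have [eS|eS] := boolP (e \in S).
    rewrite (bigD1_seq e)//= patchE mem_set// big1 ?addr0// => e' ee'.
    rewrite patchE memNset// /open_edge /= => E.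
    by rewrite E eqxx in ee'.
  rewrite (quad_edge_unsupported s H eS).2 big_seq big1// => e' eS'.
  rewrite patchE memNset// /open_edge /= => E.
  by rewrite E eS' in eS.
apply: measurable_sum => e; apply: measurable_open_edge_fun.
by apply: continuous_measurable_fun; exact: continuous_dquad_edge.
Qed.

(** The product of the quadratic and the test function vanishes at both ends of the edge, hence so
    does the integral of its derivative. *)
Lemma is_weak_derivative_quad S val kap : uniq S -> supported S val kap ->
  is_weak_derivative (quad val kap) (dquad val kap).
Proof.
move=> uS H; split; first exact: measurable_dquad uS H.
move=> e l.
have mq : measurable_fun `[0, l] (dquad val kap \o chart e).
  apply: measurable_funTS; apply: measurable_comp_chart; exact: measurable_dquad uS H.
have cd := @continuous_dquad_edge val kap e.
have md : measurable_fun `[0, l] (dquad_edge val kap e).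
  by apply: measurable_funTS; exact: continuous_measurable_fun.
split.
  rewrite (@ge0_ae_eq_integral _ _ _ mu `[0, l]%classic _
    (fun s => (dquad_edge val kap e s ^+ 2)%:E))//.
  - have c2 : continuous (fun s => dquad_edge val kap e s ^+ 2).
      by move=> s; exact: (cvgM (cd s) (cd s)).
    have /integrableP[_] := continuous_itv_integrable 0 l c2.
    by under [X in (X < _)%E -> _]eq_integral do rewrite gee0_abs ?lee_fin ?sqr_ge0//.
  - exact/measurable_EFinP/measurable_funX.
  - exact/measurable_EFinP/measurable_funX.
  - by move=> s _; rewrite lee_fin sqr_ge0.
  - by move=> s _; rewrite lee_fin sqr_ge0.
  - by apply: open_itv_ae => s sl; rewrite dquad_chart.
move=> psi tpsi; have cpsi := test_function_continuous tpsi.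
have [dpsi cdpsi [a [b [a0 bl ab]]]] := tpsi.
have psi0 s : ~ (a <= s <= b) -> psi s = 0.
  by move=> sab; apply/eqP; apply/negPn/negP => /ab.
have -> : \int[mu]_(s in `[0, l]) (dquad val kap (chart e s) * psi s) =
          \int[mu]_(s in `[0, l]) (dquad_edge val kap e s * psi s).
  apply: Rintegral_open_itv => //.
  - apply: measurable_funM => //; apply: measurable_funTS; exact: continuous_measurable_fun.
  - apply: measurable_funM => //; apply: measurable_funTS; exact: continuous_measurable_fun.
  - by move=> s sl; rewrite dquad_chart.
have -> : \int[mu]_(s in `[0, l]) (quad val kap (chart e s) * derive1 psi s) =
          \int[mu]_(s in `[0, l]) (quad_edge val kap e s * derive1 psi s).
  by apply: eq_Rintegral => s; rewrite inE/= in_itv/= => sl; rewrite quad_chart.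
have cq := @continuous_quad_edge val kap e.
have c1 : continuous (fun s => quad_edge val kap e s * derive1 psi s).
  by move=> s; apply: cvgM; [exact: cq|exact: cdpsi].
have c2 : continuous (fun s => dquad_edge val kap e s * psi s).
  by move=> s; apply: cvgM; [exact: cd|exact: cpsi].
apply/eqP; rewrite -subr_eq0 opprK -RintegralD//;
  [|exact: continuous_itv_integrable c1|exact: continuous_itv_integrable c2].
have dF (s : R) : is_derive s 1 (fun s => quad_edge val kap e s * psi s)
    (quad_edge val kap e s * derive1 psi s + dquad_edge val kap e s * psi s).
  have dq := is_derive_quad_edge val kap e s.
  have dp : is_derive s 1 psi (derive1 psi s).
    by apply: DeriveDef; [exact: dpsi|rewrite derive1E].
  have dM := is_deriveM dq dp.
  apply: (@is_derive_eq _ _ _ _ _ _ _ _ dM).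
  by rewrite /GRing.scale/= [X in _ + X]mulrC.
have cF : continuous (fun s => quad_edge val kap e s * derive1 psi s +
    dquad_edge val kap e s * psi s).
  by move=> s; exact: (cvgD (c1 s) (c2 s)).
have l0 : 0 < l by rewrite /l.
rewrite (Rintegral_continuous_FTC2 l0 cF dF).
by rewrite !psi0 ?mulr0 ?subr0//; apply/negP; rewrite negb_and -!ltNge ?a0 ?bl ?orbT.
Qed.

End quadratic_functions.

(** * Quadratic functions of finite support belong to the core of the form *)

Section quadratic_core.
Variables (R : realType) (W : weighted_graph R).
Local Notation mu := (@lebesgue_measure R).
Local Notation length e := (len e)%:num.
Implicit Types (e : loop_edge W) (val : vert W -> R) (kap : loop_edge W -> R)
  (f g h : metric_graph W -> R) (S : seq (loop_edge W)).

Definition closed_edges S : set (metric_graph W) :=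
  \bigcup_(e in [set` S]) (chart e @` `[0, length e]).

Lemma chart_range e s : exists2 t, `[0, length e]%classic t & chart e t = chart e s.
Proof.
have [s0|s0] := leP s 0.
  by exists 0; [rewrite /= in_itv/= lexx ltW|rewrite !chart_le0].
have [ls|sl] := leP (length e) s.
  by exists (length e); [rewrite /= in_itv/= lexx andbT ltW|rewrite !chart_ge].
by exists s; rewrite //= in_itv/= !ltW.
Qed.

Lemma compact_closed_edges S : compact (closed_edges S).
Proof.
elim: S => [|e S IH]; first by rewrite /closed_edges set_nil bigcup_set0; exact: compact0.
have -> : closed_edges (e :: S) = (chart e @` `[0, length e]) `|` closed_edges S.
  apply/seteqP; split => y.
    move=> [e' /=]; rewrite inE => /orP[/eqP ->|e'S] ye'; [by left|by right; exists e'].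
  move=> [ye|[e' /= e'S ye']]; first by exists e => //=; rewrite mem_head.
  by exists e' => //=; rewrite inE e'S orbT.
apply: compactU => //.
apply: continuous_compact; last exact: segment_compact.
by apply: continuous_subspaceT; exact: continuous_chart.
Qed.

(** Checked chart by chart from the definition of the quotient topology. In the chart of an edge
    outside [S], the complement is an open interval. *)
Lemma closed_closed_edges S : closed (closed_edges S).
Proof.
rewrite -[closed_edges S]setCK; apply: open_closedC.
rewrite open_metric_graphE => e; rewrite preimage_setC.
have [eS|eS] := boolP (e \in S).
  rewrite [X in open X](_ : _ = set0); first exact: open0.
  apply/seteqP; split => // s; apply; exists e => //.
  by have [t ? ?] := chart_range e s; exists t.
have inP s : 0 < s < length e -> ~ closed_edges S (chart e s).
  move=> sl [e' e'S [t _]].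
  have [t0|t0] := leP t 0; first by rewrite chart_le0// (chart_in sl).
  have [lt|tl] := leP (length e') t; first by rewrite chart_ge// (chart_in sl).
  have tl' : 0 < t < length e' by rewrite t0.
  rewrite (chart_in sl) (chart_in tl') => -[ee' _].
  by move: eS; rewrite -ee' (e'S : is_true (e' \in S)).
(* The chart is constant on each half-line outside ]0, length e[, so that half-line is kept or
   dropped as a whole, according to its vertex. *)
pose a : itv_bound R := if pselect (closed_edges S (vertex (lsrc e))) then BRight 0 else
  BInfty _ true.
pose b : itv_bound R := if pselect (closed_edges S (vertex (ltgt e))) then BLeft (length e)
  else BInfty _ false.
rewrite [X in open X](_ : _ = [set` Interval a b]); last first.
  apply/seteqP; split => s /=; rewrite itv_boundlr /a /b.
    move=> H; apply/andP; split.
      case: pselect => //= Hs; rewrite bnd_simp ltNge; apply/negP => s0.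
      by apply: H; rewrite chart_le0.
    case: pselect => //= Hs; rewrite bnd_simp ltNge; apply/negP => s0.
    by apply: H; rewrite chart_ge.
  move=> /andP[Ha Hb] Hs.
  have [s0|s0] := leP s 0.
    move: Ha Hs; rewrite chart_le0//; case: pselect => //= _.
    by rewrite bnd_simp ltNge s0.
  have [ls|sl] := leP (length e) s.
    move: Hb Hs; rewrite chart_ge//; case: pselect => //= _.
    by rewrite bnd_simp ltNge ls.
  by apply: inP Hs; rewrite s0.
by rewrite /a /b; case: pselect => ?; case: pselect => ?; exact: interval_open.
Qed.

Lemma quad_off_closed_edges S val kap y : supported S val kap ->
  quad val kap y != 0 -> closed_edges S y.
Proof.
move=> H; have [e [s [sl ->]]] := metric_graph_chart y.
rewrite quad_chart// => q0; exists e; last by exists s.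
apply/negPn/negP => eS; move: q0.
by rewrite (quad_edge_unsupported s H eS).1 eqxx.
Qed.

Lemma quad_compactly_supported S val kap : supported S val kap ->
  compactly_supported (quad val kap).
Proof.
move=> H; rewrite /compactly_supported.
have sub : closure [set x | quad val kap x != 0] `<=` closed_edges S.
  rewrite [X in _ `<=` X](closure_id _).1; last exact: closed_closed_edges.
  by apply: closure_subset => y /=; exact: quad_off_closed_edges.
apply: (subclosed_compact _ (@compact_closed_edges S) sub).
exact: closed_closure.
Qed.

Lemma weak_derivative_quad S val kap e : uniq S -> supported S val kap ->
  {ae mu, forall s, `[0, length e]%classic s ->
    weak_derivative (quad val kap) (chart e s) = dquad_edge val kap e s}.
Proof.
move=> uS H; have w := is_weak_derivative_quad uS H.
have w' : is_weak_derivative (quad val kap) (weak_derivative (quad val kap)).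
  by apply: weak_derivative_of; eexists; exact: w.
have A := weak_derivative_unique e (@continuous_quad _ _ val kap) w' w.
have B : {ae mu, forall s, `[0, length e]%classic s ->
    dquad val kap (chart e s) = dquad_edge val kap e s}.
  by apply: open_itv_ae => s; exact: dquad_chart.
apply: (@filterS2 _ _ (ae_filter_ringOfSetsType mu) _ _ _ _ A B) => s a b sl.
by rewrite a// b.
Qed.

Lemma quad_form_core S val kap : uniq S -> supported S val kap ->
  form_core (quad val kap).
Proof.
move=> uS H; have cq := @continuous_quad _ _ val kap.
have w := is_weak_derivative_quad uS H.
have w' : is_weak_derivative (quad val kap) (weak_derivative (quad val kap)).
  by apply: weak_derivative_of; eexists; exact: w.
have mq := continuous_measurable_graph cq.
have [mw _] := w'.
have D e := @weak_derivative_quad S val kap e uS H.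
(* Both integrability conditions of [form_core] in one: [t = 1] with the graph measure, [t = 0] with
   the energy measure. *)
have fin (c : loop_edge W -> {nonneg R}) (t : R) : 0 <= t ->
  (\int[edge_measure c]_x (t * quad val kap x ^+ 2 + weak_derivative (quad val kap) x ^+
    2)%:E < +oo)%E.
  move=> t0.
  have pos2 (a b : R) : 0 <= t * a ^+ 2 + b ^+ 2.
    by rewrite addr_ge0 ?(mulr_ge0 t0 (sqr_ge0 a)) ?sqr_ge0.
  rewrite (ge0_integral_edge_measure_finite c uS); last 3 first.
  - apply/measurable_EFinP/measurable_funD; last exact: measurable_funX.
    by apply: measurable_funM => //; exact: measurable_funX.
  - by move=> y; rewrite lee_fin pos2.
  - move=> e eS; apply: (@filterS _ _ (ae_filter_ringOfSetsType mu) _ _ _ (D e)) => s Hs sl.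
    rewrite Hs// quad_chart//.
    by have [-> ->] := quad_edge_unsupported s H eS; rewrite expr0n/= mulr0 addr0.
  apply: lte_sum_pinfty => e _; apply: lte_mul_pinfty => //.
  have c2 : continuous (fun s => t * quad_edge val kap e s ^+ 2 + dquad_edge val kap e s ^+ 2).
    move=> s; apply: cvgD; last first.
      exact: (cvgM (@continuous_dquad_edge _ _ val kap e s)
        (@continuous_dquad_edge _ _ val kap e s)).
    apply: cvgM; first exact: cvg_cst.
    exact: (cvgM (@continuous_quad_edge _ _ val kap e s) (@continuous_quad_edge _ _ val kap e s)).
  have pos s : (0 <= (t * quad_edge val kap e s ^+ 2 + dquad_edge val kap e s ^+ 2)%:E)%E.
    by rewrite lee_fin pos2.
  rewrite (@ge0_ae_eq_integral _ _ _ mu `[0, length e]%classic _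
     (fun s => (t * quad_edge val kap e s ^+ 2 + dquad_edge val kap e s ^+ 2)%:E)).
  - have /integrableP[_] := continuous_itv_integrable 0 (length e) c2.
    by under [X in (X < _)%E -> _]eq_integral do rewrite gee0_abs ?pos//.
  - by [].
  - apply: measurable_funTS; apply/measurable_EFinP.
    apply: measurable_funD; last by apply: measurable_funX; exact: measurable_comp_chart.
    by apply: measurable_funM => //; apply: measurable_funX; exact: measurable_comp_chart.
  - by apply: measurable_funTS; apply/measurable_EFinP; exact: continuous_measurable_fun.
  - by move=> s _; rewrite lee_fin pos2.
  - by move=> s _; exact: pos.
  - apply: (@filterS _ _ (ae_filter_ringOfSetsType mu) _ _ _ (D e)) => s Hs sl.
    by rewrite Hs// quad_chart.
split => //.
- move=> r r0; exists (quad val kap); split => //.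
    exact: quad_compactly_supported H.
  by move=> x; rewrite subrr normr0 ltW.
- by eexists; exact: w.
- rewrite /graph_measure; set c := (X in edge_measure X).
  have := fin c 1 ler01; congr (_ < _)%E.
  by apply: eq_integral => x _; rewrite mul1r.
- rewrite /energy_measure; set c := (X in edge_measure X).
  have := fin c 0 (lexx 0); congr (_ < _)%E.
  by apply: eq_integral => x _; rewrite mul0r add0r.
Qed.

End quadratic_core.

(** * Quadratic functions as resolvents *)

Section resolvent_quadratic.
Variables (R : realType) (W : weighted_graph R).
Local Notation mu := (@lebesgue_measure R).
Local Notation length e := (len e)%:num.
Implicit Types (e : loop_edge W) (val : vert W -> R) (kap : loop_edge W -> R)
  (f g h : metric_graph W -> R) (S : seq (loop_edge W)).

Lemma ae_integrable (l : R) (k k' : R -> R) : measurable_fun `[0, l] k ->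
  mu.-integrable `[0, l] (EFin \o k') ->
  {ae mu, forall s, `[0, l]%classic s -> k s = k' s} ->
  mu.-integrable `[0, l] (EFin \o k).
Proof.
move=> mk /integrableP[mk' ik'] H; apply/integrableP; split; first exact/measurable_EFinP.
apply: le_lt_trans ik'; rewrite le_eqVlt; apply/orP; left; apply/eqP.
apply: ge0_ae_eq_integral => //.
- by apply: measurableT_comp => //; exact/measurable_EFinP.
- by apply: measurableT_comp.
- by apply: (@filterS _ _ (ae_filter_ringOfSetsType mu) _ _ _ H) => s E sl; rewrite /= E.
Qed.

Lemma Rintegral_edge_measure_ae c S (k : metric_graph W -> R)
    (k' : loop_edge W -> R -> R) : uniq S -> measurable_fun setT k ->
  (forall e, e \in S -> mu.-integrable `[0, length e] (EFin \o k' e)) ->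
  (forall e, {ae mu, forall s, `[0, length e]%classic s -> k (chart e s) = k' e s}) ->
  (forall e s, e \notin S -> k' e s = 0) ->
  (edge_measure c).-integrable setT (EFin \o k) /\
  \int[edge_measure c]_y k y =
  \sum_(e <- S) (c e)%:num * \int[mu]_(s in `[0, length e]) k' e s.
Proof.
move=> uS mk ik' kk' k'0.
have mkc e : measurable_fun `[0, length e] (k \o chart e).
  by apply: measurable_funTS; exact: measurable_comp_chart.
have ik e : e \in S -> mu.-integrable `[0, length e] (EFin \o (k \o chart e)).
  move=> eS; apply: (ae_integrable _ (ik' e eS)) => //; exact: kk'.
have k0 e : e \notin S -> {ae mu, forall s, `[0, length e]%classic s -> k (chart e s) = 0}.
  move=> eS; apply: (@filterS _ _ (ae_filter_ringOfSetsType mu) _ _ _ (kk' e)) => s H sl.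
  by rewrite H// k'0.
have [ki ->] := Rintegral_edge_measure_finite c uS mk ik k0; split => //.
rewrite big_seq [RHS]big_seq; apply: eq_bigr => e eS; congr (_ * fine _).
apply: ae_eq_integral => //.
- by apply/measurable_EFinP; exact: mkc.
- by have := measurable_int _ (ik' e eS).
- by apply: (@filterS _ _ (ae_filter_ringOfSetsType mu) _ _ _ (kk' e)) => s H sl; rewrite /= H.
Qed.

(** The vertex conditions at all vertices at once, in weak form: up to sign, the sum over the
    vertices of [gam] times the weighted outgoing derivatives. Grouped by edges, these are the
    boundary terms left by integration by parts against a function with vertex values [gam]. *)
Definition kirchhoff S val kap : Prop := forall gam : vert W -> R,
  \sum_(e <- S) (cond e)%:num *
    (dquad_edge val kap e (length e) * gam (ltgt e)
     - dquad_edge val kap e 0 * gam (lsrc e)) = 0.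

(** E(u, g) = - (Lu, g) for u the quadratic function. Integration by parts on each edge leaves
    boundary terms, which cancel by [kirchhoff], and [2 * kap e] times the integral of [g]; the 2
    cancels the factor 1/2 of the form, and division by [dens e] accounts for the density in the
    graph measure. *)
Lemma energy_quad S val kap f g : uniq S -> supported S val kap ->
  kirchhoff S val kap -> continuous g -> edgewise_W12 g ->
  measurable_fun setT f ->
  (forall e s, 0 < s < length e -> f (chart e s) = kap e / (dens e)%:num) ->
  (@graph_measure R W).-integrable setT (EFin \o (fun y => f y * g y)) /\
  energy (quad val kap) g = \int[@graph_measure R W]_y (f y * g y).
Proof.
move=> uS H K cg wg mf fE.
have wdg := weak_derivative_of wg.
have [mdg _] := wdg.
have wdq : is_weak_derivative (quad val kap) (weak_derivative (quad val kap)).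
  by apply: weak_derivative_of; eexists; exact: is_weak_derivative_quad uS H.
have [mdq _] := wdq.
have cgc e : continuous (g \o chart e) by exact: continuous_comp_chart.
have [] := @Rintegral_edge_measure_ae (fun e => ((cond e)%:num * (dens e)%:num)%:nng) S
  (fun y => f y * g y) (fun e s => (kap e / (dens e)%:num) * g (chart e s)) uS.
- by apply: measurable_funM => //; exact: continuous_measurable_graph.
- move=> e _; apply: continuous_itv_integrable => s.
  by apply: cvgM; [exact: cvg_cst|exact: cgc].
- by move=> e; apply: open_itv_ae => s sl; rewrite fE.
- by move=> e s /H[_ _ ->]; rewrite !mul0r.
move=> ig gE; split; first exact: ig.
rewrite /graph_measure gE.
rewrite /energy.
have [_ ->] := @Rintegral_edge_measure_ae (fun e => (cond e)%:num%:nng) S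
  (fun y => weak_derivative (quad val kap) y * weak_derivative g y)
  (fun e s => dquad_edge val kap e s * weak_derivative g (chart e s)) uS
  (measurable_funM mdq mdg)
  (fun e _ => integrable_continuous_mul (@continuous_dquad_edge _ _ val kap e)
    (weak_derivative_integrable e wdg))
  (fun e => @filterS _ _ (ae_filter_ringOfSetsType mu) _ _
     (fun s E sl => congr1 (fun a => a * _) (E sl)) (@weak_derivative_quad _ _ S val kap e uS H))
  (fun e s eS => etrans (congr1 (fun a => a * _) (quad_edge_unsupported s H eS).2) (mul0r _)).
pose G e := \int[mu]_(s in `[0, length e]) g (chart e s).
have iG e : mu.-integrable `[0, length e] (EFin \o (g \o chart e)).
  exact: continuous_itv_integrable (cgc e).
have parts e : \int[mu]_(s in `[0, length e])
      (dquad_edge val kap e s * weak_derivative g (chart e s)) =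
    (dquad_edge val kap e (length e) * g (vertex (ltgt e)) -
     dquad_edge val kap e 0 * g (vertex (lsrc e))) + 2 * (kap e * G e).
  have cst_c : continuous (cst (- 2 * kap e) : R -> R) by exact: cst_continuous.
  have [_ test] := wdg.2 e.
  rewrite (weak_integration_by_parts (lexx 0) _ (lexx _) (cgc e)
    (weak_derivative_integrable e wdg) test (is_derive_dquad_edge val kap e) cst_c)//.
  rewrite /= (chart_le0 _ (lexx 0)) (chart_ge (lexx (length e))).
  rewrite (RintegralZl (- 2 * kap e) _ (iG e))//.
  rewrite /G; ring.
under eq_bigr do rewrite parts mulrDr.
rewrite big_split/= (K (g \o @vertex R W)) add0r mulr_sumr; apply: eq_bigr => e _.
rewrite (RintegralZl (kap e / (dens e)%:num) _ (iG e))//.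
by rewrite /G; field.
Qed.

Lemma continuous_integral_sqr_eq0 (l : R) (k : R -> R) : 0 < l -> continuous k ->
  (\int[mu]_(s in `[0%R, l]) (k s ^+ 2)%:E = 0)%E -> forall s, 0 <= s <= l -> k s = 0.
Proof.
move=> l0 ck k0 s /andP[s0 sl]; apply/eqP/negPn/negP => ks0.
have e0 : 0 < `|k s| / 2 by rewrite divr_gt0 ?normr_gt0.
have /cvgrPdist_lt/(_ _ e0)/nbhs_ballP[r /= r0 Hr] := ck s.
(* Intersected with [0, l], the interval remains nondegenerate even when [s] is an end. *)
pose c := Num.max 0 (s - r / 2); pose d := Num.min l (s + r / 2).
have cd : c < d by rewrite /c /d lt_min !gt_max; apply/andP; split; apply/andP; split; lra.
have c0 : 0 <= c by rewrite /c le_max lexx.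
have dl : d <= l by rewrite /d ge_min lexx.
have cs : s - r / 2 <= c by rewrite /c le_max lexx orbT.
have ds : d <= s + r / 2 by rewrite /d ge_min lexx orbT.
have : (((`|k s| / 2) ^+ 2 * (d - c))%:E <= 0)%E.
  rewrite -k0.
  apply: (@le_trans _ _ (\int[mu]_(t in `[c, d]) ((`|k s| / 2) ^+ 2)%:E)%E).
    rewrite integral_cst//= lebesgue_measure_itv/= lte_fin cd -EFinD.
    by rewrite -EFinM lexx.
  have mk2 : measurable_fun setT (fun t => (k t ^+ 2)%:E).
    by apply/measurable_EFinP/measurable_funX; exact: continuous_measurable_fun.
  apply: (@le_trans _ _ (\int[mu]_(t in `[c, d]) (k t ^+ 2)%:E)%E).
    apply: ge0_le_integral => //.
    - exact: measurable_funTS.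
    - move=> t /=; rewrite in_itv/= => /andP[ct td]; rewrite lee_fin.
      rewrite -[leRHS]real_normK ?num_real// lerXn2r ?nnegrE// ?(ltW e0)//.
      have : `|k s - k t| < `|k s| / 2 by apply: Hr; rewrite /ball/= ltr_norml; apply/andP;
        split; lra.
      move=> Hk; have := ler_normD (k s - k t) (k t); rewrite subrK; lra.
  apply: (@ge0_subset_integral _ (measurableTypeR R) R mu `[c, d]%classic `[0%R, l]%classic _
    _ (fun t => (k t ^+ 2)%:E)) => //.
  - exact: measurable_funTS.
  - by move=> t _; rewrite lee_fin sqr_ge0.
  - by move=> t /=; rewrite !in_itv/= => /andP[? ?]; apply/andP; split; lra.
rewrite lee_fin leNgt => /negP; apply.
by rewrite mulr_gt0 ?subr_gt0// exprn_gt0.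
Qed.

Lemma integrable_mul_sqr d (T : measurableType d) (m : {measure set T -> \bar R})
    (a b : T -> R) : measurable_fun setT a -> measurable_fun setT b ->
  (\int[m]_x (a x ^+ 2)%:E < +oo)%E -> (\int[m]_x (b x ^+ 2)%:E < +oo)%E ->
  m.-integrable setT (EFin \o (fun x => a x * b x)).
Proof.
have sq (c : T -> R) : measurable_fun setT c -> (\int[m]_x (c x ^+ 2)%:E < +oo)%E ->
    m.-integrable setT (fun x => (c x ^+ 2)%:E).
  move=> mc c2; apply/integrableP; split; first exact/measurable_EFinP/measurable_funX.
  by under eq_integral do rewrite gee0_abs ?lee_fin ?sqr_ge0//.
move=> ma mb /(sq a ma) ia /(sq b mb) ib.
have := integrableD measurableT ia ib; apply: le_integrable => //.
  exact/measurable_EFinP/measurable_funM.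
move=> x _ /=; rewrite lee_fin [leRHS]ger0_norm; last first.
  by rewrite addr_ge0// sqr_ge0.
rewrite normrM -(real_normK (num_real (a x))) -(real_normK (num_real (b x))).
have := normr_ge0 (a x); have := normr_ge0 (b x); have := sqr_ge0 (`|a x| - `|b x|); nra.
Qed.


(** [A], [B], [C] stand for the integrals of products of weak derivatives for the pairs (rho, rho),
    (rho, u), (u, u), and [a], [b], [c] for the scalar products of the same pairs. In the
    alternating sum of the four equations [F] and [G] cancel, and two nonnegative terms with sum 0
    remain. *)
Lemma quadratic_form_eq0 (al A B C a b c F G : R) : 0 < al ->
  0 <= A - 2 * B + C -> 0 <= a - 2 * b + c ->
  2^-1 * A + al * a = F -> 2^-1 * B + al * b = G ->
  2^-1 * B + al * b = F -> 2^-1 * C + al * c = G ->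
  a - 2 * b + c = 0.
Proof.
move=> al0 p1 p2 e1 e2 e3 e4.
have : al * (a - 2 * b + c) <= 0 by lra.
by rewrite pmulr_rle0// => ?; apply/eqP; rewrite eq_le p2 andbT.
Qed.

Section process.
Variables (d : measure_display) (Omega : measurableType d).
Variables (P : state W -> probability Omega R) (Y : R -> Omega -> state W).

(* With u = quad val kap and rho the resolvent of f, testing the equations of rho
   and u against rho and u gives alpha |rho - u|^2 + E(rho - u, rho - u) = 0. *)
Lemma resolvent_quad S val kap (alpha : R) f : associated_with_form P Y ->
  uniq S -> supported S val kap -> kirchhoff S val kap -> 0 < alpha ->
  measurable_fun setT f -> (exists M, forall x, `|f x| <= M) ->
  (forall e s, 0 < s < length e ->
    f (chart e s) = alpha * quad_edge val kap e s + kap e / (dens e)%:num) ->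
  resolvent P Y alpha f = quad val kap.
Proof.
move=> assoc uS H K alpha0 mf bf fE.
pose u := quad val kap.
have cu : continuous u := @continuous_quad _ _ val kap.
have mu_ := continuous_measurable_graph cu.
have f2 : (\int[@graph_measure R W]_x (f x ^+ 2)%:E < +oo)%E.
  pose k' e s := (alpha * quad_edge val kap e s + kap e / (dens e)%:num) ^+ 2.
  have [] := @Rintegral_edge_measure_ae (fun e => ((cond e)%:num * (dens e)%:num)%:nng) S
    (fun y => f y ^+ 2) k' uS (measurable_funX _ mf).
  - move=> e _; apply: continuous_itv_integrable => s.
    have c1 : continuous (fun s => alpha * quad_edge val kap e s + kap e / (dens e)%:num).
      move=> t; apply: cvgD; last exact: cvg_cst.
      by apply: cvgM; [exact: cvg_cst|exact: continuous_quad_edge].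
    exact: (cvgM (c1 s) (c1 s)).
  - by move=> e; apply: open_itv_ae => s sl; rewrite fE.
  - move=> e s eS; rewrite /k' (quad_edge_unsupported s H eS).1.
    by have [_ _ ->] := H e eS; rewrite mulr0 mul0r addr0 expr0n.
  move=> /integrableP[_ Hf] _; apply: le_lt_trans Hf.
  rewrite le_eqVlt; apply/orP; left; apply/eqP; apply: eq_integral => x _.
  by rewrite /= ger0_norm ?sqr_ge0.
have := assoc alpha f alpha0 mf bf f2.
move: (resolvent P Y alpha f) => rho [drho test].
have ucore : form_core u := quad_form_core uS H.
have du : form_domain u := form_core_form_domain ucore.
have [crho wrho _] := drho; have [_ wu _] := du.
have [rho2 Drho2] := form_domain_square_integrable drho.
have [u2 Du2] := form_domain_square_integrable du.
have mrho := continuous_measurable_graph crho.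
have [mDrho _] := weak_derivative_of wrho.
have [mDu _] := weak_derivative_of wu.
(* Inside the edges this is - L u, so that [energy_quad] applies and [u] solves the same equation as
   rho. *)
pose f1 x := f x - alpha * u x.
have mf1 : measurable_fun setT f1.
  by apply: measurable_funB => //; exact: measurable_funM.
have f1E e s : 0 < s < length e -> f1 (chart e s) = kap e / (dens e)%:num.
  move=> /[dup] sl /andP[s0 s1]; rewrite /f1 fE// /u quad_chart ?ltW//.
    by rewrite addrC addKr.
have iI (a b : metric_graph W -> R) : measurable_fun setT a -> measurable_fun setT b ->
   (\int[@graph_measure R W]_x (a x ^+ 2)%:E < +oo)%E ->
   (\int[@graph_measure R W]_x (b x ^+ 2)%:E < +oo)%E ->
   (@graph_measure R W).-integrable setT (EFin \o (fun x => a x * b x)).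
  by move=> ma mb a2 b2; exact: integrable_mul_sqr.
have iJ (a b : metric_graph W -> R) : measurable_fun setT a -> measurable_fun setT b ->
   (\int[@energy_measure R W]_x (a x ^+ 2)%:E < +oo)%E ->
   (\int[@energy_measure R W]_x (b x ^+ 2)%:E < +oo)%E ->
   (@energy_measure R W).-integrable setT (EFin \o (fun x => a x * b x)).
  by move=> ma mb a2 b2; exact: integrable_mul_sqr.
have split_f g : continuous g -> edgewise_W12 g -> measurable_fun setT g ->
    (\int[@graph_measure R W]_x (g x ^+ 2)%:E < +oo)%E ->
    energy u g + alpha * \int[@graph_measure R W]_x (u x * g x) =
    \int[@graph_measure R W]_x (f x * g x).
  move=> cg wg mg g2.
  have [if1 ->] := energy_quad uS H K cg wg mf1 f1E.
  rewrite -(RintegralZl alpha measurableT (iI u g mu_ mg u2 g2)).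
  rewrite -(RintegralD measurableT if1 (integrableZl measurableT alpha (iI u g mu_ mg u2 g2))).
  by apply: eq_Rintegral => x _; rewrite /f1; ring.
have E1 := test rho drho; have E2 := test u du.
have E3 := split_f rho crho wrho mrho rho2.
have E4 := split_f u cu wu mu_ u2.
have sym : energy u rho = energy rho u.
  by rewrite /energy; under eq_Rintegral do rewrite mulrC.
have symI : \int[@graph_measure R W]_x (u x * rho x) = \int[@graph_measure R W]_x (rho x * u x).
  by under eq_Rintegral do rewrite mulrC.
have expand (m : {measure set (metric_graph W) -> \bar R}) (a b : metric_graph W -> R) :
    m.-integrable setT (EFin \o (fun x => a x * a x)) ->
    m.-integrable setT (EFin \o (fun x => a x * b x)) ->
    m.-integrable setT (EFin \o (fun x => b x * b x)) ->
    m.-integrable setT (EFin \o (fun x => (a x - b x) ^+ 2)) /\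
    \int[m]_x ((a x - b x) ^+ 2) = \int[m]_x (a x * a x) - 2 * \int[m]_x (a x * b x)
       + \int[m]_x (b x * b x).
  move=> iaa iab ibb.
  have i2 := integrableZl measurableT 2 iab.
  have i3 := integrableB measurableT iaa i2.
  have i4 := integrableD measurableT i3 ibb.
  split.
    move: i4; apply: (eq_integrable measurableT) => x _.
    rewrite /= -EFinB -EFinD; congr (_%:E).
    ring.
  rewrite -(RintegralZl 2 measurableT iab) -(RintegralB measurableT iaa i2).
  rewrite -(RintegralD measurableT i3 ibb).
  apply: eq_Rintegral => x _; ring.
have [_ X1] := expand (@energy_measure R W) (weak_derivative rho) (weak_derivative u)
  (iJ _ _ mDrho mDrho Drho2 Drho2) (iJ _ _ mDrho mDu Drho2 Du2) (iJ _ _ mDu mDu Du2 Du2).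
have [iX2 X2] := expand (@graph_measure R W) rho u
  (iI _ _ mrho mrho rho2 rho2) (iI _ _ mrho mu_ rho2 u2) (iI _ _ mu_ mu_ u2 u2).
have pos1 : 0 <= \int[@energy_measure R W]_x ((weak_derivative rho x - weak_derivative u x) ^+ 2).
  by apply: Rintegral_ge0 => x _; exact: sqr_ge0.
have pos2 : 0 <= \int[@graph_measure R W]_x ((rho x - u x) ^+ 2).
  by apply: Rintegral_ge0 => x _; exact: sqr_ge0.
have Z : \int[@graph_measure R W]_x ((rho x - u x) ^+ 2) = 0.
  rewrite X2; rewrite X1 in pos1; rewrite X2 in pos2.
  rewrite sym symI in E3.
  exact: (quadratic_form_eq0 alpha0 pos1 pos2 E1 E2 E3 E4).
have Z' : (\int[@graph_measure R W]_x ((rho x - u x) ^+ 2)%:E = 0)%E.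
  have fn := integrable_fin_num measurableT iX2.
  by rewrite -(fineK fn); congr (_%:E); exact: Z.
(* The two functions agree in L^2; continuity along the charts makes them agree everywhere, at the
   vertices too. *)
apply/funext => y; have [e [s [sl ->]]] := metric_graph_chart y.
apply/subr0_eq.
have ck : continuous (fun s => rho (chart e s) - u (chart e s)).
  have c1 : continuous (rho \o chart e) by exact: continuous_comp_chart.
  have c2 : continuous (u \o chart e) by exact: continuous_comp_chart.
  by move=> t; exact: (cvgB (c1 t) (c2 t)).
have l0 : 0 < length e by [].
have mk : measurable_fun setT (fun x => ((rho x - u x) ^+ 2)%:E).
  by apply/measurable_EFinP/measurable_funX/measurable_funB.
have k0 x : (0 <= ((rho x - u x) ^+ 2)%:E)%E by rewrite lee_fin sqr_ge0.
apply: (continuous_integral_sqr_eq0 l0 ck _ sl).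
move: Z'; rewrite /graph_measure; set c := (X in edge_measure X) => Z'.
have c0 e' : 0 < (c e')%:num by rewrite /c/= mulr_gt0.
exact: (@ge0_integral_edge_measure_eq0 R W c _ mk k0 c0 Z' e).
Qed.

End process.
End resolvent_quadratic.

(** * Exponential times *)

Section bounded_integrals.
Variable R : realType.

Definition image_measure d1 d2 (T1 : measurableType d1) (T2 : measurableType d2)
  (m : {measure set T1 -> \bar R}) (f : T1 -> T2) (mf : measurable_fun setT f) :
  {measure set T2 -> \bar R}.
Proof. by refine (pushforward m f). Defined.

Lemma Rintegral_image_measure d1 d2 (T1 : measurableType d1) (T2 : measurableType d2)
    (m : {measure set T1 -> \bar R}) (f : T1 -> T2) (mf : measurable_fun setT f)
    (k : T2 -> R) : measurable_fun setT k ->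
  m.-integrable setT (EFin \o (k \o f)) ->
  (image_measure m mf).-integrable setT (EFin \o k) /\
  \int[image_measure m mf]_y k y = \int[m]_x k (f x).
Proof.
move=> mk ik; have mEk : measurable_fun setT (EFin \o k) by exact/measurable_EFinP.
split; first exact: integrable_pushforward.
by congr fine; rewrite (integral_pushforward mf mEk).
Qed.

Lemma Rintegral_mscale d (T : measurableType d) (m : {measure set T -> \bar R})
    (k : {nonneg R}) (f : T -> R) : m.-integrable setT (EFin \o f) ->
  \int[mscale k m]_x f x = k%:num * \int[m]_x f x.
Proof.
move=> if_; have mf := measurable_int _ if_.
rewrite /Rintegral integralE ge0_integral_mscale//; last exact: measurable_funepos.
rewrite ge0_integral_mscale//; last exact: measurable_funeneg.
have pE := integrable_pos_fin_num measurableT if_.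
have nE := integrable_neg_fin_num measurableT if_.
rewrite -muleBr// -?integralE ?fineM//.
by exact: integrable_fin_num.
by apply: fin_num_adde_defl; rewrite fin_numN.
Qed.

Lemma bounded_integrable d (T : measurableType d) (m : probability T R)
    (f : T -> R) M (D : set T) : measurable D -> measurable_fun setT f ->
  (forall x, `|f x| <= M) -> m.-integrable D (EFin \o f).
Proof.
move=> mD mf bf.
have i1 : m.-integrable D (EFin \o cst M) by exact: finite_measure_integrable_cst.
apply: le_integrable i1 => //.
  by apply/measurable_EFinP; exact: measurable_funTS.
by move=> x _ /=; rewrite lee_fin (le_trans (bf x))// ler_norm.
Qed.

Lemma bounded_Rintegral d (T : measurableType d) (m : probability T R)
    (f : T -> R) M : measurable_fun setT f -> (forall x, `|f x| <= M) ->
  `|\int[m]_x f x| <= M.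
Proof.
move=> mf bf; have if_ := bounded_integrable m measurableT mf bf.
have EM : \int[m]_(_ in setT) M = M.
  by rewrite Rintegral_cst//= [X in _ * fine X]probability_setT mulr1.
apply: (le_trans (le_normr_Rintegral measurableT if_)); rewrite -[leRHS]EM.
apply: le_Rintegral => //.
- by have := integrable_norm if_.
- exact: finite_measure_integrable_cst.
Qed.

Section fubini.
Context d1 d2 (T1 : measurableType d1) (T2 : measurableType d2).
Variables (m1 : probability T1 R) (m2 : probability T2 R).
Variables (f : T1 * T2 -> R) (M : R).
Hypothesis mf : measurable_fun setT f.
Hypothesis bf : forall x, `|f x| <= M.

Let integrable_prod : (m1 \x m2)%E.-integrable setT (EFin \o f).
Proof.
apply/integrable12ltyP; first exact/measurable_EFinP.
have mF : measurable_fun setT (fun x => \int[m2]_y `|(EFin \o f) (x, y)|)%E.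
  apply: (measurable_fun_fubini_tonelli_F (abse \o (EFin \o f))) => //=.
  by apply: measurableT_comp => //; exact/measurable_EFinP.
apply: (@le_lt_trans _ _ (\int[m1]_x (cst M%:E x))%E).
  apply: ge0_le_integral => //.
  - by move=> x _; exact: integral_ge0.
  - move=> x _ /=.
    have EM : (\int[m2]_(_ in setT) M%:E = M%:E)%E.
      by rewrite integral_cst//= [X in (_ * X)%E]probability_setT mule1.
    rewrite -[leRHS]EM; apply: ge0_le_integral => //.
    + have mfx : measurable_fun setT (fun y => f (x, y)).
        by apply: measurableT_comp => //; exact: pair1_measurable.
      by apply/measurable_EFinP; apply: measurableT_comp.
    + by move=> y _; rewrite lee_fin.
by rewrite integral_cst//= [X in (_ * X)%E]probability_setT mule1 ltry.
Qed.

Let inner1 x : (\int[m2]_y (f (x, y))%:E)%E = (\int[m2]_y f (x, y))%:E.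
Proof.
rewrite /Rintegral fineK//; apply: integrable_fin_num => //.
apply: (@bounded_integrable _ _ m2 (fun y => f (x, y)) M) => //.
by apply: measurableT_comp => //; exact: measurable_pair1.
Qed.

Let inner2 y : (\int[m1]_x (f (x, y))%:E)%E = (\int[m1]_x f (x, y))%:E.
Proof.
rewrite /Rintegral fineK//; apply: integrable_fin_num => //.
apply: (@bounded_integrable _ _ m1 (fun x => f (x, y)) M) => //.
by apply: measurableT_comp => //; exact: measurable_pair2.
Qed.

Lemma bounded_fubini :
  \int[m1]_x \int[m2]_y f (x, y) = \int[m2]_y \int[m1]_x f (x, y).
Proof.
rewrite /Rintegral; congr fine.
have := Fubini integrable_prod.
have -> : (\int[m1]_x \int[m2]_y (EFin \o f) (x, y) =
    \int[m1]_x (\int[m2]_y f (x, y))%:E)%E.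
  by apply: eq_integral => x _; exact: inner1.
by move=> ->; apply: eq_integral => y _; exact: inner2.
Qed.

Lemma measurable_bounded_section1 : measurable_fun setT (fun x => \int[m2]_y f (x, y)).
Proof.
have := measurable_fubini_F integrable_prod.
by move=> H; apply/measurable_EFinP; apply: eq_measurable_fun H => x _; exact: inner1.
Qed.

End fubini.
End bounded_integrals.

Section exponential_law.
Variables (R : realType) (al : R).
Local Notation mu := (@lebesgue_measure R).

Definition exp_law (al_gt0 : 0 < al) : probability (measurableTypeR R) R.
Proof. by refine (exponential_prob al). Defined.

Hypothesis al_gt0 : 0 < al.
Local Notation kappa := (exp_law al_gt0).

Lemma exp_lawE A : kappa A = (\int[mu]_(x in A) (exponential_pdf al x)%:E)%E.
Proof. by []. Qed.

Lemma exp_law_ray (a : R) : kappa `[a, +oo[%classic = (expR (- al * Num.max 0 a))%:E.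
Proof.
have ray (b : R) : 0 <= b -> kappa `[b, +oo[%classic = (expR (- al * b))%:E.
  move=> b0; rewrite exp_lawE (@ge0_continuous_FTC2y _ _
    (fun x => - (expR (- al * x))) _ 0)//.
  - by rewrite EFinN oppeK add0e.
  - by move=> x _; apply: exponential_pdf_ge0; exact: ltW.
  - apply: (@continuous_subspaceW R^o _ _ [set` `[0, +oo[%R]).
      by move=> x /=; rewrite !in_itv/= !andbT; exact: le_trans.
    exact: within_continuous_exponential_pdf.
  - rewrite -oppr0; apply: cvgN.
    rewrite (_ : (fun x => expR (- al * x)) =
                 (fun z => expR (- z)) \o (fun z => al * z)); last first.
      by apply: eq_fun => x; rewrite mulNr.
    apply: (@cvg_comp _ _ _ _ _ _ (pinfty_nbhs R)); last exact: cvgr_expR.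
    exact: gt0_cvgMry.
  - apply: cvgN; apply/cvg_at_right_filter.
    apply: continuous_comp; last exact: continuous_expR.
    by apply: cvgM; [exact: cvg_cst|exact: cvg_id].
  - move=> x; rewrite in_itv/= andbT => bx; apply: derive1_exponential_pdf.
    by rewrite in_itv/= andbT (le_lt_trans b0).
have [a0|a0] := leP 0 a; first exact: ray.
rewrite mulr0 expR0; apply/eqP; rewrite eq_le probability_le1//=.
rewrite -(_ : kappa `[0, +oo[%classic = 1%E); last by rewrite ray// mulr0 expR0.
apply: le_measure; rewrite ?inE//.
by move=> x /=; rewrite !in_itv/= !andbT; apply: le_trans; exact: ltW.
Qed.

(** Closed rays are stable under intersection, generate the Borel sets, and exhaust the line. *)
Lemma measure_unique_rays (m1 m2 : {measure set (measurableTypeR R) -> \bar R}) :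
  (forall a, m1 `[a, +oo[%classic = m2 `[a, +oo[%classic) ->
  (forall a, m1 `[a, +oo[%classic < +oo)%E ->
  forall A, measurable A -> m1 A = m2 A.
Proof.
move=> m12 fin A; apply: (@measure_unique _ R (measurableTypeR R) (@RGenCInfty.G R)
  (fun n => `[- n%:R, +oo[%classic) _ _ _ _ m1 m2).
- exact: RGenCInfty.measurableE.
- move=> _ _ [a ->] [b ->]; exists (Num.max a b).
  by apply/seteqP; split => x /=; rewrite !in_itv/= !andbT ge_max; [case=> -> ->|case/andP].
- by move=> n; exists (- n%:R).
- apply/seteqP; split => // x _; exists (Num.truncn `|x|).+1 => //=.
  by rewrite in_itv/= andbT lerNl (le_trans (ler_norm _))// normrN ltW// truncnS_gt.
- by move=> _ [a ->]; exact: m12.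
- by move=> n; exact: fin.
Qed.

(** The law restricted to [u, +oo[ and [exp (- al * u)] times its translate by [u] agree on closed
    rays, hence as measures. *)
Lemma exp_law_memoryless (u : R) (phi : R -> R) M : 0 <= u ->
  measurable_fun setT phi -> (forall t, `|phi t| <= M) ->
  \int[kappa]_(t in `[u, +oo[) phi t = expR (- al * u) * \int[kappa]_t phi (u + t).
Proof.
move=> u0 mphi bphi.
pose shift : measurableTypeR R -> measurableTypeR R := fun t => u + t.
have mshift : measurable_fun setT shift by exact: measurable_funD.
pose m1 := mrestr kappa (measurable_itv `[u, +oo[).
pose m2 := mscale (NngNum (expR_ge0 (- al * u))) (image_measure kappa mshift).
have m12 : forall A, measurable A -> m1 A = m2 A.
  apply: measure_unique_rays => a.
    transitivity (kappa `[Num.max u a, +oo[%classic).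
      rewrite /m1 /= /mrestr; congr (exponential_prob al _).
      apply/seteqP; split => x /=; rewrite !in_itv/= !andbT ge_max.
        by case=> -> ->.
      by case/andP.
    transitivity ((expR (- al * u))%:E * kappa `[(a - u)%R, +oo[%classic)%E; last first.
      rewrite /m2 /= /mscale; congr (_ * exponential_prob al _)%E.
      by apply/seteqP; split => x /=; rewrite !in_itv/= !andbT lerBlDl.
    rewrite !exp_law_ray -EFinM -expRD; congr (expR _)%:E.
    rewrite -mulrDr; congr (_ * _).
    rewrite /Num.max; do ! case: ifPn; rewrite -?leNgt; lra.
  by rewrite /m1 /mrestr/= (le_lt_trans (probability_le1 _ _))// ?ltry//; exact: measurableI.
have ib := bounded_integrable kappa measurableT.
have mphis : measurable_fun setT (phi \o shift) by exact: measurableT_comp.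
have is_ := ib _ M mphis (fun t => bphi _).
transitivity (\int[m1]_(t in `[u, +oo[) phi t).
  by congr fine; apply: eq_measure_integral => A mA AD; rewrite /m1 /= /mrestr setIidl.
transitivity (\int[m1]_t phi t).
  have mEphi : measurable_fun setT (EFin \o phi) by exact/measurable_EFinP.
  have m1fin : (m1 setT < +oo)%E.
    by rewrite /m1 /= /mrestr setTI (le_lt_trans (probability_le1 _ _))// ltry.
  have im1 : m1.-integrable setT (EFin \o phi).
    apply/integrableP; split => //.
    apply: (@le_lt_trans _ _ (\int[m1]_t (cst M%:E t))%E).
      apply: ge0_le_integral => //; first exact: measurableT_comp.
      by move=> t _; rewrite /= lee_fin.
    rewrite integral_cst// lte_mul_pinfty// lee_fin.
    exact: le_trans (normr_ge0 _) (bphi 0).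
  rewrite /Rintegral; congr fine; apply/esym.
  rewrite (@negligible_integral _ _ _ m1 setT (~` `[u, +oo[%classic))//.
  - by rewrite setTD setCK.
  - exact: measurableC.
  - by rewrite /m1 /= /mrestr setICl measure0.
transitivity (\int[m2]_t phi t).
  by congr fine; apply: eq_measure_integral => A mA _; exact: m12.
have [i2 E2] := Rintegral_image_measure mshift mphi is_.
by rewrite /m2 Rintegral_mscale// E2.
Qed.

(** The law is given by its density on sets; the Radon-Nikodym derivative carries this over to
    integrals of functions. *)
Lemma exp_law_density (phi : R -> R) M :
  measurable_fun setT phi -> (forall t, `|phi t| <= M) ->
  \int[kappa]_t phi t = al * \int[mu]_(t in `[0, +oo[) (expR (- (al * t)) * phi t).
Proof.
move=> mphi bphi.
have dom : kappa `<< mu.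
  apply/null_content_dominatesP => A mA muA0; rewrite exp_lawE.
  by rewrite null_set_integral//; apply/measurable_EFinP/measurable_funTS;
    exact: measurable_exponential_pdf.
have iphi := bounded_integrable kappa measurableT mphi bphi.
have E : (\int[kappa]_t (phi t)%:E = \int[mu]_t ((phi t)%:E * (exponential_pdf al t)%:E))%E.
  rewrite -(Radon_Nikodym_change_of_variables dom)//=.
  have mpdf : measurable_fun setT (fun t => (exponential_pdf al t)%:E).
    by apply/measurable_EFinP; exact: measurable_exponential_pdf.
  have mEphi : measurable_fun setT (EFin \o phi) by exact/measurable_EFinP.
  apply: ae_eq_integral => //.
  - have iRN : mu.-integrable setT (Radon_Nikodym (charge_of_finite_measure kappa) mu).
      by apply: Radon_Nikodym_integrable; exact: dom.
    exact: emeasurable_funM mEphi (measurable_int _ iRN).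
  - exact: emeasurable_funM.
  - apply: ae_eqe_mul2l; rewrite Radon_NikodymE/=.
    case: cid => h [h1 h2 h3] /=.
    apply: integral_ae_eq => // A _ mA; rewrite -h3//.
have -> : \int[kappa]_t phi t = \int[mu]_t (phi t * exponential_pdf al t).
  by rewrite /Rintegral E; congr fine; apply: eq_integral => t _; rewrite EFinM.
have ip : mu.-integrable setT (EFin \o (fun t => phi t * exponential_pdf al t)).
  apply: (@integrable_bounded_mul R _ (measurableTypeR R) mu setT phi (exponential_pdf al) M) => //.
  exact: integrable_exponential_pdf.
have -> : \int[mu]_(t in `[0, +oo[) (expR (- (al * t)) * phi t) =
  \int[mu]_(t in `[0, +oo[) (al^-1 * (phi t * exponential_pdf al t)).
  apply: eq_Rintegral => t; rewrite inE/= in_itv/= andbT => t0.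
  by rewrite exponential_pdfE// mulNr; field; rewrite gt_eqF.
rewrite RintegralZl//; last exact: integrableS ip.
rewrite mulrA divff ?gt_eqF// mul1r [RHS]Rintegral_mkcond.
apply: eq_Rintegral => t _; rewrite patchE; case: ifPn => // t0.
rewrite lt0_exponential_pdf ?mulr0// ltNge; apply: contra t0 => t0.
by rewrite inE/= in_itv/= t0.
Qed.

End exponential_law.

(** * Hitting times *)

Section paths.
Variables (R : realType) (W : weighted_graph R).
Variables (d : measure_display) (Omega : measurableType d).
Variables (P : state W -> probability Omega R) (Y : R -> Omega -> state W).
Hypothesis D : diffusion P Y.
Implicit Types (phi theta : metric_graph W -> R) (w : Omega) (s t : R).

Lemma alive_before w s t : 0 <= s <= t -> Y t w <> None -> Y s w <> None.
Proof. by move=> st Yt Ys; apply: Yt; exact: (diffusion_cemetery D st Ys). Qed.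

(** [phi] need not tend to 0 at infinity, so [extend0 phi] can jump at the cemetery; hence the
    restriction to times when the path is alive. *)
Lemma path_cvg phi w t : continuous phi -> 0 <= t -> Y t w <> None ->
  extend0 phi (Y s w) @[s --> within `[0, +oo[%classic (nbhs t)] -->
  extend0 phi (Y t w).
Proof.
move=> cphi t0 Yt; have Yc := diffusion_continuous D t0 Yt.
have H : extend0 phi z @[z --> Y t w] --> extend0 phi (Y t w).
  move: Yt {Yc}; case: (Y t w) => // y _ A /= nA.
  rewrite /nbhs/= /one_point_nbhs /=; exact: cphi nA.
exact: (@cvg_comp _ _ _ (fun s => Y s w) (extend0 phi) _ _ _ Yc H).
Qed.

Lemma alive_near w t : 0 <= t -> Y t w <> None ->
  \forall s \near within `[0, +oo[%classic (nbhs t), Y s w <> None.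
Proof.
move=> t0 Yt.
(* [extend0] of the constant 1 is the indicator of being alive. *)
have c1 : continuous (cst 1 : metric_graph W -> R) by exact: cst_continuous.
have /cvgrPdist_lt/(_ _ (@ltr01 R)) := path_cvg c1 t0 Yt.
apply: filterS => s; move: Yt; case: (Y t w) => // y _ /=.
by case: (Y s w) => //=; rewrite subr0 normr1 ltxx.
Qed.

Lemma path_within_continuous phi w a b : continuous phi -> 0 <= a ->
  Y b w <> None -> {within `[a, b], continuous (fun s => extend0 phi (Y s w))}.
Proof.
move=> cphi a0 Yb; apply/subspace_continuousP => t /=; rewrite in_itv/= => /andP[at_ tb].
have t0 : 0 <= t := le_trans a0 at_.
have Yt : Y t w <> None by apply: (alive_before _ Yb); rewrite t0.
have := path_cvg cphi t0 Yt; apply: cvg_trans; apply: cvg_app.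
apply: within_subset => s /=; rewrite !in_itv/= andbT => /andP[+ _].
exact: le_trans.
Qed.

Section hitting.
Variable theta : metric_graph W -> R.
Hypothesis ctheta : continuous theta.
(** As a zero set, the target is reached when a real-valued path vanishes, which opens the way to
    the intermediate and extreme value theorems. *)
Let F := [set y | theta y = 0].
Let hit w t := 0 <= t /\ (Some @` F) (Y t w).
Let T := hitting_time Y F.

Lemma hit_extend0 w t : hit w t -> Y t w <> None /\ extend0 theta (Y t w) = 0.
Proof. by move=> [_ [y Fy <-]]. Qed.

Lemma extend0_hit w t : 0 <= t -> Y t w <> None -> extend0 theta (Y t w) = 0 -> hit w t.
Proof. by move=> t0; case Yt : (Y t w) => [y|]// _ /= Fy; split => //; exists y. Qed.

Lemma hitting_time_le w t : hit w t -> (T w <= t%:E)%E.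
Proof. by move=> ht; apply: ereal_inf_lbound; exists t. Qed.

Lemma hitting_time_ge0 w : (0 <= T w)%E.
Proof. by apply: le_ereal_inf_tmp => _ [t [t0 _] <-]; rewrite lee_fin. Qed.

(** There are hits at or shortly after the infimum. As the cemetery is absorbing, the path is alive
    at the infimum, and by continuity [theta] vanishes there. *)
Lemma hitting_time_attained w : (T w < +oo)%E -> hit w (fine (T w)).
Proof.
move=> Toy; have T0 := hitting_time_ge0 w.
have Tfin : T w \is a fin_num by rewrite ge0_fin_numE.
set tau := fine (T w); have tauE : T w = tau%:E by rewrite fineK.
have tau0 : 0 <= tau by rewrite fine_ge0.
have hits e : 0 < e -> exists2 t, hit w t & tau <= t < tau + e.
  move=> e0.
  have [_ [t ht <-] tlt] := lb_ereal_inf_adherent e0 Tfin.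
  exists t => //; rewrite -lee_fin -tauE hitting_time_le//=.
  by rewrite -lte_fin EFinD -tauE.
have Ytau : Y tau w <> None.
  move=> YN; have [t ht /andP[tt _]] := hits 1 ltr01.
  by have [+ _] := hit_extend0 ht; apply; apply: (diffusion_cemetery D _ YN); rewrite tau0.
apply: extend0_hit => //; apply/eqP/negPn/negP => th0.
have e0 : 0 < `|extend0 theta (Y tau w)| by rewrite normr_gt0.
have /cvgrPdist_lt/(_ _ e0) := path_cvg ctheta tau0 Ytau.
rewrite near_withinE => /nbhs_ballP[r /= r0 Hr].
have [t ht /andP[tt tr]] := hits r r0.
have [_ h0] := hit_extend0 ht.
have : `|extend0 theta (Y tau w) - extend0 theta (Y t w)| < `|extend0 theta (Y tau w)|.
  apply: Hr; last by rewrite /= in_itv/= andbT; case: ht.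
  by rewrite /ball/= distrC ger0_norm ?subr_ge0//; lra.
by rewrite h0 subr0 ltxx.
Qed.

Lemma hitting_time_leP w t : (T w <= t%:E)%E <-> exists2 r, hit w r & r <= t.
Proof.
split=> [Tt|[r hr rt]]; last first.
  by apply: le_trans (hitting_time_le hr) _; rewrite lee_fin.
have Toy : (T w < +oo)%E by rewrite (le_lt_trans Tt)// ltry.
exists (fine (T w)); first exact: hitting_time_attained.
by rewrite -lee_fin fineK// ge0_fin_numE// hitting_time_ge0.
Qed.

(** By the intermediate value theorem, a change of sign of [theta] would be a hit before [T]. *)
Lemma path_sign w t y0 y : Y 0 w = Some y0 -> 0 < theta y0 ->
  0 <= t -> (t%:E < T w)%E -> Y t w = Some y -> 0 < theta y.
Proof.
move=> Y0 th0 t0 tT Yt; rewrite ltNge; apply/negP => thy.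
have YtN : Y t w <> None by rewrite Yt.
have := @IVT R (fun s => extend0 theta (Y s w)) 0 t 0 t0
  (path_within_continuous ctheta (lexx 0) YtN).
rewrite Y0 Yt /= ge_min le_max thy orbT (ltW th0)/= => /(_ isT)[c].
rewrite in_itv/= => /andP[c0 ct] thc.
have Yc : Y c w <> None by apply: (alive_before _ YtN); rewrite c0.
have := hitting_time_le (extend0_hit c0 Yc thc).
by rewrite leNgt (le_lt_trans _ tT)// lee_fin.
Qed.

(** A hit by time [t] is read off at the countably many times [t * q] with [q] rational in [0, 1],
    none of which exceeds [t]. The path may die between the hit and [t], so a rational [m] first
    marks a time, not before the hit, at which it is still alive; on [0, t * m] the path is
    continuous. *)
Lemma hitting_event_formula t : 0 <= t ->
  [set w | (T w <= t%:E)%E] =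
  \bigcup_(m : rat) (if (0 <= m <= 1) then
     [set w | Y (t * ratr m) w <> None] `&`
     \bigcap_(n : nat) \bigcup_(q : rat) (if (0 <= q <= m) then
        [set w | Y (t * ratr q) w <> None /\ `|extend0 theta (Y (t * ratr q) w)| < n.+1%:R^-1]
        else set0)
   else set0).
Proof.
move=> t0; apply/seteqP; split => w /=.
  move=> /hitting_time_leP[r hr rt].
  have [Yr thr] := hit_extend0 hr.
  have [r0 _] := hr.
  (* A hit at [t] exactly cannot be approached from the right within [0, t]; the scaling by [t]
     makes [t] itself a sampled time, with [q = 1]. *)
  have [rE|rt'] := eqVneq r t.
    exists 1 => //; rewrite ler01 lexx/= rmorph1 mulr1 -rE; split => // n _.
    by exists 1 => //; rewrite ler01 lexx/= rmorph1 mulr1 thr normr0; split.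
  have {rt'} rt' : r < t by rewrite lt_neqAle rt'.
  have t0' : 0 < t := le_lt_trans r0 rt'.
  have dens b : r < b -> exists2 q : rat, 0 <= q & r < t * ratr q < b.
    move=> rb; have : r / t < b / t by rewrite ltr_pM2r// invr_gt0.
    move=> /rat_in_itvoo[q]; rewrite in_itv/= ltr_pdivrMr// ltr_pdivlMr// => rqb.
    exists q; last by rewrite mulrC.
    rewrite -(ler0q R) -(pmulr_lge0 _ t0').
    by case/andP : rqb => /ltW/(le_trans r0).
  have /nbhs_ballP[e /= e0 He] : \forall s \near r, 0 <= s -> Y s w <> None.
    have := alive_near r0 Yr; rewrite near_withinE; apply: filterS => s + s0.
    by apply; rewrite /= in_itv/= andbT.
  have [m m0 /andP[rm mb]] : exists2 q : rat, 0 <= q & r < t * ratr q < Num.min t (r + e).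
    by apply: dens; rewrite lt_min rt'/= ltrDl.
  move: mb; rewrite lt_min => /andP[mt me].
  have m1 : m <= 1.
    rewrite -(ler_rat R) rmorph1 -(ler_pM2l t0') mulr1; exact: ltW.
  have tm0 : 0 <= t * ratr m by rewrite (le_trans r0)// ltW.
  exists m => //; rewrite m0 m1/=; split.
    by apply: He => //; rewrite /ball/= distrC ger0_norm; lra.
  move=> n _.
  have n0 : (0 : R) < n.+1%:R^-1 by rewrite invr_gt0.
  have /nbhs_ballP[e' /= e'0 He'] : \forall s \near r, 0 <= s -> `|extend0 theta (Y s w)| <
    n.+1%:R^-1.
    have /cvgrPdist_lt/(_ _ n0) := path_cvg ctheta r0 Yr; rewrite near_withinE.
    apply: filterS => s + s0; rewrite thr sub0r normrN.
    by apply; rewrite /= in_itv/= andbT.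
  have [q q0 /andP[rq qb]] : exists2 q : rat, 0 <= q & r < t * ratr q < Num.min (t * ratr m)
    (r + e').
    by apply: dens; rewrite lt_min rm/= ltrDl.
  move: qb; rewrite lt_min => /andP[qm qe'].
  have tq0 : 0 <= t * ratr q by rewrite (le_trans r0)// ltW.
  exists q => //; have qm' : q <= m by rewrite -(ler_rat R) -(ler_pM2l t0') ltW.
  rewrite q0 qm'/=; split.
    by apply: He => //; rewrite /ball/= distrC ger0_norm; lra.
  by apply: He' => //; rewrite /ball/= distrC ger0_norm; lra.
move=> [m _]; case: ifPn => // /andP[m0 m1] [Ym H].
have tm0 : 0 <= t * ratr m by rewrite mulr_ge0// ler0q.
have mt : t * ratr m <= t by rewrite ler_piMr// -(rmorph1 (ratr : {rmorphism rat -> R})) ler_rat.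
apply/hitting_time_leP.
have cth := path_within_continuous ctheta (lexx 0) Ym.
have cabs : {within `[0, t * ratr m], continuous (fun s => `|extend0 theta (Y s w)|)}.
  by move=> s; apply: (continuous_comp (cth s)); exact: norm_continuous.
(* The minimum of |theta| on a compact interval is attained; arbitrarily small sampled values force
   it to be 0. *)
have [c] := EVT_min tm0 cabs; rewrite in_itv/= => /andP[c0 cm] Hc.
have Yc : Y c w <> None by apply: (alive_before _ Ym); rewrite c0.
exists c; last exact: le_trans mt.
apply: extend0_hit => //; apply/eqP; rewrite -normr_eq0; apply/negPn/negP => thc.
have thc0 : 0 < `|extend0 theta (Y c w)| by rewrite lt_neqAle eq_sym thc normr_ge0.
have [n Hn] : exists n, n.+1%:R^-1 < `|extend0 theta (Y c w)|.
  exists (Num.truncn (`|extend0 theta (Y c w)|^-1)).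
  rewrite invf_plt ?posrE//; exact: truncnS_gt.
have [q _] := H n I; case: ifPn => // /andP[q0 qm] [_ thq].
have : `|extend0 theta (Y c w)| <= `|extend0 theta (Y (t * ratr q) w)|.
  by apply: Hc; rewrite in_itv/= mulr_ge0 ?ler0q//= ler_wpM2l// ler_rat.
by move=> /le_lt_trans/(_ thq)/lt_trans/(_ Hn); rewrite ltxx.
Qed.

End hitting.
End paths.

(** * Functions that are measurable along the paths *)

Section observables.
Variables (R : realType) (W : weighted_graph R).
Implicit Types (phi psi : metric_graph W -> R).

(* Joint measurability of (t, w) |-> psi (Y t w) is proved by approximating t from
   the right, for continuous psi; observable functions inherit it. *)
Definition observable psi : Prop :=
  forall (d : measure_display) (T : measurableType d) (Z : T -> state W),
    (forall phi, continuous phi -> measurable_fun setT (extend0 phi \o Z)) ->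
    measurable_fun setT (extend0 psi \o Z).

Lemma observable_continuous phi : continuous phi -> observable phi.
Proof. by move=> cphi d T Z; apply. Qed.

(** The condition [k 0 0 = 0] matches the value 0 of [extend0] at the cemetery. *)
Lemma observable_binary (k : R -> R -> R) phi psi : k 0 0 = 0 ->
  measurable_fun setT (fun p : R * R => k p.1 p.2) ->
  observable phi -> observable psi -> observable (fun y => k (phi y) (psi y)).
Proof.
move=> k0 mk ophi opsi d T Z HZ.
have -> : extend0 (fun y => k (phi y) (psi y)) \o Z =
    (fun p => k p.1 p.2) \o (fun x => (extend0 phi (Z x), extend0 psi (Z x))).
  by apply/funext => x /=; case: (Z x) => //=; rewrite k0.
apply: measurableT_comp => //; apply/measurable_fun_pairP; split.
  exact: ophi.
exact: opsi.
Qed.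

Lemma observableD phi psi : observable phi -> observable psi ->
  observable (fun y => phi y + psi y).
Proof.
apply: (observable_binary (k := fun a b => a + b)); first by rewrite addr0.
by apply: measurable_funD; [exact: measurable_fst|exact: measurable_snd].
Qed.

Lemma observableZ (a : R) phi : observable phi -> observable (fun y => a * phi y).
Proof.
move=> ophi; apply: (observable_binary (k := fun b _ => a * b) _ _ ophi ophi).
  by rewrite mulr0.
by apply: measurable_funM => //; exact: measurable_fst.
Qed.

Lemma observable_pos phi : observable phi ->
  observable (fun y => if 0 < phi y then 1 else 0).
Proof.
move=> ophi; apply: (observable_binary (k := fun b _ => if 0 < b then 1 else 0) _ _ ophi ophi).
  by rewrite ltxx.
apply: measurable_fun_ifT => //; apply: measurable_fun_ltr => //; exact: measurable_fst.
Qed.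

Lemma observable_sum (I : Type) (s : seq I) (f : I -> metric_graph W -> R) :
  (forall i, observable (f i)) -> observable (fun y => \sum_(i <- s) f i y).
Proof.
move=> of_; elim: s => [|i s IH].
  apply: observable_continuous; rewrite (_ : (fun y => _) = cst 0).
    exact: cst_continuous.
  by apply/funext => y; rewrite big_nil.
rewrite (_ : (fun y => _) = (fun y => f i y + \sum_(j <- s) f j y)).
  exact: observableD.
by apply/funext => y; rewrite big_cons.
Qed.

Lemma observable_measurable psi : observable psi -> measurable_fun setT psi.
Proof.
move=> opsi; rewrite (_ : psi = extend0 psi \o Some)//; apply: opsi => phi cphi.
exact: continuous_measurable_graph.
Qed.

Lemma measurable_state_open (U : set (state W)) : open U -> measurable U.
Proof. by move=> oU; exact: sub_sigma_algebra. Qed.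

Lemma open_some (U : set (metric_graph W)) : open U -> open (Some @` U : set (state W)).
Proof. exact: one_point_compactification_open_some. Qed.

Lemma measurable_extend0 psi : observable psi ->
  measurable_fun setT (extend0 psi : state W -> R).
Proof.
move=> opsi; suff : measurable_fun setT (extend0 psi \o (id : state W -> state W)) by [].
apply: opsi => phi cphi; apply: (measurability _ (RGenOpens.measurableE R)) => //.
move=> _ [_ [a [b ->] <-]]; rewrite setTI.
have mU : measurable (Some @` (phi @^-1` `]a, b[) : set (state W)).
  apply: measurable_state_open; apply: open_some.
  by move/continuousP : cphi; apply; exact: interval_open.
have mN : measurable ([set None] : set (state W)).
  rewrite (_ : [set None] = ~` (Some @` setT)); last first.
    by apply/seteqP; split => [_ -> [y]//|[y H|//]]; case: H; exists y.
  by apply: measurableC; apply: measurable_state_open; apply: open_some; exact: openT.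
have [ab|ab] := pselect (`]a, b[%classic (0 : R)).
  rewrite (_ : _ @^-1` _ = (Some @` (phi @^-1` `]a, b[)) `|` [set None]).
    exact: measurableU.
  apply/seteqP; split => -[y|]//=; first by move=> H; left; exists y.
  - by move=> _; right.
  - by case=> [[z zab [<-]]|].
rewrite (_ : _ @^-1` _ = Some @` (phi @^-1` `]a, b[)) //.
apply/seteqP; split => -[y|]//=; first by move=> H; exists y.
- by case=> z zab [<-].
- by case.
Qed.

End observables.

Section measurable_paths.
Variables (R : realType) (W : weighted_graph R).
Variables (d : measure_display) (Omega : measurableType d).
Variables (P : state W -> probability Omega R) (Y : R -> Omega -> state W).
Hypothesis D : diffusion P Y.
Implicit Types (phi psi : metric_graph W -> R).

Lemma measurable_path psi t : 0 <= t -> observable psi ->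
  measurable_fun setT (fun w => extend0 psi (Y t w)).
Proof.
move=> t0 opsi; apply: opsi => phi cphi.
apply: measurableT_comp; last exact: (diffusion_measurable D t0).
by apply: measurable_extend0; exact: observable_continuous.
Qed.

Lemma joint_measurable psi : observable psi ->
  measurable_fun setT
    (fun p : measurableTypeR R * Omega => extend0 psi (Y (Num.max 0 p.1) p.2)).
Proof.
move=> opsi; apply: opsi => phi cphi.
(* Times are rounded strictly upwards. From the left, the values could fail to converge at the time
   of death; from the right they do, since a dead path stays dead. *)
pose grid (n k : nat) : R := k.+1%:R / n.+1%:R.
pose idx (n : nat) (t : R) := Num.truncn (n.+1%:R * Num.max 0 t).
pose g n (p : measurableTypeR R * Omega) := extend0 phi (Y (grid n (idx n p.1)) p.2).
have max0 (t : R) : 0 <= Num.max 0 t by rewrite le_max lexx.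
apply: (measurable_fun_cvg (h := g)).
  move=> n _ B mB; rewrite setTI.
  have -> : g n @^-1` B = \bigcup_k
     (((fun t : measurableTypeR R => n.+1%:R * Num.max 0 t) @^-1` `[k%:R, k.+1%:R[) `*`
     ((fun w => extend0 phi (Y (grid n k) w)) @^-1` B)).
    apply/seteqP; split => -[t w] /=; rewrite /g/=.
      move=> H; exists (idx n t) => //=; split => //=.
      by rewrite in_itv/= truncn_itv// mulr_ge0.
    move=> [k _ [/=]]; rewrite in_itv/= => /truncn_def E H.
    by rewrite /idx E.
  apply: bigcupT_measurable => k; apply: measurableX.
    rewrite -[X in measurable X]setTI.
    apply: (@measurable_funM _ _ _ setT (cst n.+1%:R) (fun t : R => Num.max 0 t)) => //.
    exact: measurable_maxr.
  rewrite -[X in measurable X]setTI; by apply: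
    (measurable_path _ (observable_continuous cphi)) => //; rewrite /grid divr_ge0.
move=> [t w] _ /=; rewrite /g/=; set t0 := Num.max 0 t.
have t00 : 0 <= t0 := max0 t.
have gridP n : t0 < grid n (idx n t) /\ grid n (idx n t) <= t0 + n.+1%:R^-1.
  have /andP[H1 H2] : (idx n t)%:R <= n.+1%:R * t0 < (idx n t).+1%:R.
    by apply: truncn_itv; rewrite mulr_ge0.
  split; first by rewrite /grid ltr_pdivlMr// mulrC.
  rewrite /grid ler_pdivrMr// mulrDl mulVf// -natr1 lerD2r//.
  by rewrite mulrC.
have [Yt|Yt] := pselect (Y t0 w = None).
  apply: cvg_near_cst; near=> n; rewrite Yt.
  have [/ltW ? _] := gridP n.
  by rewrite (diffusion_cemetery D _ Yt)// t00.
have := path_cvg D cphi t00 Yt.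
apply: (@cvg_comp _ _ _ (fun n => grid n (idx n t)) (fun s => extend0 phi (Y s w))).
move=> A /nbhs_ballP[r /= r0 HA].
have [N _ HN] := near_infty_natSinv_lt (PosNum r0).
exists N => // n /= /HN /= nr; have [H1 H2] := gridP n.
apply: HA; last by rewrite /= in_itv/= andbT (le_trans t00)// ltW.
rewrite /ball/= distrC ger0_norm ?subr_ge0 ?(ltW H1)//.
by rewrite ltrBlDl; apply: le_lt_trans H2 _; rewrite ltrD2l.
Unshelve. all: by end_near. Qed.

End measurable_paths.

(** * The hitting time is a stopping time *)

Section stopping.
Variables (R : realType) (W : weighted_graph R).
Variables (d : measure_display) (Omega : measurableType d).
Variables (P : state W -> probability Omega R) (Y : R -> Omega -> state W).
Hypothesis D : diffusion P Y.

Let gen (t : R) : set (set Omega) := [set A | exists s, 0 <= s <= t /\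
         exists2 B, measurable B & A = Y s @^-1` B].

Lemma past_generator t s B : 0 <= s <= t -> measurable B -> past Y t (Y s @^-1` B).
Proof.
by move=> st mB; apply: sub_sigma_algebra; exists s; split => //; exists B.
Qed.

Lemma past_mono s t : s <= t -> past Y s `<=` past Y t.
Proof.
move=> st; apply: smallest_sub; first exact: smallest_sigma_algebra.
move=> _ [r [/andP[r0 rs] [B mB ->]]]; apply: past_generator => //.
by rewrite r0 (le_trans rs).
Qed.

Lemma past_measurable t : past Y t `<=` measurable.
Proof.
apply: smallest_sub; first exact: sigma_algebra_measurable.
move=> _ [s [/andP[s0 _] [B mB ->]]].
by rewrite -[X in measurable X]setTI; apply: (diffusion_measurable D s0).
Qed.

Variable theta : metric_graph W -> R.
Hypothesis ctheta : continuous theta.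
Let F := [set y | theta y = 0].
Let T := hitting_time Y F.

Lemma hitting_past t : 0 <= t -> past Y t [set w | (T w <= t%:E)%E].
Proof.
move=> t0; rewrite (hitting_event_formula D ctheta t0).
pose G := g_sigma_algebraType (gen t).
suff : @measurable _ G (\bigcup_(m : rat) (if (0 <= m <= 1) then
     [set w | Y (t * ratr m) w <> None] `&`
     \bigcap_(n : nat) \bigcup_(q : rat) (if (0 <= q <= m) then
        [set w | Y (t * ratr q) w <> None /\ `|extend0 theta (Y (t * ratr q) w)| < n.+1%:R^-1]
        else set0)
   else set0)) by [].
have mY (m : rat) B : 0 <= m <= 1 -> measurable B -> @measurable _ G (Y (t * ratr m) @^-1` B).
  move=> /andP[m0 m1] mB; apply: past_generator => //.
  by rewrite mulr_ge0 ?ler0q//= ler_piMr// -(rmorph1 (ratr : {rmorphism rat -> R})) ler_rat.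
apply: bigcupT_measurable_rat => m; case: ifPn => // m01.
apply: measurableI.
  rewrite (_ : [set w | _] = Y (t * ratr m) @^-1` (Some @` (setT : set (metric_graph W)))).
    by apply: (mY m) => //; apply: measurable_state_open; apply: open_some; exact: openT.
  apply/seteqP; split => w /=; case: (Y _ w) => [y|] //=.
  - by move=> _; exists y.
  - by case.
apply: bigcapT_measurable => n; apply: bigcupT_measurable_rat => q.
case: ifPn => // /andP[q0 qm].
rewrite (_ : [set w | _] = Y (t * ratr q) @^-1` (Some @` [set y | `|theta y| < n.+1%:R^-1])).
  apply: mY; first by case/andP : m01 => _ m1; rewrite q0 (le_trans qm).
  apply: measurable_state_open; apply: open_some.
  have -> : [set y | `|theta y| < n.+1%:R^-1] = theta @^-1` `](- n.+1%:R^-1), n.+1%:R^-1[.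
    by apply/seteqP; split => y /=; rewrite in_itv/= ltr_norml.
  by move/continuousP : ctheta; apply; exact: interval_open.
apply/seteqP; split => w /=; case: (Y _ w) => //=.
- by move=> y [_ H]; exists y.
- by case.
- by move=> y [z H [<-]].
- by case.
Qed.

Lemma hitting_stopping_time : stopping_time Y T.
Proof.
split; first by move=> w; exact: hitting_time_ge0.
by move=> t t0 s ts; apply: (past_mono (ltW ts)); exact: hitting_past.
Qed.

Lemma hitting_stopped_past r : stopped_past Y T [set w | (T w <= r%:E)%E].
Proof.
move=> t t0 s ts.
have [r0|r0] := leP 0 r.
  have -> : [set w | (T w <= r%:E)%E] `&` [set w | (T w <= t%:E)%E] =
     [set w | (T w <= (Num.min r t)%:E)%E].
    by apply/seteqP; split => w /=; rewrite EFin_min le_min => /andP.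
  apply: (@past_mono (Num.min r t)); first by rewrite ge_min (ltW ts) orbT.
  by apply: hitting_past; rewrite le_min r0.
have -> : [set w | (T w <= r%:E)%E] `&` [set w | (T w <= t%:E)%E] = set0.
  apply/seteqP; split => w //= -[Tr _].
  by have := le_trans (hitting_time_ge0 Y theta w) Tr; rewrite lee_fin leNgt r0.
exact: (@measurable0 _ (g_sigma_algebraType (gen s))).
Qed.

Lemma measurable_hitting_le r : measurable [set w | (T w <= r%:E)%E].
Proof.
have [r0|r0] := leP 0 r; first exact: (past_measurable (hitting_past r0)).
have -> : [set w | (T w <= r%:E)%E] = set0; last exact: measurable0.
apply/seteqP; split => w //= Tr.
by have := le_trans (hitting_time_ge0 Y theta w) Tr; rewrite lee_fin leNgt r0.
Qed.

Lemma measurable_hitting_time : measurable_fun setT T.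
Proof.
apply: (measurability _ (ErealGenOInfty.measurableE R)) => //.
move=> _ [_ [r ->] <-]; rewrite setTI.
rewrite (_ : _ @^-1` _ = ~` [set w | (T w <= r%:E)%E]).
  by apply: measurableC; exact: measurable_hitting_le.
by apply/seteqP; split => w /=; rewrite in_itv/= andbT ltNge => /negP.
Qed.

End stopping.

(** * Dynkin's formula *)

Section strong_markov_functions.
Variables (R : realType) (W : weighted_graph R).
Variables (d : measure_display) (Omega : measurableType d).
Variables (P : state W -> probability Omega R) (Y : R -> Omega -> state W).
Hypothesis D : diffusion P Y.
Variable theta : metric_graph W -> R.
Hypothesis ctheta : continuous theta.
Let F := [set y | theta y = 0].
Let T := hitting_time Y F.
Variable ys : seq (metric_graph W).
Hypothesis ys_uniq : uniq ys.
Hypothesis ysP : forall y, theta y = 0 -> y \in ys.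
Hypothesis obs_ys : forall y, y \in ys ->
  observable (fun z => if z == y then 1 else 0 : R).
Implicit Types (f psi : metric_graph W -> R).

(** Where [T] is infinite, [fine] puts the default 0 in its place; such paths are later excluded by
    an event [T <= r]. *)
Definition time_after (p : measurableTypeR R * Omega) : measurableTypeR R * Omega :=
  (fine (T p.2) + Num.max 0 p.1, p.2).

Lemma measurable_time_after : measurable_fun setT time_after.
Proof.
apply/measurable_fun_pairP; split; last exact: measurable_snd.
apply: measurable_funD.
  apply: (@measurableT_comp _ _ _ _ _ _ (@fine R)) => //.
  by apply: measurableT_comp; [exact: (measurable_hitting_time D ctheta)|exact: measurable_snd].
by apply: measurable_maxr => //; exact: measurable_fst.
Qed.

Let T0 w : 0 <= fine (T w).
Proof. by rewrite fine_ge0// hitting_time_ge0. Qed.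

Lemma max_time_after s w : Num.max 0 (fine (T w) + Num.max 0 s) = fine (T w) + Num.max 0 s.
Proof. by rewrite max_r// addr_ge0// le_max lexx. Qed.

Lemma joint_measurable_after psi : observable psi -> measurable_fun setT
  (fun p : measurableTypeR R * Omega => extend0 psi (Y (fine (T p.2) + Num.max 0 p.1) p.2)).
Proof.
move=> opsi; have := measurableT_comp (joint_measurable D opsi) measurable_time_after.
by apply: eq_measurable_fun => -[s w] _ /=; rewrite max_time_after.
Qed.

Lemma measurable_after psi s : observable psi -> 0 <= s ->
  measurable_fun setT (fun w => extend0 psi (Y (fine (T w) + s) w)).
Proof.
move=> opsi s0.
have := measurableT_comp (joint_measurable_after opsi) (pair1_measurable s).
by apply: eq_measurable_fun => w _ /=; rewrite max_r.
Qed.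

(** An event known at time [T], to which the strong Markov property applies; in Dynkin's formula [r]
    is drawn from an exponential law. *)
Let A r := [set w | (T w <= r%:E)%E].
Let C y := if y \in ys then [set w | Y (fine (T w)) w = Some y] else set0.

Let mA r : measurable (A r).
Proof. exact: (measurable_hitting_le D ctheta). Qed.

Lemma measurable_hitting_at y : measurable (C y).
Proof.
rewrite /C; case: ifPn => yys; last exact: measurable0.
have := measurable_after (obs_ys yys) (lexx 0).
move=> /(_ measurableT [set 1]) ; rewrite setTI => /(_ (measurable_set1 _)).
congr measurable; apply/seteqP; split => w; rewrite /= addr0.
  case: (Y _ w) => [z|]/=; last by move/eqP; rewrite eq_sym oner_eq0.
  by case: eqP => [->//|_ /eqP]; rewrite eq_sym oner_eq0.
by move=> ->/=; rewrite eqxx.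
Qed.

Let mC := measurable_hitting_at.

Lemma hitting_indic (k : metric_graph W -> \bar R) r w : A r w ->
  exists2 y, y \in ys & Y (fine (T w)) w = Some y /\
    (\sum_(z <- ys) k z * (\1_(C z) w)%:E = k y)%E.
Proof.
move=> Aw; have Toy : (T w < +oo)%E by rewrite (le_lt_trans Aw)// ltry.
have [_ [y /ysP yys Yy]] := hitting_time_attained D ctheta Toy.
exists y => //; split => //.
rewrite (bigD1_seq y)//= big1 ?adde0; last first.
  move=> z zy; rewrite indicE memNset ?mule0// /C; case: ifPn => [_ /=|_ []].
  by rewrite -Yy => -[yz]; rewrite yz eqxx in zy.
by rewrite /C yys indicE mem_set ?mule1.
Qed.

(** On [A r] the position at [T] is one of the finitely many points of [ys], so the integral of the
    kernel becomes a sum. *)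
Lemma strong_markov_event z r s (B : set (state W)) : 0 <= s -> measurable B ->
  (P z (A r `&` [set w | B (Y (fine (T w) + s) w)]) =
   \sum_(y <- ys) P z (A r `&` C y) * P (Some y) (Y s @^-1` B))%E.
Proof.
move=> s0 mB.
have := diffusion_strong_markov D z (hitting_stopping_time D ctheta) (mA r)
  (hitting_stopped_past D ctheta r) s0 mB.
have E : A r `&` [set w | (T w < +oo)%E] = A r.
  by apply/seteqP; split => w //= => [[]//|Tr]; split => //; rewrite (le_lt_trans Tr)// ltry.
rewrite /= -/F -/T -/(A r) E => ->.
transitivity (\int[P z]_(w in A r) \sum_(y <- ys) P (Some y) (Y s @^-1` B) * (\1_(C y) w)%:E)%E.
  apply: eq_integral => w; rewrite inE => Aw.
  have [y yys [Yy ->]] := hitting_indic (fun y => P (Some y) (Y s @^-1` B)) Aw.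
  by rewrite Yy.
rewrite ge0_integral_sum//.
- apply: eq_bigr => y _.
  rewrite ge0_integralZl//.
  + by rewrite integral_indic// setIC muleC.
  + exact/measurable_EFinP/measurable_indic.
- move=> y; apply: emeasurable_funM => //; exact/measurable_EFinP/measurable_indic.
- by move=> y w _; rewrite mule_ge0// lee_fin.
Qed.

(** Passage from events to functions on the side of the values: the law of [f] at time [s] after
    [T], on [A r], and a mixture of the laws of [f] at time [s] from the points of [ys] are measures
    on the line that agree by [strong_markov_event]. *)
Lemma strong_markov_ge0 z r s f M : 0 <= s -> observable f ->
  (forall y, 0 <= f y <= M) ->
  (\int[P z]_(w in A r) (extend0 f (Y (fine (T w) + s) w))%:E =
   \sum_(y <- ys) P z (A r `&` C y) * \int[P (Some y)]_w (extend0 f (Y s w))%:E)%E.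
Proof.
move=> s0 of_ f0.
have mT := measurable_after of_ s0; have ms := measurable_path D s0 of_.
have ext0 y : 0 <= extend0 f y by case: y => //= y; case/andP: (f0 y).
pose m1 := image_measure (mrestr (P z) (mA r)) mT.
pose y_ i := nth point ys i.
pose a_ i : {nonneg R} := NngNum (fine_ge0 (measure_ge0 (P z) (A r `&` C (y_ i)))).
pose m2 := msum (fun i => mscale (a_ i) (image_measure (P (Some (y_ i))) ms)) (size ys).
have m12 B : measurable B -> m1 B = m2 B.
  move=> mB; have mB' : measurable ((extend0 f : state W -> R) @^-1` B).
    by rewrite -[X in measurable X]setTI; exact: (measurable_extend0 of_).
  have := strong_markov_event z r s0 mB'.
  rewrite /m1 /m2 /msum /= /mrestr /image_measure /= /pushforward /mscale.
  rewrite setIC => ->; rewrite (big_nth point) big_mkord; apply: eq_bigr => i _.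
  by rewrite /= fineK// fin_num_measure//; exact: measurableI.
(* The positive part is the identity on the values of [f], and nonnegative on the whole line as the
   integration lemmas require. *)
pose k (v : R) : \bar R := (Num.max 0 v)%:E.
have k0 v : (0 <= k v)%E by rewrite lee_fin le_max lexx.
have mk : measurable_fun setT k by apply/measurable_EFinP; exact: measurable_maxr.
have kE y : k (extend0 f y) = (extend0 f y)%:E by rewrite /k max_r.
transitivity (\int[m1]_v k v)%E.
  rewrite ge0_integral_pushforward// preimage_setT ge0_integral_mrestr//.
  - by apply: eq_integral => w _ /=; rewrite kE.
  - exact: measurableT_comp.
  - by move=> w; exact: k0.
transitivity (\int[m2]_v k v)%E.
  by apply: eq_measure_integral => B mB _; exact: m12.
rewrite ge0_integral_measure_sum//.
rewrite (big_nth point) big_mkord; apply: eq_bigr => i _.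
rewrite ge0_integral_mscale// ge0_integral_pushforward// preimage_setT /=.
rewrite fineK ?fin_num_measure//; last exact: measurableI.
by congr (_ * _)%E; apply: eq_integral => w _ /=; rewrite kE.
Qed.

End strong_markov_functions.

Section dynkin_formula.
Variables (R : realType) (W : weighted_graph R).
Variables (d : measure_display) (Omega : measurableType d).
Variables (P : state W -> probability Omega R) (Y : R -> Omega -> state W).
Hypothesis D : diffusion P Y.
Variable theta : metric_graph W -> R.
Hypothesis ctheta : continuous theta.
Let F := [set y | theta y = 0].
Let T := hitting_time Y F.
Variable ys : seq (metric_graph W).
Hypothesis ys_uniq : uniq ys.
Hypothesis ysP : forall y, theta y = 0 -> y \in ys.
Hypothesis obs_ys : forall y, y \in ys ->
  observable (fun z => if z == y then 1 else 0 : R).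
Variables (al : R) (al_gt0 : 0 < al).
Local Notation kappa := (exp_law al_gt0).
Variables (f : metric_graph W -> R) (M : R).
Hypothesis obs_f : observable f.
Hypothesis bf : forall y, `|f y| <= M.

Let M0 : 0 <= M.
Proof. exact: le_trans (normr_ge0 _) (bf (vertex (Defs.root W))). Qed.

Let bext y : `|extend0 f y| <= M.
Proof. by case: y => [y|]//=; rewrite ?bf// normr0. Qed.

Let max0 (t : R) : 0 <= Num.max 0 t.
Proof. by rewrite le_max lexx. Qed.

Lemma exp_law_max0 (phi : R -> R) K : measurable_fun setT phi ->
  (forall t, `|phi t| <= K) -> \int[kappa]_t phi (Num.max 0 t) = \int[kappa]_t phi t.
Proof.
move=> mphi bphi.
rewrite (exp_law_density _ (phi := fun t => phi (Num.max 0 t)) (M := K))//.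
  rewrite (exp_law_density _ mphi bphi); congr (_ * _); apply: eq_Rintegral => t.
  by rewrite inE/= in_itv/= andbT => t0; rewrite max_r.
by apply: measurableT_comp => //; exact: measurable_maxr.
Qed.

(** The factor [al] turns the Laplace transform into the mean of [f] at an independent exponential
    time. *)
Lemma exp_resolvent y :
  al * resolvent P Y al f y = \int[kappa]_t \int[P (Some y)]_w extend0 f (Y (Num.max 0 t) w).
Proof.
rewrite (exp_law_density _ (phi := fun t => \int[P (Some y)]_w extend0 f (Y (Num.max 0 t) w))
  (M := M)).
- congr (_ * _); apply: eq_Rintegral => t.
  by rewrite inE/= in_itv/= andbT => t0; rewrite max_r.
- exact: (measurable_bounded_section1 kappa (P (Some y)) (joint_measurable D obs_f)
  (fun p => bext _)).
- move=> t; apply: bounded_Rintegral => //.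
  exact: (measurable_path D).
Qed.

Let A r := [set w | (T w <= r%:E)%E].
Let C y := if y \in ys then [set w | Y (fine (T w)) w = Some y] else set0.

Let mA r : measurable (A r).
Proof. exact: (measurable_hitting_le D ctheta). Qed.

Variable z : state W.

Lemma strong_markov_weights r : exists2 a : metric_graph W -> R,
  fine (P z (A r)) = \sum_(y <- ys) a y &
  forall s, 0 <= s -> \int[P z]_(w in A r) extend0 f (Y (fine (T w) + s) w) =
   \sum_(y <- ys) a y * \int[P (Some y)]_w extend0 f (Y s w).
Proof.
pose a y := P z (A r `&` C y).
have fa y : a y \is a fin_num.
  rewrite fin_num_measure//; apply: measurableI => //.
  exact: (measurable_hitting_at D ctheta obs_ys).
exists (fun y => fine (a y)).
  have := strong_markov_event D ctheta ys_uniq ysP obs_ys z r (lexx 0) measurableT.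
  rewrite (_ : _ `&` _ = A r); last by apply/seteqP; split => w //= [].
  move=> ->; rewrite -sum_fine; last first.
    by move=> y _; rewrite preimage_setT probability_setT mule1; exact: fa.
  by apply: eq_bigr => y _; rewrite preimage_setT probability_setT mule1.
move=> s s0.
(* A signed [f] is the difference of the nonnegative functions [f + M] and [M]; both are 0 at the
   cemetery, so the splitting is right there too. *)
pose c := cst M : metric_graph W -> R.
have oc : observable c by apply: observable_continuous; exact: cst_continuous.
have og := observableD obs_f oc.
have R_of_E g : observable g -> (forall y, 0 <= g y <= 2 * M) ->
  \int[P z]_(w in A r) extend0 g (Y (fine (T w) + s) w) =
   \sum_(y <- ys) fine (a y) * \int[P (Some y)]_w extend0 g (Y s w).
  move=> og' g0; rewrite /Rintegral (strong_markov_ge0 D ctheta ys_uniq ysP obs_ys z r s0 og' g0).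
  have ig y : (\int[P (Some y)]_w (extend0 g (Y s w))%:E)%E \is a fin_num.
    apply: integrable_fin_num => //; apply: (@bounded_integrable _ _ _ _ _ (2 * M)) => //.
      exact: (measurable_path D).
    move=> w; case: (Y s w) => [u|]/=; last by rewrite normr0 mulr_ge0.
    by case/andP: (g0 u) => g1 g2; rewrite ger0_norm.
  rewrite -sum_fine; last by move=> y _; apply: fin_numM; [exact: fa|exact: ig].
  by apply: eq_bigr => y _; rewrite (fineM (fa y) (ig y)).
have split_ (m : probability Omega R) B (Z : Omega -> state W) : measurable B ->
   (forall psi, observable psi -> measurable_fun setT (fun w => extend0 psi (Z w))) ->
   \int[m]_(w in B) extend0 f (Z w) =
   \int[m]_(w in B) extend0 (fun y => f y + c y) (Z w) - \int[m]_(w in B) extend0 c (Z w).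
  move=> mB mZ; rewrite -RintegralB//.
  - by apply: eq_Rintegral => w _; case: (Z w) => [y|]/=; rewrite ?addrK// subr0.
  - apply: (@bounded_integrable _ _ _ _ _ (M + M)) => //; first exact: mZ.
    move=> w; case: (Z w) => [y|]/=; last by rewrite normr0 addr_ge0.
    by rewrite (le_trans (ler_normD _ _))// lerD// ger0_norm.
  - apply: (@bounded_integrable _ _ _ _ _ M) => //; first exact: mZ.
    by move=> w; case: (Z w) => [y|]/=; rewrite ?normr0// ger0_norm.
rewrite split_//; last by move=> psi op; exact: (measurable_after D ctheta).
rewrite !R_of_E//; first last.
- by move=> y; have := bf y; rewrite ler_norml /c/=; move/andP; lra.
- by move=> y; rewrite /c/=; have := M0; lra.
rewrite -sumrB; apply: eq_bigr => y _; rewrite -mulrBr; congr (_ * _).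
by rewrite -split_// => psi op; exact: (measurable_path D).
Qed.

Variable c : R.
Hypothesis res_c : forall y, y \in ys -> resolvent P Y al f y = c.

Let h s w := extend0 f (Y (fine (T w) + Num.max 0 s) w) - al * c.
Let K := M + `|al * c|.

Let bh s w : `|h s w| <= K.
Proof. by rewrite (le_trans (ler_normB _ _))// lerD. Qed.

Let mh : measurable_fun setT (fun p : measurableTypeR R * Omega => h p.1 p.2).
Proof.
apply: measurable_funB => //; exact: (joint_measurable_after D ctheta).
Qed.

Let J (r : R) w : R := if (T w <= r%:E)%E then 1 else 0.

Let mJ : measurable_fun setT (fun p : measurableTypeR R * Omega => J p.1 p.2).
Proof.
apply: measurable_fun_ifT => //; apply: measurable_fun_lee.
  by apply: measurableT_comp; [exact: (measurable_hitting_time D ctheta)|exact: measurable_snd].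
by apply/measurable_EFinP; exact: measurable_fst.
Qed.

Let J01 r w : 0 <= J r w <= 1.
Proof. by rewrite /J; case: ifP => _; rewrite lexx ler01. Qed.

Let bJ r w v : `|v| <= K -> `|J r w * v| <= K.
Proof.
move=> vK; have /andP[J0 J1] := J01 r w; rewrite normrM (ger0_norm J0).
by rewrite (le_trans _ vK)// ler_piMl.
Qed.

(** At [T] the path starts afresh from a point of [ys], from where the mean of [f] at an exponential
    time is [al * c], the same for all of them; [h] is the deviation from this mean. *)
Lemma restart_mean r : \int[kappa]_s \int[P z]_w (J r w * h s w) = 0.
Proof.
have [a Ea Ha] := strong_markov_weights r.
pose g y s := \int[P (Some y)]_w extend0 f (Y (Num.max 0 s) w).
have mg y : measurable_fun setT (g y : measurableTypeR R -> R).
  exact: (measurable_bounded_section1 kappa (P (Some y)) (joint_measurable D obs_f)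
    (fun p => bext _)).
have bg y s : `|g y s| <= M.
  by apply: bounded_Rintegral => //; exact: (measurable_path D).
have ig y := bounded_integrable kappa measurableT (mg y) (bg y).
transitivity (\int[kappa]_s \sum_(y <- ys) a y * (g y s - al * c)).
  apply: eq_Rintegral => s _.
  transitivity (\int[P z]_(w in A r) h s w).
    rewrite [RHS]Rintegral_mkcond; apply: eq_Rintegral => w _; rewrite patchE /J.
    rewrite (_ : (w \in A r) = (T w <= r%:E)%E); last by apply/idP/idP; rewrite inE.
    by case: ifP => _; rewrite ?mul1r ?mul0r.
  have ms : measurable_fun setT (fun w => extend0 f (Y (fine (T w) + Num.max 0 s) w)).
    exact: (measurable_after D ctheta).
  rewrite RintegralB//; last 2 first.
  - exact: (bounded_integrable _ (mA r) ms (fun w => bext _)).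
  - exact: finite_measure_integrable_cst.
  rewrite (Ha _ (max0 s)) Rintegral_cst// [fine _]Ea mulr_sumr -sumrB.
  by apply: eq_bigr => y _; rewrite mulrBr (mulrC (al * c)).
rewrite (_ : (fun s => _) = (fun s => \sum_(y <- ys) a y * (g y s - al * c)))//.
(* Induction over lists contained in [ys], as the resolvent is known to be [c] only there. *)
have isum : forall (l : seq (metric_graph W)), {subset l <= ys} ->
   (kappa).-integrable setT (EFin \o (fun s => \sum_(y <- l) a y * (g y s - al * c))) /\
   \int[kappa]_s (\sum_(y <- l) a y * (g y s - al * c)) = 0.
  elim => [|y l IH] sl.
    rewrite (_ : (fun s => _) = cst 0); last by apply/funext => s; rewrite big_nil.
    split; first exact: finite_measure_integrable_cst.
    by rewrite Rintegral_cst// mul0r.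
  have [|i1 e1] := IH; first by move=> u ul; apply: sl; rewrite inE ul orbT.
  have i3 : kappa.-integrable setT (EFin \o (fun s => g y s - al * c)).
    apply: (@bounded_integrable _ _ _ kappa _ K) => //; first exact: measurable_funB.
    by move=> s; rewrite (le_trans (ler_normB _ _))// lerD.
  have i2 : kappa.-integrable setT (EFin \o (fun s => a y * (g y s - al * c))).
    exact: (integrableZl measurableT _ i3).
  rewrite (_ : (fun s => _) = (fun s => a y * (g y s - al * c) + \sum_(j <- l) a j *
    (g j s - al * c))); last first.
    by apply/funext => s; rewrite big_cons.
  split; first exact: integrableD i2 i1.
  rewrite RintegralD// e1 addr0 RintegralZl// RintegralB//; last first.
    exact: finite_measure_integrable_cst.
  have yys : y \in ys by apply: sl; rewrite inE eqxx.
  rewrite -exp_resolvent res_c// Rintegral_cst// [X in _ * fine X]probability_setT.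
  by rewrite mulr1 subrr mulr0.
by have [] := isum ys (fun _ => id).
Qed.

Let h0 t w := extend0 f (Y (Num.max 0 t) w) - al * c.

Let mh0 : measurable_fun setT (fun p : measurableTypeR R * Omega => h0 p.1 p.2).
Proof. by apply: measurable_funB => //; exact: (joint_measurable D). Qed.

Let bh0 s w : `|h0 s w| <= K.
Proof. by rewrite (le_trans (ler_normB _ _))// lerD. Qed.

(* From T on, the exponential time that exceeds T is an exponential time again,
   and exp (- al T) is the probability that another one, r, exceeds T. *)
Lemma restart_path w : \int[kappa]_t (J (Num.max 0 t) w * h0 t w) =
  \int[kappa]_r (J r w * \int[kappa]_s h s w).
Proof.
have mh0w : measurable_fun setT (h0 ^~ w : measurableTypeR R -> R).
  exact: (measurableT_comp mh0 (measurable_pair2 w)).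
have mJw : measurable_fun setT (J ^~ w : measurableTypeR R -> R).
  exact: (measurableT_comp mJ (measurable_pair2 w)).
have [Toy|] := boolP (T w < +oo)%E; last first.
  rewrite -leNgt leye_eq => /eqP Ty.
  have z0 (phi : R -> R) : (forall t, phi t = 0) -> \int[kappa]_t phi t = 0.
    move=> p0; rewrite (_ : phi = cst 0); last exact/funext.
    by rewrite Rintegral_cst// mul0r.
  by rewrite [LHS]z0 ?[RHS]z0// => t; rewrite /J Ty leye_eq/= mul0r.
have T0 : (0 <= T w)%E := hitting_time_ge0 Y theta w.
have ET : T w = (fine (T w))%:E by rewrite fineK// ge0_fin_numE.
set tau := fine (T w) in ET.
have tau0 : 0 <= tau by rewrite fine_ge0.
have ml := exp_law_memoryless al_gt0.
have -> : \int[kappa]_t (J (Num.max 0 t) w * h0 t w) = \int[kappa]_(t in `[tau, +oo[) h0 t w.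
  (* For [tau = 0] the indicator is 1 at negative [t] as well; the integrands then differ, but on a
     set of measure 0 for the exponential law. *)
  have [t0|t0] := ltP 0 tau.
    rewrite [RHS]Rintegral_mkcond; apply: eq_Rintegral => t _; rewrite patchE /J ET lee_fin.
    rewrite mem_setE in_itv/= andbT le_max leNgt t0/=.
    by case: ifP; rewrite ?mul1r ?mul0r.
  have E0 : tau = 0 by apply/eqP; rewrite eq_le t0.
  rewrite E0 (ml _ (h0 ^~ w) K)// mulr0 expR0 mul1r; apply: eq_Rintegral => t _.
  by rewrite add0r /J ET lee_fin E0 max0 mul1r.
rewrite (ml _ (h0 ^~ w) K)//.
rewrite RintegralZr//; last first.
  by apply: (@bounded_integrable _ _ _ _ _ 1) => // r; have /andP[J0 J1] := J01 r w;
    rewrite ger0_norm.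
congr (_ * _).
  transitivity (\int[kappa]_(r in `[tau, +oo[) cst 1 r).
    by rewrite Rintegral_cst// [X in 1 * fine X]exp_law_ray max_r// mul1r.
  rewrite [LHS]Rintegral_mkcond; apply: eq_Rintegral => t _; rewrite patchE /J ET lee_fin.
  by rewrite mem_setE in_itv/= andbT.
rewrite -[LHS](@exp_law_max0 (fun t => h0 (tau + t) w) K)//.
  by apply: eq_Rintegral => s _; rewrite /h0 /h -/tau max_r// addr_ge0.
by apply: (measurableT_comp mh0w); exact: measurable_funD.
Qed.

(** When the exponential time exceeds [T], the value of [f] may be replaced by its mean [al * c]
    given the path up to [T]. *)
Lemma dynkin y : z = Some y ->
  al * resolvent P Y al f y =
  \int[P z]_w \int[kappa]_t (if (T w <= (Num.max 0 t)%:E)%E then al * c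
                             else extend0 f (Y (Num.max 0 t) w)).
Proof.
move=> zy; rewrite exp_resolvent -zy.
rewrite (bounded_fubini kappa (P z) (joint_measurable D obs_f) (fun p => bext _)).
pose k (p : Omega * measurableTypeR R) := J (Num.max 0 p.2) p.1 * h0 p.2 p.1.
have mh0' : measurable_fun setT (fun p : Omega * measurableTypeR R => h0 p.2 p.1).
  exact: (measurableT_comp mh0 (@measurable_swap _ _ _ _)).
have mmax : measurable_fun setT (fun p : Omega * measurableTypeR R => (Num.max 0 p.2, p.1) :
  measurableTypeR R * Omega).
  apply/measurable_fun_pairP; split; last exact: measurable_fst.
  by apply: measurable_maxr => //; exact: measurable_snd.
have mk : measurable_fun setT k.
  by apply: measurable_funM => //; exact: (measurableT_comp mJ mmax).
have bk p : `|k p| <= K by exact: bJ.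
pose g (p : Omega * measurableTypeR R) := extend0 f (Y (Num.max 0 p.2) p.1).
have mg : measurable_fun setT g.
  exact: (measurableT_comp (joint_measurable D obs_f) (@measurable_swap _ _ _ _)).
have bg p : `|g p| <= M by exact: bext.
have mg1 := measurable_bounded_section1 (P z) kappa mg bg.
have mk1 := measurable_bounded_section1 (P z) kappa mk bk.
have mgw w : measurable_fun setT (fun t => g (w, t)) by exact:
  (measurableT_comp mg (measurable_pair1 w)).
have mkw w : measurable_fun setT (fun t => k (w, t)) by exact:
  (measurableT_comp mk (measurable_pair1 w)).
have bg1 w : `|\int[kappa]_t g (w, t)| <= M by exact: bounded_Rintegral.
have bk1 w : `|\int[kappa]_t k (w, t)| <= K by exact: bounded_Rintegral.
(* The error made by this replacement. [restart_path] separates the time left after [T] from the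
   event [T <= r]; after an exchange of integrals, [restart_mean] applies for each [r]. *)
have k0 : \int[P z]_w \int[kappa]_t k (w, t) = 0.
  transitivity (\int[P z]_w \int[kappa]_r (J r w * \int[kappa]_s h s w)).
    by apply: eq_Rintegral => w _; exact: restart_path.
  pose H w := \int[kappa]_s h s w.
  have mh' : measurable_fun setT (fun p : Omega * measurableTypeR R => h p.2 p.1).
    exact: (measurableT_comp mh (@measurable_swap _ _ _ _)).
  have mH : measurable_fun setT H.
    exact: (measurable_bounded_section1 (P z) kappa mh' (fun p => bh _ _)).
  have mhw w : measurable_fun setT (h ^~ w : measurableTypeR R -> R).
    exact: (measurableT_comp mh (measurable_pair2 w)).
  have bH w : `|H w| <= K by exact: bounded_Rintegral.
  have mJH : measurable_fun setT (fun p : measurableTypeR R * Omega => J p.1 p.2 * H p.2).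
    by apply: measurable_funM => //; exact: (measurableT_comp mH measurable_snd).
  rewrite -(bounded_fubini kappa (P z) mJH (fun p => bJ _ _ (bH _)))/=.
  transitivity (\int[kappa]_r (0 : R)); last by rewrite Rintegral_cst// mul0r.
  apply: eq_Rintegral => r _; rewrite -(restart_mean r).
  have mJh : measurable_fun setT (fun p : measurableTypeR R * Omega => J r p.2 * h p.1 p.2).
    apply: measurable_funM => //.
    exact: (measurableT_comp (measurableT_comp mJ (measurable_pair1 r)) measurable_snd).
  rewrite (bounded_fubini kappa (P z) mJh (fun p => bJ _ _ (bh _ _)))/=.
  by apply: eq_Rintegral => w _; rewrite RintegralZl//;
    exact: (bounded_integrable kappa measurableT (mhw w) (fun s => bh s w)).
transitivity (\int[P z]_w \int[kappa]_t g (w, t) - \int[P z]_w \int[kappa]_t k (w, t)).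
  by rewrite k0 subr0.
rewrite -RintegralB//.
- apply: eq_Rintegral => w _; rewrite -RintegralB//.
  + apply: eq_Rintegral => t _; rewrite /k /g /J /h0/=; case: ifP => _.
      by rewrite mul1r; ring.
    by rewrite mul0r subr0.
  + exact: (bounded_integrable kappa measurableT (mgw w) (fun s => bg _)).
  + exact: (bounded_integrable kappa measurableT (mkw w) (fun s => bk _)).
- exact: (bounded_integrable (P z) measurableT mg1 bg1).
- exact: (bounded_integrable (P z) measurableT mk1 bk1).
Qed.

End dynkin_formula.

(** * Mean hitting times *)

Section iterated_integrals.
Context (R : realType) d1 d2 (T1 : measurableType d1) (T2 : measurableType d2).
Variables (m1 : probability T1 R) (m2 : probability T2 R).
Implicit Types f g : T1 * T2 -> R.

Definition bounded_measurable f : Prop :=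
  measurable_fun setT f /\ exists M, forall p, `|f p| <= M.

Definition iterated f : R := \int[m1]_x \int[m2]_y f (x, y).

Lemma bounded_measurable_inner f : bounded_measurable f ->
  [/\ forall x, m2.-integrable setT (EFin \o (fun y => f (x, y))),
      m1.-integrable setT (EFin \o (fun x => \int[m2]_y f (x, y))) &
      measurable_fun setT (fun x => \int[m2]_y f (x, y))].
Proof.
move=> [mf [M bf]].
have mfx x : measurable_fun setT (fun y => f (x, y)).
  exact: (measurableT_comp mf (measurable_pair1 x)).
have m1f := measurable_bounded_section1 m1 m2 mf bf.
split => //.
- by move=> x; exact: (bounded_integrable m2 measurableT (mfx x) (fun y => bf _)).
- apply: (bounded_integrable m1 measurableT m1f (M := M)).
  by move=> x; apply: bounded_Rintegral.
Qed.

Lemma iterated_cst c : iterated (fun=> c) = c.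
Proof.
rewrite /iterated Rintegral_cst// [X in _ * fine X]probability_setT mulr1.
by rewrite Rintegral_cst// [X in _ * fine X]probability_setT mulr1.
Qed.

Lemma bounded_measurable_linear f g a b : bounded_measurable f ->
  bounded_measurable g -> bounded_measurable (fun p => a * f p + b * g p).
Proof.
move=> [mf [M bf]] [mg [N bg]]; split.
  by apply: measurable_funD; apply: measurable_funM.
exists (`|a| * M + `|b| * N) => p; rewrite (le_trans (ler_normD _ _))//.
by rewrite !normrM lerD// ler_wpM2l.
Qed.

Lemma iterated_linear f g a b : bounded_measurable f -> bounded_measurable g ->
  iterated (fun p => a * f p + b * g p) = a * iterated f + b * iterated g.
Proof.
move=> /bounded_measurable_inner[i1f i2f _] /bounded_measurable_inner[i1g i2g _].
have Zf := integrableZl measurableT a i2f.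
have Zg := integrableZl measurableT b i2g.
rewrite /iterated -(RintegralZl _ measurableT i2f) -(RintegralZl _ measurableT i2g).
rewrite -(RintegralD measurableT Zf Zg); apply: eq_Rintegral => x _.
rewrite -(RintegralZl _ measurableT (i1f x)) -(RintegralZl _ measurableT (i1g x)).
rewrite -RintegralD//.
- exact: (integrableZl measurableT a (i1f x)).
- exact: (integrableZl measurableT b (i1g x)).
Qed.

Lemma iterated_ae_le f g : bounded_measurable f -> bounded_measurable g ->
  {ae m1, forall x, forall y, f (x, y) <= g (x, y)} -> iterated f <= iterated g.
Proof.
move=> /bounded_measurable_inner[i1f i2f mf] /bounded_measurable_inner[i1g i2g mg] fg.
pose F x := \int[m2]_y f (x, y); pose G x := \int[m2]_y g (x, y).
(* The minimum equals [F] almost everywhere and is at most [G] everywhere, which reduces the claim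
   to a pointwise comparison. *)
have mmin : measurable_fun setT (fun x => Num.min (F x) (G x)) by exact: measurable_minr.
have E : iterated f = \int[m1]_x Num.min (F x) (G x).
  rewrite /iterated /Rintegral; congr fine; apply: ae_eq_integral => //.
  - exact/measurable_EFinP.
  - exact/measurable_EFinP.
  apply: (@filterS _ _ (ae_filter_ringOfSetsType m1) _ _ _ fg) => x fgx _.
  by rewrite min_l// le_Rintegral.
rewrite E; apply: le_Rintegral => //; last by move=> x _; rewrite ge_min lexx orbT.
apply: (@le_integrable _ _ _ m1 _ measurableT _ (fun x => (`|F x| + `|G x|)%:E)) => //.
- exact/measurable_EFinP.
- move=> x _ /=; rewrite lee_fin (ger0_norm (addr_ge0 _ _))//.
  by rewrite /Num.min; case: ifP => _; [rewrite lerDl|rewrite lerDr].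
- apply: (integrableD measurableT (f := fun x => `|F x|%:E) (g := fun x => `|G x|%:E)).
  + exact: integrable_norm.
  + exact: integrable_norm.
Qed.

End iterated_integrals.

Section mean_hitting_time.
Variables (R : realType) (W : weighted_graph R).
Variables (d : measure_display) (Omega : measurableType d).
Variables (P : state W -> probability Omega R) (Y : R -> Omega -> state W).
Hypothesis D : diffusion P Y.
Variable theta : metric_graph W -> R.
Hypothesis ctheta : continuous theta.
Let F := [set y | theta y = 0].
Let T := hitting_time Y F.
Variable ys : seq (metric_graph W).
Hypothesis ys_uniq : uniq ys.
Hypothesis ysP : forall y, theta y = 0 -> y \in ys.
Hypothesis obs_ys : forall y, y \in ys ->
  observable (fun z => if z == y then 1 else 0 : R).
Variable x0 : metric_graph W.
Hypothesis theta_x0 : 0 < theta x0.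

Let T0 w : (0 <= T w)%E := hitting_time_ge0 Y theta w.

Section fixed_rate.
Variables (al : R) (al_gt0 : 0 < al).
Local Notation kappa := (exp_law al_gt0).
Local Notation II := (iterated (P (Some x0)) kappa).

(** The probability, given the path, that [T] exceeds the exponential time; its mean is the Q of the
    overview. *)
Definition survival w : R := \int[kappa]_t (if (T w <= (Num.max 0 t)%:E)%E then 0 else 1).

Lemma survivalE w :
  survival w = 1 - (if (T w < +oo)%E then expR (- al * fine (T w)) else 0).
Proof.
case: ifPn => [Toy|]; last first.
  rewrite -leNgt leye_eq => /eqP Ty; rewrite subr0.
  transitivity (\int[kappa]_t (1 : R)).
    by apply: eq_Rintegral => t _; rewrite Ty leye_eq.
  by rewrite Rintegral_cst// mul1r [X in fine X]probability_setT.
have ET : T w = (fine (T w))%:E by rewrite fineK// ge0_fin_numE.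
set tau := fine (T w) in ET *.
have tau0 : 0 <= tau by rewrite -lee_fin -ET.
have i1 : kappa.-integrable setT (EFin \o cst 1) by exact: finite_measure_integrable_cst.
have Et : \int[kappa]_(t in `[tau, +oo[) (1 : R) = expR (- al * tau).
  rewrite Rintegral_cst// mul1r.
  have Ek : kappa `[tau, +oo[%classic = (expR (- al * tau))%:E by rewrite exp_law_ray max_r.
  by rewrite [X in fine X]Ek.
have [t0|t0] := ltP 0 tau; last first.
  have E0 : tau = 0 by apply/eqP; rewrite eq_le t0.
  rewrite E0 mulr0 expR0 subrr.
  transitivity (\int[kappa]_t (0 : R)); last by rewrite Rintegral_cst// mul0r.
  by apply: eq_Rintegral => t _; rewrite ET E0 lee_fin le_max lexx.
pose k (t : measurableTypeR R) : R := if tau <= t then 1 else 0.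
have mk : measurable_fun setT k by apply: measurable_fun_ifT => //; exact: measurable_fun_ler.
have ik : kappa.-integrable setT (EFin \o k).
  by apply: (bounded_integrable kappa measurableT mk (M := 1)) => t; rewrite /k;
    case: ifP => _; rewrite ?normr0 ?normr1.
have -> : expR (- al * tau) = \int[kappa]_t k t.
  rewrite -Et Rintegral_mkcond; apply: eq_Rintegral => t _.
  by rewrite patchE mem_setE in_itv/= andbT.
transitivity (\int[kappa]_t 1 - \int[kappa]_t k t); last first.
  by rewrite Rintegral_cst// [X in _ * fine X - _]probability_setT mulr1.
rewrite -RintegralB//; apply: eq_Rintegral => t _.
rewrite /k ET lee_fin le_max leNgt t0/=.
by case: ifP => _; rewrite ?subrr ?subr0.
Qed.

Lemma survival_le w : (T w < +oo)%E -> survival w <= al * fine (T w).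
Proof.
move=> Toy; rewrite survivalE Toy lerBlDr -lerBlDl.
by have := expR_ge1Dx (- al * fine (T w)); rewrite mulNr.
Qed.

(** From exp y >= 1 + y follows y <= (1 + y) (1 - exp (- y)). The truncation at [N] makes the factor
    uniform in the path. *)
Lemma survival_ge w (N : R) : 0 <= N ->
  al * fine (Order.min (T w) N%:E) <= (1 + al * N) * survival w.
Proof.
move=> N0; have B0 : 0 <= al * N by rewrite mulr_ge0// ltW.
rewrite survivalE; case: ifPn => [Toy|]; last first.
  rewrite -leNgt leye_eq => /eqP ->; rewrite subr0 mulr1 min_r ?leey//=.
  by rewrite lerDr.
have ET : T w = (fine (T w))%:E by rewrite fineK// ge0_fin_numE.
set tau := fine (T w) in ET *.
have tau0 : 0 <= tau by rewrite -lee_fin -ET.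
rewrite ET -EFin_min/=.
set y := al * tau; have y0 : 0 <= y by rewrite mulr_ge0// ltW.
set E := expR (- al * tau).
have E0 : 0 < E by exact: expR_gt0.
have E1 : E * (1 + y) <= 1.
  rewrite /E mulNr expRN -/y mulrC ler_pdivrMr ?expR_gt0// mul1r.
  exact: expR_ge1Dx.
have E2 : E <= 1.
  by rewrite (le_trans _ E1)// ler_peMr ?(ltW E0)// lerDl.
have [tN|tN] := leP tau N.
  have yB : y <= al * N by rewrite ler_pM2l.
  rewrite -/y; nra.
have yB : al * N <= y by rewrite ler_pM2l// ltW.
nra.
Qed.

(** Death before [T] is not yet ruled out, so the cemetery counts as good. *)
Let good (v : state W) := if v is Some y then 0 < theta y else true.

Let stop (c : R) (g : state W -> R) (p : Omega * measurableTypeR R) : R :=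
  if (T p.1 <= (Num.max 0 p.2)%:E)%E then c else g (Y (Num.max 0 p.2) p.1).

Let stop_bm c f M : observable f -> (forall y, `|f y| <= M) ->
  bounded_measurable (stop c (extend0 f)).
Proof.
move=> of_ bf; split; last first.
  have M0 : 0 <= M by exact: le_trans (normr_ge0 _) (bf x0).
  exists (`|c| + M) => p; rewrite /stop; case: ifP => _; first by rewrite lerDl.
  by case: (Y _ _) => [y|]/=; rewrite ?normr0 ?addr_ge0// (le_trans (bf y))// lerDr.
apply: measurable_fun_ifT => //.
  apply: measurable_fun_lee.
    by apply: measurableT_comp; [exact: (measurable_hitting_time D ctheta)|exact: measurable_fst].
  by apply/measurable_EFinP; apply: measurable_maxr => //; exact: measurable_snd.
exact: (measurableT_comp (joint_measurable D of_) (@measurable_swap _ _ _ _)).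
Qed.

Let ae_good : {ae P (Some x0), forall w, forall t, (T w <= (Num.max 0 t)%:E)%E = false ->
  good (Y (Num.max 0 t) w)}.
Proof.
apply: (@filterS _ _ (ae_filter_ringOfSetsType (P (Some x0))) _ _ _ (diffusion_start D (Some x0))).
move=> w Y0 t /negbT; rewrite -ltNge => tT; rewrite /good.
case E : (Y _ w) => [y|]//.
by apply: (path_sign D ctheta Y0 theta_x0 _ tT E); rewrite le_max lexx.
Qed.

Variables (A Mu : R) (f1 f2 : metric_graph W -> R) (M1 M2 : R).
Hypothesis Mu0 : 0 <= Mu.
Hypothesis obs_f1 : observable f1.
Hypothesis bf1 : forall y, `|f1 y| <= M1.
Hypothesis f1E : forall y, 0 < theta y -> f1 y = al.
Hypothesis res_f1 : forall y, y \in x0 :: ys -> resolvent P Y al f1 y = 1.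
Hypothesis obs_f2 : observable f2.
Hypothesis bf2 : forall y, `|f2 y| <= M2.
Hypothesis f2E : forall y, 0 < theta y -> 1 <= f2 y <= 1 + al * Mu.
Hypothesis res_f2 : forall y, y \in ys -> resolvent P Y al f2 y = 0.
Hypothesis res_f2_x0 : resolvent P Y al f2 x0 = A.

(* Up to T, f1 equals al; as its resolvent is 1 at x0 and on ys, the path is alive
   until T. *)
Lemma survival_sandwich :
  \int[P (Some x0)]_w survival w <= al * A <= (1 + al * Mu) * \int[P (Some x0)]_w survival w.
Proof.
have oc c : observable (cst c : metric_graph W -> R).
  by apply: observable_continuous; exact: cst_continuous.
have b1 := stop_bm al obs_f1 bf1; have b2 := stop_bm 0 obs_f2 bf2.
have bc : bounded_measurable (stop 0 (cst 1)).
  have b0 (y : metric_graph W) : `|cst 0 y : R| <= 0 by rewrite normr0.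
  have [m1 [K bK]] := stop_bm (-1) (oc 0) b0.
  (* The constant 1 on all states is not an [extend0], since it is 1 at the cemetery; subtracting 1
     brings it into the scope of [stop_bm]. *)
  rewrite (_ : stop 0 (cst 1) = (fun p => 1 + stop (-1) (extend0 (cst 0)) p)).
    split; first exact: measurable_funD.
    by exists (1 + K) => p; rewrite (le_trans (ler_normD _ _))// normr1 lerD2l.
  apply/funext => p; rewrite /stop; case: ifP => _; first by rewrite subrr.
  by case: (Y _ _) => [y|]/=; rewrite addr0.
have bone : bounded_measurable (fun _ : Omega * measurableTypeR R => 1 : R) by split => //;
  exists 1 => p; rewrite normr1.
have S1 : \int[P (Some x0)]_w survival w = II (stop 0 (cst 1)) by [].
have D1 : al = II (stop al (extend0 f1)).
  have res1 y : y \in ys -> resolvent P Y al f1 y = 1.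
    by move=> yys; apply: res_f1; rewrite inE yys orbT.
  have := dynkin D ctheta ys_uniq ysP obs_ys al_gt0 obs_f1 bf1 res1 (erefl (Some x0)).
  by rewrite res_f1 ?inE ?eqxx// mulr1.
have D2 : al * A = II (stop 0 (extend0 f2)).
  have := dynkin D ctheta ys_uniq ysP obs_ys al_gt0 obs_f2 bf2 res_f2 (erefl (Some x0)).
  by rewrite res_f2_x0 mulr0.
rewrite S1 D2; apply/andP; split.
  have b12 := bounded_measurable_linear 1 (- al^-1) b2 b1.
  have b3 := bounded_measurable_linear 1 1 b12 bone.
  (* What is added is [1 - al^-1 * stop al (extend0 f1)], of mean 0 by [D1]. It vanishes after [T]
     and, almost surely, while the path is alive before [T]; at a path dead before [T] it is 1 and
     makes up for [f2] contributing 0 there. *)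
  have -> : II (stop 0 (extend0 f2)) =
    II (fun p => 1 * (1 * stop 0 (extend0 f2) p + - al^-1 * stop al (extend0 f1) p) + 1 * 1).
    rewrite (iterated_linear _ _ _ _ b12 bone) (iterated_linear _ _ _ _ b2 b1).
    rewrite -D1 iterated_cst; field.
    by rewrite gt_eqF.
  apply: iterated_ae_le => //.
  apply: (@filterS _ _ (ae_filter_ringOfSetsType (P (Some x0))) _ _ _ ae_good).
  move=> w gw t; rewrite /stop/=; case: ifPn => [_|/negbTE /gw].
    by rewrite !mul1r add0r mulNr mulVf ?gt_eqF// addNr.
  case: (Y _ w) => [y|]/=; last by rewrite !mulr0 mul1r addr0 add0r mul1r.
  move=> /[dup] /f1E -> /f2E /andP[f2y _].
  by rewrite !mul1r mulNr mulVf ?gt_eqF// subrK.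
rewrite -[leRHS]addr0 -[X in _ + X](mul0r (II (stop 0 (cst 1)))).
rewrite -(iterated_linear _ _ _ _ bc bc).
apply: iterated_ae_le => //; first exact: bounded_measurable_linear.
apply: (@filterS _ _ (ae_filter_ringOfSetsType (P (Some x0))) _ _ _ ae_good).
move=> w gw t; rewrite /stop/=; case: ifPn => [_|/negbTE /gw]; first by rewrite !mulr0 addr0.
rewrite mul0r addr0 mulr1.
case: (Y _ w) => [y|]/=; first by move=> /f2E /andP[].
by rewrite addr_ge0// mulr_ge0// ltW.
Qed.

Lemma measurable_survival : measurable_fun setT survival.
Proof.
have mT := measurable_hitting_time D ctheta.
rewrite (_ : survival = (fun w => 1 - (if (T w < +oo)%E then expR (- al * fine (T w)) else 0))).
  apply: measurable_funB => //; apply: measurable_fun_ifT => //.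
    exact: measurable_fun_lte.
  apply: measurableT_comp => //; apply: measurable_funM => //.
  exact: (@measurableT_comp _ _ _ _ _ _ (@fine R)).
by apply/funext => w; exact: survivalE.
Qed.

Lemma survival01 w : 0 <= survival w <= 1.
Proof.
rewrite survivalE; case: ifPn => [Toy|_]; last by rewrite subr0 lexx ler01.
rewrite subr_ge0 lerBlDr lerDl expR_ge0 andbT -expR0 ler_expR mulNr oppr_le0.
by rewrite mulr_ge0 ?(ltW al_gt0)// fine_ge0.
Qed.

Lemma integrable_survival : (P (Some x0)).-integrable setT (EFin \o survival).
Proof.
apply: (bounded_integrable _ measurableT measurable_survival (M := 1)) => w.
by have /andP[s0 s1] := survival01 w; rewrite ger0_norm.
Qed.

End fixed_rate.

Lemma mean_hitting_time A Mu : 0 <= Mu ->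
  (forall al, 0 < al -> exists f1 M1, [/\ observable f1, forall y, `|f1 y| <= M1,
    forall y, 0 < theta y -> f1 y = al &
    forall y, y \in x0 :: ys -> resolvent P Y al f1 y = 1]) ->
  (forall al, 0 < al -> exists f2 M2, [/\ observable f2, forall y, `|f2 y| <= M2,
    forall y, 0 < theta y -> 1 <= f2 y <= 1 + al * Mu,
    forall y, y \in ys -> resolvent P Y al f2 y = 0 & resolvent P Y al f2 x0 = A]) ->
  (\int[P (Some x0)]_w T w)%E = A%:E.
Proof.
move=> Mu0 H1 H2; have mT := measurable_hitting_time D ctheta.
pose Q al (al0 : 0 < al) := \int[P (Some x0)]_w survival al0 w.
have SW al (al0 : 0 < al) : Q al al0 <= al * A <= (1 + al * Mu) * Q al al0.
  have [f1 [M1 [? ? ? ?]]] := H1 al al0; have [f2 [M2 [? ? ? ? ?]]] := H2 al al0.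
  exact: (@survival_sandwich al al0 A Mu f1 f2 M1 M2).
(* The passage [al -> 0]: for a margin [e] it suffices to take [al = e / (B * Z + 1)]. *)
have small (B X Z : R) : 0 <= B -> 0 <= Z -> (forall al, 0 < al -> X <= (1 + al * B) * Z) -> X <= Z.
  move=> B0 Z0 H; apply/ler_addgt0Pr => e e0.
  have BZ : 0 < B * Z + 1 by rewrite ltr_wpDl// mulr_ge0.
  have al0 : 0 < e / (B * Z + 1) by rewrite divr_gt0.
  apply: (le_trans (H _ al0)); rewrite mulrDl mul1r lerD2l -mulrA.
  by rewrite mulrAC ler_pdivrMr// ler_pM2l// lerDl.
have Q0 al (al0 : 0 < al) : 0 <= Q al al0.
  by apply: Rintegral_ge0 => w _; have /andP[] := survival01 al0 w.
have A0 : 0 <= A.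
  by have /andP[+ _] := SW 1 ltr01; rewrite mul1r; exact: le_trans.
(* The mean of [T] is not known to be finite yet; it is bounded through truncations, uniformly in
   [n]. *)
pose tN (n : nat) w := Order.min (T w) n%:R%:E.
have tN0 n w : (0 <= tN n w)%E by rewrite le_min (T0 w)/= lee_fin ler0n.
have tNn n w : (tN n w <= n%:R%:E)%E by rewrite ge_min lexx orbT.
have mtN n : measurable_fun setT (tN n) by exact: measurable_mine.
have tNfin n w : tN n w = (fine (tN n w))%:E.
  by rewrite fineK// ge0_fin_numE// (le_lt_trans (tNn n w))// ltry.
have up n : (\int[P (Some x0)]_w tN n w <= A%:E)%E.
  have mf : measurable_fun setT (fine \o tN n).
    exact: (@measurableT_comp _ _ _ _ _ _ (@fine R)).
  have if_ : (P (Some x0)).-integrable setT (EFin \o (fine \o tN n)).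
    apply: (bounded_integrable _ measurableT mf (M := n%:R)) => w.
    by rewrite /= ger0_norm ?fine_ge0// -lee_fin -tNfin.
  have -> : (\int[P (Some x0)]_w tN n w = (\int[P (Some x0)]_w fine (tN n w))%:E)%E.
    rewrite /Rintegral fineK; first by apply: eq_integral => w _.
    exact: integrable_fin_num if_.
  (* [al] times the truncated mean is at most [(1 + al * n) * Q], and Q is at most [al * A]. *)
  rewrite lee_fin; apply: (small n%:R) => // al al0.
  rewrite -(ler_pM2l al0) -(RintegralZl _ measurableT if_).
  have /andP[QA _] := SW al al0.
  have Bn : 0 <= 1 + al * n%:R by rewrite addr_ge0// mulr_ge0// ltW.
  rewrite mulrCA; apply: (@le_trans _ _ ((1 + al * n%:R) * Q al al0)); last by rewrite ler_wpM2l.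
  rewrite -(RintegralZl _ measurableT (integrable_survival al0)).
  apply: le_Rintegral => //.
  - exact: (integrableZl measurableT al if_).
  - exact: (integrableZl measurableT _ (integrable_survival al0)).
  - by move=> w _; exact: survival_ge.
have IA : (\int[P (Some x0)]_w T w <= A%:E)%E.
  have tNT w : tN n w @[n --> \oo] --> T w.
    have [Toy|] := boolP (T w < +oo)%E.
      have ET : T w = (fine (T w))%:E by rewrite fineK// ge0_fin_numE.
      apply: cvg_near_cst; near=> n.
      apply/eqP; rewrite /tN min_l// ET lee_fin; near: n; exact: nbhs_infty_ger.
    rewrite -leNgt leye_eq => /eqP Ty; rewrite Ty.
    rewrite (_ : tN ^~ w = (fun n => n%:R%:E)).
      by apply/cvgeryP; exact: cvgr_idn.
    by apply/funext => n; rewrite /tN Ty min_r// leey.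
  have nd w : setT w -> nondecreasing_seq (tN ^~ w).
    move=> _ m n mn; rewrite /tN le_min ge_min lexx/= ge_min lee_fin ler_nat mn orbT.
    by [].
  have cv := @cvg_monotone_convergence _ _ _ (P (Some x0)) setT measurableT tN mtN
    (fun n w _ => tN0 n w) nd.
  rewrite (_ : (\int[P (Some x0)]_w T w)%E = (\int[P (Some x0)]_w limn (tN ^~ w))%E); last first.
    by apply: eq_integral => w _; apply/esym/cvg_lim => //; exact: tNT.
  rewrite -(cvg_lim _ cv)//; apply: lime_le; first exact: cvgP cv.
  by apply: nearW => n; exact: up.
have Ifin : (\int[P (Some x0)]_w T w)%E \is a fin_num.
  by rewrite ge0_fin_numE ?integral_ge0// (le_lt_trans IA)// ltry.
(* Conversely [al * A <= (1 + al * Mu) * Q], and Q is at most [al] times the mean of [T] since 1 -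
   exp (- y) <= y. *)
apply/eqP; rewrite eq_le IA/= -(fineK Ifin) lee_fin.
apply: (small Mu) => //; first by rewrite fine_ge0// integral_ge0.
move=> al al0; rewrite -(ler_pM2l al0); have /andP[_ AQ] := SW al al0.
rewrite mulrCA (le_trans AQ)// ler_wpM2l ?addr_ge0 ?mulr_ge0 ?(ltW al0)//.
rewrite -lee_fin EFinM (fineK Ifin) -ge0_integralZl_EFin ?(ltW al0)//.
rewrite /Q /Rintegral fineK; last exact: integrable_fin_num (integrable_survival al0).
apply: ge0_le_integral => //.
- by move=> w _; rewrite lee_fin; have /andP[] := survival01 al0 w.
- by apply/measurable_EFinP; exact: measurable_survival.
- by apply: measurable_funeM.
- move=> w _; have [Toy|] := boolP (T w < +oo)%E.
    have ET : (fine (T w))%:E = T w by rewrite fineK// ge0_fin_numE.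
    by rewrite -[X in (_ * X)%E]ET -EFinM lee_fin survival_le.
  by rewrite -leNgt leye_eq => /eqP ->; rewrite mulry gtr0_sg// mul1e leey.
Unshelve. all: by end_near. Qed.

End mean_hitting_time.

(** * The star of a vertex *)

Section loop_curvature.
Variables (R : realType) (W : weighted_graph R).
Local Notation length e := (len e)%:num.
Local Notation conductance e := (cond e)%:num.
Implicit Types (val : vert W -> R) (kE : edge W -> R) (ES : seq (edge W))
  (VS : seq (vert W)).

(** The share of [e] in the vertex condition at [y]: conductance times the derivative at [y] into
    the edge. The loop at [y], with its two ends, adds [2 * cond * kap * length], whence the
    denominator in [with_loops]. *)
Definition outflow val kE y (e : edge W) : R :=
  conductance (inl e : loop_edge W) *
  ((src e == y)%:R * (slope val (inl e) + kE e * length (inl e : loop_edge W)) +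
   (tgt e == y)%:R * (- slope val (inl e) + kE e * length (inl e : loop_edge W))).

(* The curvature on the loop at y is the one that makes the vertex condition
   hold at y, whatever the function is on the other edges. *)
Definition with_loops ES val kE (e : loop_edge W) : R :=
  match e with
  | inl e => kE e
  | inr y => - (\sum_(e <- ES) outflow val kE y e) /
      (2 * conductance (inr y : loop_edge W) * length (inr y : loop_edge W))
  end.

Definition edges_loops ES VS : seq (loop_edge W) :=
  [seq inl e | e <- ES] ++ [seq inr y | y <- VS].

Lemma edges_loops_uniq ES VS : uniq ES -> uniq VS -> uniq (edges_loops ES VS).
Proof.
move=> uE uV; rewrite cat_uniq !map_inj_uniq; [|by move=> ? ? []..].
by rewrite uE uV andbT; apply/hasPn => _ /mapP[y _ ->]; apply/mapP => -[].
Qed.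

(** The term of the loop at [y] is the total outflow at [y] times [gam y]. After exchanging the
    sums, each edge meets only the loops at its two ends, and cancels them. *)
Lemma kirchhoff_with_loops ES VS val kE : uniq VS ->
  (forall e, e \in ES -> src e \in VS /\ tgt e \in VS) ->
  kirchhoff (edges_loops ES VS) val (with_loops ES val kE).
Proof.
move=> uV H gam; rewrite big_cat !big_map/=.
have -> : \sum_(y <- VS) (cond (inr y : loop_edge W))%:num *
    (dquad_edge val (with_loops ES val kE) (inr y) (length (inr y : loop_edge W)) * gam
      (ltgt (inr y : loop_edge W))
     - dquad_edge val (with_loops ES val kE) (inr y) 0 * gam (lsrc (inr y : loop_edge W))) =
   \sum_(y <- VS) \sum_(e <- ES) outflow val kE y e * gam y.
  apply: eq_bigr => y _; rewrite -mulr_suml /dquad_edge /slope /= subrr mul0r !add0r.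
  set s := \sum_(e <- ES) _; field.
  by rewrite !gt_eqF.
rewrite exchange_big/= -big_split/= big1_seq// => e /andP[_ eES].
have pick z : z \in VS -> forall c : R, \sum_(y <- VS) (z == y)%:R * c * gam y = c * gam z.
  move=> zV c; rewrite (bigD1_seq z)//= eqxx mul1r big1 ?addr0// => y yz.
  by rewrite eq_sym (negbTE yz) !mul0r.
have [sV tV] := H e eES.
rewrite (_ : \sum_(y <- VS) outflow val kE y e * gam y = conductance (inl e : loop_edge W) *
  ((slope val (inl e) + kE e * length (inl e : loop_edge W)) * gam (src e) +
   (- slope val (inl e) + kE e * length (inl e : loop_edge W)) * gam (tgt e))).
  by rewrite /dquad_edge/=; ring.
rewrite -(pick _ sV) -(pick _ tV) -big_split/= mulr_sumr.
by apply: eq_bigr => y _; rewrite /outflow; ring.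
Qed.

Lemma supported_with_loops ES VS val kE :
  (forall e, e \in ES -> src e \in VS /\ tgt e \in VS) ->
  (forall e, e \notin ES -> [/\ val (src e) = 0, val (tgt e) = 0 & kE e = 0]) ->
  (forall y, y \notin VS -> val y = 0) ->
  supported (edges_loops ES VS) val (with_loops ES val kE).
Proof.
move=> H HE HV [e|y]; rewrite mem_cat negb_or => /andP[i1 i2]/=.
  by apply: HE; apply: contra i1 => eE; apply/mapP; exists e.
have yV : y \notin VS by apply: contra i2 => yV; apply/mapP; exists y.
split; [exact: HV|exact: HV|].
rewrite big1_seq ?oppr0 ?mul0r// => e /andP[_ /H[sV tV]].
rewrite /outflow.
have -> : (src e == y) = false by apply/eqP => E; rewrite -E sV in yV.
have -> : (tgt e == y) = false by apply/eqP => E; rewrite -E tV in yV.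
by rewrite !mul0r addr0 mulr0.
Qed.

Lemma quad_bounded S val kap : supported S val kap ->
  exists2 M, 0 <= M & forall y, `|quad val kap y| <= M.
Proof.
move=> HS; pose K e := `|val (lsrc e)| + `|slope val e| * length e +
  `|kap e| * (length e * length e).
have K0 e : 0 <= K e by rewrite !addr_ge0// mulr_ge0.
exists (\sum_(e <- S) K e); first exact: sumr_ge0.
move=> y; have [e [s [/[dup] sl /andP[s0 sle] ->]]] := metric_graph_chart y.
rewrite quad_chart//; have [eS|eS] := boolP (e \in S); last first.
  by rewrite (quad_edge_unsupported s HS eS).1 normr0 sumr_ge0.
apply: (@le_trans _ _ (K e)); last first.
  by rewrite (big_rem e eS)/= lerDl sumr_ge0.
rewrite /quad_edge /K; apply: (le_trans (ler_normD _ _)); apply: lerD.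
  by apply: (le_trans (ler_normD _ _)); rewrite lerD2l normrM ler_wpM2l// ger0_norm.
rewrite !normrM ler_wpM2l// ler_pM// ger0_norm// ?subr_ge0// lerBlDr lerDl//.
Qed.

End loop_curvature.

(** * Indicators of open edges and of vertices are observable *)

Section indicators.
Variables (R : realType) (W : weighted_graph R).
Local Notation length e := (len e)%:num.

Lemma bump_gt0 (s l : R) : 0 < s < l -> 0 < s * (l - s).
Proof. by move=> /andP[s0 sl]; rewrite mulr_gt0// subr_gt0. Qed.

Lemma observable_cst (c : R) : observable (cst c : metric_graph W -> R).
Proof. by apply: observable_continuous; exact: cst_continuous. Qed.

(** The parabola on [e], extended by 0, is positive exactly on the open edge. *)
Lemma observable_open_edge (e : loop_edge W) :
  observable (fun y => if y \in open_edge e then 1 else 0 : R).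
Proof.
have := observable_pos (observable_continuous
  (@continuous_quad R W (fun=> 0) (fun e' => (e' == e)%:R))).
congr observable; apply/funext => -[z|[[e' s] H]] /=.
  by rewrite ltxx memNset.
rewrite /quad_edge /slope subrr !(mul0r, add0r).
case: eqP => ee'; first by rewrite mul1r bump_gt0// mem_set.
by rewrite mul0r ltxx memNset.
Qed.

(** The quadratic function chosen is 1 at [x] and smaller elsewhere. The coefficient -1 on the loops
    is there for the loop at [x], along which the interpolation alone would stay equal to 1; on the
    other edges the absence of graph loops ensures that at most one end has value 1. *)
Lemma observable_vertex (x : vert W) :
  observable (fun y => if y == vertex x then 1 else 0 : R).
Proof.
pose val z : R := (z == x)%:R.
pose kap (e : loop_edge W) : R := if is_loop e then -1 else 0.
have o1 := observableD (observable_cst 1)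
  (observableZ (-1) (observable_continuous (@continuous_quad R W val kap))).
have := observableD (observable_cst 1) (observableZ (-1) (observable_pos o1)).
congr observable; apply/funext => y /=.
suff -> : (0 < 1 + -1 * quad val kap y) = (y != vertex x).
  by case: eqP => _ /=; ring.
rewrite mulN1r subr_gt0; case: y => [z|[[e s] H]] /=.
  rewrite /val; have [->|zx] := eqVneq z x; first by rewrite ltxx eqxx.
  by rewrite ltr01; apply/esym/eqP => -[zx']; rewrite zx' eqxx in zx.
have /andP[s0 sl] := H; have l0 : 0 < length e := lt_trans s0 sl.
have b0 := bump_gt0 H; rewrite /quad_edge.
have -> : slope val e * s = (val (ltgt e) - val (lsrc e)) * (s / length e).
  by rewrite /slope mulrAC mulrA.
have t0 : 0 < s / length e by rewrite divr_gt0.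
have t1 : s / length e < 1 by rewrite ltr_pdivrMr// mul1r.
rewrite /kap /val; case: (e) (s / length e) b0 t0 t1 => [e'|z] t b0 t0 t1 /=.
  rewrite mul0r addr0.
  case: eqP => sx; case: eqP => tx /=; last 3 first; [lra..|].
  by case: (wgraph_no_loops (e := e')); rewrite sx tx.
rewrite subrr mul0r addr0 mulN1r; case: eqP => _ /=.
  by rewrite ltrBlDr ltrDl b0.
by rewrite sub0r (lt_trans _ ltr01)// oppr_lt0 b0.
Qed.

End indicators.

Section local_functions.
Variables (R : realType) (W : weighted_graph R).
Local Notation length e := (len e)%:num.

Lemma incident_edges (V : seq (vert W)) : exists2 ES : seq (edge W),
  uniq ES & forall e, (e \in ES) = (src e \in V) || (tgt e \in V).
Proof.
elim: V => [|z V [ES uES HES]]; first by exists [::].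
have /finite_seqP[s Hs] := wgraph_locally_finite z.
exists (undup (s ++ ES)); first exact: undup_uniq.
move=> e; rewrite mem_undup mem_cat HES !inE orbACA; congr (_ || _).
have -> : (e \in s) = `[< [set e | src e = z \/ tgt e = z] e >].
  by rewrite Hs; apply/idP/asboolP.
apply/asboolP/idP => /= [[->|->]|/orP[/eqP ?|/eqP ?]]; rewrite ?eqxx ?orbT//.
  by left.
by right.
Qed.

(** What makes finite support possible: at the outer ends of the edges of [ES] the value is 0 but
    the derivative need not be, and the loops there compensate for it. *)
Lemma local_kirchhoff (V : seq (vert W)) (ES : seq (edge W)) val kE :
  uniq ES -> (forall e, (e \in ES) = (src e \in V) || (tgt e \in V)) ->
  (forall z, z \notin V -> val z = 0) -> (forall e, e \notin ES -> kE e = 0) ->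
  exists S : seq (loop_edge W), [/\ uniq S, supported S val (with_loops ES val kE) &
    kirchhoff S val (with_loops ES val kE)].
Proof.
move=> uES HES HV HE.
(* The vertices whose loops are needed: those of [V] and the outer ends. *)
pose VS := undup (V ++ map (@src W) ES ++ map (@tgt W) ES).
have mVS e : e \in ES -> src e \in VS /\ tgt e \in VS.
  by move=> eE; rewrite !mem_undup !mem_cat !map_f ?orbT.
exists (edges_loops ES VS); split.
- by rewrite edges_loops_uniq// undup_uniq.
- apply: supported_with_loops => // [e eE|y].
    move: (eE); rewrite HES negb_or => /andP[sV tV].
    by split; [exact: HV|exact: HV|exact: HE].
  by rewrite mem_undup mem_cat negb_or => /andP[/HV].
- by apply: kirchhoff_with_loops => //; exact: undup_uniq.
Qed.

Variables (d : measure_display) (Omega : measurableType d).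
Variables (P : state W -> probability Omega R) (Y : R -> Omega -> state W).
Hypothesis AF : associated_with_form P Y.

(* The values of the source at the vertices do not affect its resolvent; c sets
   the one at x. *)
Lemma observable_source S val kap (al c : R) (x : vert W) :
  uniq S -> supported S val kap -> kirchhoff S val kap -> 0 < al ->
  exists f, [/\ observable f, exists M, forall y, `|f y| <= M,
    forall z, f (vertex z) = al * val z + (if z == x then c else 0),
    forall e s, 0 < s < length e ->
      f (chart e s) = al * quad_edge val kap e s + kap e / (dens e)%:num &
    resolvent P Y al f = quad val kap].
Proof.
move=> uS HS HK al0.
pose f y : R := al * quad val kap y +
  (\sum_(e <- S) kap e / (dens e)%:num * (if y \in open_edge e then 1 else 0) +
   c * (if y == vertex x then 1 else 0)).
have of_ : observable f.
  apply: observableD; first exact: (observableZ _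
    (observable_continuous (@continuous_quad _ _ _ _))).
  apply: observableD; last exact: (observableZ _ (@observable_vertex _ _ _)).
  by apply: observable_sum => e; exact: (observableZ _ (@observable_open_edge _ _ _)).
have fe e s : 0 < s < length e ->
    f (chart e s) = al * quad_edge val kap e s + kap e / (dens e)%:num.
  move=> H; rewrite /f quad_chart; last by case/andP: H => ? ?; rewrite !ltW.
  congr (_ + _); rewrite (chart_in H) mulr0 addr0.
  have [eS|eS] := boolP (e \in S).
    rewrite (bigD1_seq e)//= mem_set// mulr1 big1 ?addr0// => e' ee'.
    by rewrite memNset ?mulr0// => /= E; rewrite E eqxx in ee'.
  have [_ _ ->] := HS e eS; rewrite mul0r big_seq big1// => e' eS'.
  by rewrite memNset ?mulr0// => /= E; rewrite E eS' in eS.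
have bf : exists M, forall y, `|f y| <= M.
  have [M M0 bq] := quad_bounded HS.
  exists (al * M + (\sum_(e <- S) `|kap e / (dens e)%:num| + `|c|)) => y.
  have b1 (b : bool) (v : R) : `|v * (if b then 1 else 0)| <= `|v|.
    by case: b; rewrite ?mulr1// mulr0 normr0.
  rewrite (le_trans (ler_normD _ _))// lerD//.
    by rewrite normrM gtr0_norm// ler_pM2l.
  rewrite (le_trans (ler_normD _ _))// lerD//.
  by rewrite (le_trans (ler_norm_sum _ _ _))// ler_sum.
exists f; split => //.
- move=> z; rewrite /f/= big1 ?add0r; last by move=> e _; rewrite memNset ?mulr0.
  congr (_ + _); have [->|zx] := eqVneq z x; first by rewrite eqxx mulr1.
  by rewrite (_ : _ == _ = false) ?mulr0//; apply/eqP => -[zx']; rewrite zx' eqxx in zx.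
- apply: (resolvent_quad AF uS HS HK al0) => //.
  exact: observable_measurable.
Qed.

End local_functions.

(** * The function vanishing exactly at the neighbours, and the two sources *)

Section star_function.
Variables (R : realType) (W : weighted_graph R) (x : vert W) (xs : seq (vert W)).
Hypothesis xsP : forall y, y \in xs <-> neighbours x y.
Local Notation length e := (len e)%:num.

Lemma center_notin : x \notin xs.
Proof.
by apply/negP => /xsP[e [[sx tx]|[sx tx]]]; apply: (wgraph_no_loops (e := e)); rewrite sx tx.
Qed.

Definition touches (e : loop_edge W) := (lsrc e == x) || (ltgt e == x).

Lemma touches_ends e : touches e -> lsrc e \in x :: xs /\ ltgt e \in x :: xs.
Proof.
case: e => [e|y]; rewrite /touches/= !inE; last by rewrite orbb => ->.
case/orP => /eqP E; rewrite E eqxx/=; split=> //; apply/orP; right; apply/xsP; exists e.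
  by left.
by right.
Qed.

(** The vertex values alone would make [theta] vanish along the loops at the neighbours and along
    edges joining two neighbours; the coefficient -1 of [star_kap] away from [x] makes it negative
    there. *)
Definition star_val z : R := if z == x then 1 else if z \in xs then 0 else -1.
Definition star_kap e : R := if touches e then 0 else -1.
Definition theta := quad star_val star_kap.

Lemma theta_edge e s : 0 < s < length e ->
  if touches e then 0 < theta (chart e s) else theta (chart e s) < 0.
Proof.
move=> /[dup] H /andP[s0 sl]; rewrite /theta quad_chart; last by rewrite !ltW.
have b0 := bump_gt0 H; rewrite /quad_edge.
have -> : slope star_val e * s = (star_val (ltgt e) - star_val (lsrc e)) * (s / length e).
  by rewrite /slope mulrAC mulrA.
have l0 : 0 < length e := lt_trans s0 sl.
have t0 : 0 < s / length e by rewrite divr_gt0.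
have t1 : s / length e < 1 by rewrite ltr_pdivrMr// mul1r.
set t := s / length e in t0 t1 *; rewrite /star_kap; have [te|te] := boolP (touches e).
  rewrite mul0r addr0; have [sV tV] := touches_ends te.
  have : star_val (lsrc e) = 1 \/ star_val (ltgt e) = 1.
    by case/orP: te => /eqP E; [left|right]; rewrite /star_val E eqxx.
  have v0 z : z \in x :: xs -> 0 <= star_val z.
    by rewrite inE /star_val; case: eqP => //= _ ->.
  have := v0 _ sV; have := v0 _ tV; move: (star_val _) (star_val _) => a b b0' a0 H'.
  by have : 0 < a + (b - a) * t by case: H' => ->; nra.
move: te; rewrite negb_or => /andP[sx tx].
have v0 z : z != x -> star_val z <= 0.
  by rewrite /star_val => /negbTE ->; case: ifP.
have := v0 _ sx; have := v0 _ tx; move: (star_val _) (star_val _) => a b b0' a0.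
by rewrite mulN1r; nra.
Qed.

Lemma theta_eq0 y : theta y = 0 <-> [set vertex z | z in [set` xs]] y.
Proof.
split=> [|[z /= zxs <-]]; last first.
  rewrite /theta/= /star_val zxs ifN//.
  by apply: contraTneq zxs => ->; exact: center_notin.
case: y => [z|[[e s] H]].
  rewrite /theta/= /star_val; case: eqP => _; first by move/eqP; rewrite oner_eq0.
  case: ifP => [zxs _|_ /eqP]; first by exists z.
  by rewrite oppr_eq0 oner_eq0.
rewrite -(chart_in H) => t0; have := theta_edge H.
by rewrite t0 ltxx; case: ifP.
Qed.

Lemma theta_gt0 y : 0 < theta y -> y = vertex x \/
  exists e s, [/\ touches e, 0 < s < length e & y = chart e s].
Proof.
case: y => [z|[[e s] H]].
  rewrite /theta/= /star_val; case: eqP => [-> _|_]; first by left.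
  by case: ifP; rewrite ?ltxx// ltr0N1.
rewrite -(chart_in H) => t0; right; exists e, s; split => //.
by have := theta_edge H; case: ifP => // _ /(lt_trans t0); rewrite ltxx.
Qed.

Variables (d : measure_display) (Omega : measurableType d).
Variables (P : state W -> probability Omega R) (Y : R -> Omega -> state W).
Hypothesis AF : associated_with_form P Y.

Lemma locally_constant_source al : 0 < al -> exists f M,
  [/\ observable f, forall y, `|f y| <= M, forall y, 0 < theta y -> f y = al &
      forall y, y \in vertex x :: map (@vertex R W) xs -> resolvent P Y al f y = 1].
Proof.
move=> al0; have [ES uES HES] := incident_edges (x :: xs).
pose val z : R := if z \in x :: xs then 1 else 0; pose kE (e : edge W) : R := 0.
have [S [uS HS HK]] : exists S : seq (loop_edge W), [/\ uniq S,
    supported S val (with_loops ES val kE) & kirchhoff S val (with_loops ES val kE)].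
  by apply: (local_kirchhoff uES HES) => // z /negbTE zV; rewrite /val zV.
(* No correction at [x]: the source is already [al * 1] there. *)
have [f [of_ [M bf] fv fe rf]] := observable_source AF 0 x uS HS HK al0.
have slope0 e : touches e -> slope val e = 0.
  by move=> /touches_ends[sV tV]; rewrite /slope /val sV tV subrr mul0r.
(* All edges at [x] are flat, so nothing flows out of [x] and its loop is flat too; the loops at the
   neighbours need not be. *)
have kap0 e : touches e -> with_loops ES val kE e = 0.
  case: e => //= y; rewrite /touches/= orbb => /eqP ->.
  rewrite big1 ?oppr0 ?mul0r// => e _; rewrite /outflow /kE mul0r !addr0.
  have [te|] := boolP (touches (inl e)); first by rewrite slope0// oppr0 !mulr0 addr0 mulr0.
  by rewrite negb_or /= => /andP[/negbTE -> /negbTE ->]; rewrite !mul0r addr0 mulr0.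
exists f, M; split => //.
- move=> y /theta_gt0[->|[e [s [te H ->]]]].
    by rewrite fv /val inE eqxx/= mulr1 addr0.
  rewrite fe// kap0// mul0r addr0 /quad_edge slope0// kap0// !mul0r !addr0.
  by rewrite /val (touches_ends te).1 mulr1.
- move=> y yV; rewrite rf; have [z zV ->] : exists2 z, z \in x :: xs & y = vertex z.
    by move: yV; rewrite -[_ :: _]/(map _ (x :: xs)) => /mapP.
  by rewrite /= /val zV.
Qed.

Definition star_mean : R :=
  (\sum_(e \in star_loop x) (dens e)%:num * qcond e * (len e)%:num) /
  (\sum_(e \in star x) qcond e / (len e)%:num).

(** The quadratic function u behind the source does not depend on [al], so one bound [Mu] serves in
    the limit [al -> 0]. Where [theta > 0] the source is [1 + al * u]. *)
Lemma linear_source : xs != [::] -> exists2 Mu, 0 <= Mu & forall al, 0 < al -> exists f M,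
  [/\ observable f, forall y, `|f y| <= M,
      forall y, 0 < theta y -> 1 <= f y <= 1 + al * Mu,
      forall y, y \in map (@vertex R W) xs -> resolvent P Y al f y = 0 &
      resolvent P Y al f (vertex x) = star_mean].
Proof.
move=> xs0; have [ES uES HES] := incident_edges [:: x].
have ESP e : (e \in ES) = touches (inl e) by rewrite HES !inE.
have starE : star x = [set` map inl ES].
  apply/seteqP; split => e.
    move=> [e' /= H <-]; rewrite map_f// ESP /touches/=.
    by case: H => ->; rewrite eqxx ?orbT.
  move=> /= /mapP[e' + ->]; rewrite ESP => /orP[/eqP H|/eqP H]; exists e' => //.
    by left.
  by right.
have uS1 : uniq (map inl ES : seq (loop_edge W)) by rewrite map_inj_uniq// => ? ? [].
pose a e : R := (cond (inl e : loop_edge W))%:num / length (inl e : loop_edge W).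
pose b e : R := (dens (inl e : loop_edge W))%:num * (cond (inl e : loop_edge W))%:num *
  length (inl e : loop_edge W).
have denE : \sum_(e \in star x) qcond e / (len e)%:num = \sum_(e <- ES) a e.
  by rewrite starE -fsbig_seq// big_map.
have numE : \sum_(e \in star_loop x) (dens e)%:num * qcond e * (len e)%:num =
  (dens (inr x : loop_edge W))%:num * (2 * (cond (inr x : loop_edge W))%:num) * length
    (inr x : loop_edge W)
  + \sum_(e <- ES) b e.
  have -> : star_loop x = [set` inr x :: map inl ES].
    rewrite /star_loop starE; apply/seteqP; split => e /=; rewrite inE.
      by case=> [->|->]; rewrite ?eqxx ?orbT.
    by case/orP => [/eqP ->|]; [left|right].
  rewrite -fsbig_seq; first by rewrite big_cons big_map.
  by rewrite cons_uniq uS1 andbT; apply/mapP => -[].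
have den0 : 0 < \sum_(e <- ES) a e.
  case: xs xs0 xsP => [//|y l] _ yP.
  have [e ey] := (yP y).1 (mem_head _ _).
  have eES : e \in ES.
    by rewrite ESP /touches/=; case: ey => -[-> ->]; rewrite eqxx ?orbT.
  rewrite (big_rem e eES)/= ltr_pwDl ?divr_gt0//.
  by apply: sumr_ge0 => e' _; rewrite divr_ge0.
have A0 : 0 <= star_mean.
  rewrite /star_mean denE numE; apply: divr_ge0; last exact: (ltW den0).
  apply: addr_ge0; first by rewrite !mulr_ge0.
  by apply: sumr_ge0 => e _; rewrite !mulr_ge0.
set A := star_mean in A0 *.
(* The vertex condition at [x] when the curvature is the density on every edge at [x], loop
   included; the value [A] at [x] is its solution. *)
have AE : A * \sum_(e <- ES) a e = (dens (inr x : loop_edge W))%:num *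
  (2 * (cond (inr x : loop_edge W))%:num) * length (inr x : loop_edge W)
  + \sum_(e <- ES) b e.
  by rewrite /A /star_mean denE numE divfK// gt_eqF.
pose val z : R := if z == x then A else 0.
pose kE (e : edge W) : R := if e \in ES then (dens (inl e : loop_edge W))%:num else 0.
have [S [uS HS HK]] : exists S : seq (loop_edge W), [/\ uniq S,
    supported S val (with_loops ES val kE) & kirchhoff S val (with_loops ES val kE)].
  apply: (local_kirchhoff uES HES) => [z|e /negbTE eE]; last by rewrite /kE eE.
  by rewrite inE /val => /negbTE ->.
have kapE e : touches e -> with_loops ES val kE e = (dens e)%:num.
  case: e => [e|y] /=; first by rewrite -ESP /kE => ->.
  rewrite /touches/= orbb => /eqP ->.
  (* Into an edge at [x], the parabola has derivative density times length, giving [b e], and the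
     descent from [A] to 0 has derivative - A / length, giving [- A * a e]. *)
  have -> : \sum_(e <- ES) outflow val kE x e = \sum_(e <- ES) (b e - A * a e).
    apply: eq_big_seq => e eES; have := eES; rewrite ESP /touches /outflow /slope /val /kE
      eES /b /a/=.
    have st := wgraph_no_loops (e := e).
    case: eqP => sx; case: eqP => tx //= _.
    - by case: st; rewrite sx tx.
    - by field; rewrite gt_eqF.
    - by field; rewrite gt_eqF.
  rewrite sumrB -mulr_sumr AE; set s := \sum_(e <- ES) b e.
  by field; rewrite !gt_eqF.
have [Mu Mu0 bq] := quad_bounded HS.
exists Mu => // al al0.
(* The correction 1 at [x] makes the formula [1 + al * u] valid at [x] too, so that the bounds hold
   at every point of the star. *)
have [f [of_ [M bf] fv fe rf]] := observable_source AF 1 x uS HS HK al0.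
exists f, M; split => //.
- have bnd v : 0 <= v <= Mu -> 1 <= al * v + 1 <= 1 + al * Mu.
    by move=> /andP[v0 vM]; rewrite lerDr mulr_ge0 ?(ltW al0)//= addrC lerD2l ler_pM2l.
  move=> y /theta_gt0[->|[e [s [te H ->]]]].
    rewrite fv eqxx; apply: bnd.
    by have := bq (vertex x); rewrite /= /val eqxx A0 ger0_norm.
  rewrite fe// kapE// divff ?gt_eqF//; apply: bnd.
  have Hs : 0 <= s <= length e by case/andP: H => ? ?; rewrite !ltW.
  have := bq (chart e s); rewrite quad_chart// => /(le_trans (ler_norm _)) ->.
  rewrite andbT /quad_edge kapE//; apply: addr_ge0; last first.
    by apply: mulr_ge0 => //; exact/ltW/bump_gt0.
  have v0 z : 0 <= val z by rewrite /val; case: ifP.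
  have -> : slope val e * s = (val (ltgt e) - val (lsrc e)) * (s / length e).
    by rewrite /slope mulrAC mulrA.
  have t0 : 0 <= s / length e by rewrite divr_ge0//; case/andP: Hs.
  have t1 : s / length e <= 1 by rewrite ler_pdivrMr// mul1r; case/andP: Hs.
  have := v0 (lsrc e); have := v0 (ltgt e); nra.
- move=> _ /mapP[z zxs ->]; rewrite rf/= /val ifN//.
  by apply: contraTneq zxs => ->; exact: center_notin.
- by rewrite rf/= /val eqxx.
Qed.

End star_function.

Theorem theorem2p2 (R : realType) (W : weighted_graph R)
    (d : measure_display) (Omega : measurableType d)
    (P : state W -> probability Omega R) (Y : R -> Omega -> state W)
    (BM : brownian_motion P Y)
    (x : vert W) (k : nat) (k_ge1 : (1 <= k)%N) (xs : k.-tuple (vert W))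
    (xs_uniq : uniq xs) (xsP : forall y, y \in xs <-> neighbours x y) :
  (\int[P (Some (vertex x))]_w
     hitting_time Y [set vertex y | y in [set` xs]] w)%E =
  ((\sum_(e \in star_loop x) (dens e)%:num * qcond e * (len e)%:num) /
   (\sum_(e \in star x) qcond e / (len e)%:num))%:E.
Proof.
have [D AF] := BM.
have FE : [set vertex y | y in [set` xs]] = [set y | theta x xs y = 0].
  by apply/seteqP; split => y /(theta_eq0 xsP).
rewrite FE.
have xs0 : tval xs != [::] by rewrite -size_eq0 size_tuple -lt0n.
have [Mu Mu0 H2] := linear_source xsP AF xs0.
apply: (@mean_hitting_time _ _ _ _ _ _ D _ _ (map (@vertex R W) xs) _ _ _ _ _ _ Mu) => //.
- exact: continuous_quad.
- by rewrite map_inj_uniq// => y z [].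
- by move=> y /(theta_eq0 xsP)[z zxs <-]; exact: map_f.
- by move=> _ /mapP[z _ ->]; exact: observable_vertex.
- by rewrite /theta/= /star_val eqxx.
- exact: (locally_constant_source xsP AF).
Qed.
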